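(* Let $A=A_0$. There are isomorphisms of commutative graded algebras $${\rm HH}^{*}(A)/\mathcal N_A\simeq {\rm HH}^{4*}(A)\simeq K[z_0,z_1,z_2,z_3,z_4]/\langle z_0z_2-z_1^2,\ z_0z_3-z_1z_2,\ z_0z_4-z_2^2,\ z_0z_4-z_1z_3,\ z_1z_4-z_2z_3,\ z_2z_4-z_3^2\rangle,$$ where each $z_j$ ($0\le j\le 4$) has degree $4$. Therefore ${\rm HH}^*(A)/\mathcal N_A$ is finitely generated as an algebra.
   Context: $K$ is an algebraically closed field. $\Gamma$ is the quiver with four vertices $0,1,2,3$ and eight arrows $a_i,b_i$ ($0\le i\le 3$), where $a_i$ and $b_i$ both go from $i$ to $i+1$ (indices modulo $4$); paths are written from left to right. In the path algebra $K\Gamma$ put $x=\sum_{i=0}^3 a_i$ and $y=\sum_{i=0}^3 b_i$. The algebra $A=A_0$ is $K\Gamma/\langle xy,\ x^{2}+y^{2},\ yx\rangle$. With $A^{\rm e}=A^{\rm op}\otimes_K A$, the Hochschild cohomology ring is ${\rm HH}^*(A)=\bigoplus_{t\ge 0}{\rm Ext}^t_{A^{\rm e}}(A,A)$ with the Yoneda product, ${\rm HH}^t(A)={\rm Ext}^t_{A^{\rm e}}(A,A)$. $\mathcal N_A$ is the ideal of ${\rm HH}^*(A)$ generated by all homogeneous nilpotent elements. ${\rm HH}^{4*}(A)$ is the graded subalgebra $\bigoplus_{i\ge 0}{\rm HH}^{4i}(A)$ of ${\rm HH}^*(A)$. *)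

(* Defs.v *)
From HB Require Import structures.
From mathcomp Require Import all_boot all_order all_algebra.
From mathcomp Require Import boolp functions.
From mathcomp Require Import mpoly.

Set Implicit Arguments.
Unset Strict Implicit.
Unset Printing Implicit Defensive.
Import GRing.Theory.
Local Open Scope ring_scope.
Local Open Scope quotient_scope.

Section Submodules.
Variables (K : fieldType) (V : lmodType K).

Record submod := Submod {
  mem_submod :> V -> Prop;
  submod0 : mem_submod 0;
  submodP : forall a u v,
    mem_submod u -> mem_submod v -> mem_submod (a *: u + v)
}.

Implicit Types (I : submod) (u v : V).

Definition submod_pred (I : submod) : {pred V} := [pred v | `[< I v >]].

Lemma submod_predP I v : reflect (I v) (v \in submod_pred I).
Proof. exact: asboolP. Qed.

Fact submod_pred_closed I : GRing.subsemimod_closed (submod_pred I).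
Proof.
apply: GRing.submod_closed_semi; split; first exact/submod_predP/submod0.
by move=> a u v /submod_predP Iu /submod_predP Iv; exact/submod_predP/submodP.
Qed.
HB.instance Definition _ I :=
  GRing.isSubmodClosed.Build K V (submod_pred I) (submod_pred_closed I).

Record submod_of (I : submod) :=
  SubmodOf { submod_val : V; _ : submod_val \in submod_pred I }.
HB.instance Definition _ I := [isSub for @submod_val I].
HB.instance Definition _ I := [Choice of submod_of I by <:].
HB.instance Definition _ I := [SubChoice_isSubZmodule of submod_of I by <:].
HB.instance Definition _ I := [SubZmodule_isSubLmodule of submod_of I by <:].

Lemma submod_valP I (x : submod_of I) : I (val x).
Proof. exact/submod_predP/(valP x). Qed.

Definition to_submod I v (Iv : I v) : submod_of I :=
  SubmodOf (introT (submod_predP I v) Iv).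

Definition quot_mod (I : submod) : Type := Quotient.quot (submod_pred I).
Section QuotMod.
Variable I : submod.
HB.instance Definition _ := Choice.on (quot_mod I).
HB.instance Definition _ := GRing.Zmodule.on (quot_mod I).

Definition proj (v : V) : quot_mod I :=
  \pi_(Quotient.quot (submod_pred I)) v.

Lemma proj_eqP u v : proj u = proj v <-> I (u - v).
Proof.
split=> [/eqP|Iuv]; last by apply/eqP; rewrite -Quotient.idealrBE; apply/submod_predP.
by rewrite /proj -Quotient.idealrBE => /submod_predP.
Qed.

Lemma proj_surj x : exists v, x = proj v.
Proof. by exists (repr x); rewrite /proj reprK. Qed.

Lemma projD u v : proj (u + v) = proj u + proj v.
Proof. exact: (raddfD (\pi_(Quotient.quot (submod_pred I)))). Qed.

Definition lift_rep (x : quot_mod I) : V := repr (x : Quotient.quot (submod_pred I)).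
Lemma lift_repK x : proj (lift_rep x) = x. Proof. exact: reprK. Qed.

Definition scaleq a (x : quot_mod I) := proj (a *: lift_rep x).

Lemma projZ a u : proj (a *: u) = scaleq a (proj u).
Proof.
apply/proj_eqP; rewrite -scalerBr -[_ *: _]addr0; apply: submodP; last exact: submod0.
by apply/proj_eqP; rewrite lift_repK.
Qed.

Fact scaleqA a b x : scaleq a (scaleq b x) = scaleq (a * b) x.
Proof. by rewrite -[x]lift_repK -!projZ scalerA. Qed.
Fact scaleq1 : left_id 1 scaleq.
Proof. by move=> x; rewrite -[x]lift_repK -projZ scale1r. Qed.
Fact scaleqDr : right_distributive scaleq +%R.
Proof.
by move=> a x y; rewrite -[x]lift_repK -[y]lift_repK -projD -!projZ scalerDr projD.
Qed.
Fact scaleqDl x : {morph scaleq^~ x : a b / a + b}.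
Proof. by move=> a b; rewrite -[x]lift_repK -!projZ scalerDl projD. Qed.
HB.instance Definition _ := GRing.Zmodule_isLmodule.Build K (quot_mod I)
  scaleqA scaleq1 scaleqDr scaleqDl.

Fact proj_is_linear : linear proj.
Proof. by move=> a u v; rewrite projD projZ. Qed.
HB.instance Definition _ := GRing.isLinear.Build K V (quot_mod I) _ proj proj_is_linear.
End QuotMod.
End Submodules.

Section Algebras.
Variable K : fieldType.
Implicit Types R S : algType K.

Definition two_sided_ideal R (I : R -> Prop) : Prop :=
  [/\ I 0, forall x y, I x -> I y -> I (x + y),
      forall r x, I x -> I (r * x) & forall r x, I x -> I (x * r)].

Definition ideal_gen R (G : R -> Prop) (x : R) : Prop :=
  forall I : R -> Prop, two_sided_ideal I -> (forall g, G g -> I g) -> I x.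

Fact ideal_gen0 R (G : R -> Prop) : ideal_gen G 0.
Proof. by move=> I [I0 _ _ _] _. Qed.

Fact ideal_genP R (G : R -> Prop) a u v :
  ideal_gen G u -> ideal_gen G v -> ideal_gen G (a *: u + v).
Proof.
move=> Gu Gv I HI HG; have [_ ID Il _] := HI.
apply: ID; last exact: Gv.
by rewrite -[u]mul1r scalerAl; apply/Il; exact: Gu.
Qed.

Definition ideal_submod R (G : R -> Prop) : submod R :=
  Submod (@ideal_gen0 R G) (@ideal_genP R G).

Lemma ideal_gen_ideal R (G : R -> Prop) : two_sided_ideal (ideal_gen G).
Proof.
split; first exact: ideal_gen0.
- by move=> x y Gx Gy; rewrite -[x]scale1r; exact: ideal_genP.
- by move=> r x Gx I HI HG; have [_ _ Il _] := HI; apply: Il; exact: Gx.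
- by move=> r x Gx I HI HG; have [_ _ _ Ir] := HI; apply: Ir; exact: Gx.
Qed.

(* A set of generators of a proper ideal; the quotient is then nonzero, as
   the library requires of an algType. *)
Record proper_gens R := ProperGens {
  gens :> R -> Prop;
  gens_proper : ~ ideal_gen gens 1
}.

Lemma proper_gensP R (G : R -> Prop) (I : R -> Prop) :
  two_sided_ideal I -> (forall g, G g -> I g) -> ~ I 1 -> ~ ideal_gen G 1.
Proof. by move=> HI HG I1 G1; apply: I1; exact: G1. Qed.

(* The quotient of R by the two-sided ideal generated by G. *)
Definition quot_alg R (G : proper_gens R) : Type := quot_mod (ideal_submod G).

Section QuotAlg.
Variables (R : algType K) (G : proper_gens R).
HB.instance Definition _ := GRing.Lmodule.on (quot_alg G).

Definition qproj (r : R) : quot_alg G := proj (ideal_submod G) r.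
HB.instance Definition _ := GRing.isLinear.Build K R (quot_alg G) _ qproj
  (@proj_is_linear _ _ (ideal_submod G)).

Lemma qproj_eqP u v : qproj u = qproj v <-> ideal_gen G (u - v).
Proof. exact: proj_eqP. Qed.

Lemma qproj_surj x : exists v, x = qproj v.
Proof. exact: proj_surj. Qed.

Definition mulq (x y : quot_alg G) : quot_alg G :=
  qproj (lift_rep x * lift_rep y).

Fact qprojM : {morph qproj : x y / x * y >-> mulq x y}.
Proof.
move=> x y; apply/qproj_eqP.
set x' := lift_rep _; set y' := lift_rep _.
have -> : x * y - x' * y' = x * (y - y') + (x - x') * y'.
  by rewrite mulrBr mulrBl addrA subrK.
have [_ ID Il Ir] := ideal_gen_ideal G.
by apply: ID; [apply: Il | apply: Ir]; apply/qproj_eqP;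
   rewrite [RHS]lift_repK.
Qed.

Let qK x : qproj (lift_rep x) = x. Proof. exact: lift_repK. Qed.

Fact mulqA : associative mulq.
Proof. by move=> x y z; rewrite -[x]qK -[y]qK -[z]qK -!qprojM mulrA. Qed.
Fact mul1q : left_id (qproj 1) mulq.
Proof. by move=> x; rewrite -[x]qK -!qprojM mul1r. Qed.
Fact mulq1 : right_id (qproj 1) mulq.
Proof. by move=> x; rewrite -[x]qK -!qprojM mulr1. Qed.
Fact mulqDl : left_distributive mulq +%R.
Proof.
by move=> x y z; rewrite -[x]qK -[y]qK -[z]qK -raddfD -!qprojM -raddfD mulrDl.
Qed.
Fact mulqDr : right_distributive mulq +%R.
Proof.
by move=> x y z; rewrite -[x]qK -[y]qK -[z]qK -raddfD -!qprojM -raddfD mulrDr.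
Qed.
Fact oneq_neq0 : qproj 1 != 0.
Proof.
rewrite -(raddf0 qproj); apply/eqP => /qproj_eqP; rewrite subr0.
exact: gens_proper.
Qed.
HB.instance Definition _ := GRing.Zmodule_isNzRing.Build (quot_alg G)
  mulqA mul1q mulq1 mulqDl mulqDr oneq_neq0.

HB.instance Definition _ := GRing.isMonoidMorphism.Build R (quot_alg G) qproj
  (erefl, qprojM).

Let qM x y : qproj (x * y) = qproj x * qproj y. Proof. exact: rmorphM. Qed.
Let qZ a x : qproj (a *: x) = a *: qproj x. Proof. exact: linearZ. Qed.

Fact scaleqAl (a : K) (x y : quot_alg G) : a *: (x * y) = (a *: x) * y.
Proof.
by rewrite -[x]qK -[y]qK -qM -!qZ -qM scalerAl.
Qed.
HB.instance Definition _ :=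
  GRing.Lmodule_isLalgebra.Build K (quot_alg G) scaleqAl.
Fact scaleqAr (a : K) (x y : quot_alg G) : a *: (x * y) = x * (a *: y).
Proof. by rewrite -[x]qK -[y]qK -qM -!qZ -qM scalerAr. Qed.
HB.instance Definition _ :=
  GRing.Lalgebra_isAlgebra.Build K (quot_alg G) scaleqAr.
End QuotAlg.
End Algebras.

Record quiver := Quiver {
  qvert : finType;
  qarr : finType;
  qsrc : qarr -> qvert;
  qtgt : qarr -> qvert;
  qvert0 : qvert
}.

Section PathAlgebra.
Variables (K : fieldType) (Q : quiver).

(* A path is its initial vertex together with its arrows, read from left to
   right; the pair (v, [::]) is the trivial path at v. *)
Definition qpair : Type := (qvert Q * seq (qarr Q))%type.

Fixpoint is_walk (v : qvert Q) (s : seq (qarr Q)) : bool :=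
  if s is e :: s' then (qsrc e == v) && is_walk (qtgt e) s' else true.

Definition walk_end (v : qvert Q) (s : seq (qarr Q)) : qvert Q :=
  last v (map (@qtgt Q) s).

(* The underlying space of KQ: finitely supported functions on the set of
   paths, extended by 0 to all pairs (v, s). *)
Definition path_supp (f : qpair -> K^o) : Prop :=
  (forall p, f p != 0 -> is_walk p.1 p.2) /\
  (exists s : seq qpair, forall p, f p != 0 -> p \in s).

Lemma is_walk_cat v s t :
  is_walk v (s ++ t) = is_walk v s && is_walk (walk_end v s) t.
Proof. by elim: s v => //= e s IHs v; rewrite IHs andbA. Qed.

Fact path_supp0 : path_supp 0.
Proof. by split=> [p|]; [|exists [::] => p]; rewrite eqxx. Qed.

Fact path_suppP a f g :
  path_supp f -> path_supp g -> path_supp (a *: f + g).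
Proof.
move=> [wf [s sf]] [wg [t tg]].
have fgE p : (a *: f + g) p != 0 -> (f p != 0) || (g p != 0).
  apply: contraNT; rewrite negb_or !negbK => /andP[/eqP f0 /eqP g0].
  by rewrite [X in X == _](_ : _ = a *: f p + g p) // f0 g0 scaler0 addr0.
split=> [p /fgE/orP[/wf|/wg]//|]; exists (s ++ t) => p /fgE.
by rewrite mem_cat => /orP[/sf->|/tg->]; rewrite ?orbT.
Qed.

Definition path_submod : submod (qpair -> K^o) :=
  Submod path_supp0 path_suppP.

Definition path_alg : Type := submod_of path_submod.
HB.instance Definition _ := Choice.on path_alg.
HB.instance Definition _ := GRing.Lmodule.on path_alg.

Definition pcoef (f : path_alg) : qpair -> K := val f.

Lemma path_alg_eq (f g : path_alg) : (forall p, pcoef f p = pcoef g p) -> f = g.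
Proof. by move=> fg; apply/val_inj/funext. Qed.

(* Multiplication is concatenation of paths: the coefficient at p of f * g is
   the sum of f q * g r over all factorizations p = q r. *)
Definition pconv (f g : qpair -> K) (p : qpair) : K :=
  \sum_(0 <= k < (size p.2).+1)
    f (p.1, take k p.2) * g (walk_end p.1 (take k p.2), drop k p.2).

Fact pconv_supp (f g : qpair -> K^o) :
  path_supp f -> path_supp g -> path_supp (pconv f g).
Proof.
move=> [wf [s sf]] [wg [t tg]].
have fgE p : pconv f g p != 0 ->
    exists k, f (p.1, take k p.2) != 0 /\
              g (walk_end p.1 (take k p.2), drop k p.2) != 0.
  move=> fgp; apply: contrapT => /forallNP np; move/eqP: fgp; apply.
  rewrite /pconv big1_seq // => k _; apply/eqP; rewrite mulf_eq0 -[_ || _]negbK.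
  by rewrite negb_or; apply/negP => /andP[fk gk]; apply: (np k).
split=> [[v u] /fgE[k [/wf/= w1 /wg/= w2]]|].
  by rewrite -(cat_take_drop k u) is_walk_cat w1.
exists [seq (q.1, q.2 ++ r.2) | q <- s, r <- t] => -[v u] /fgE[k [/sf/= sk /tg/= tk]].
by apply/allpairsP; exists ((v, take k u), (walk_end v (take k u), drop k u)); split => //=;
  rewrite cat_take_drop.
Qed.

Definition pmul (f g : path_alg) : path_alg :=
  @to_submod _ _ path_submod _ (pconv_supp (submod_valP f) (submod_valP g)).

(* The sum of the trivial paths. *)
Definition pone_fun (p : qpair) : K^o := (nilp p.2)%:R.
Fact pone_supp : path_supp pone_fun.
Proof.
split=> [[v [|e s]]|]; rewrite /pone_fun /= ?eqxx //.
exists [seq (v, [::]) | v <- enum (qvert Q)] => -[v [|e s]]; rewrite /= ?eqxx // => _.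
by apply/mapP; exists v; rewrite ?mem_enum.
Qed.
Definition pone : path_alg := @to_submod _ _ path_submod _ pone_supp.

Lemma pcoef_mul f g p : pcoef (pmul f g) p = pconv (pcoef f) (pcoef g) p.
Proof. by []. Qed.

Lemma triangle_sum (F : nat -> nat -> K) n :
  \sum_(0 <= k < n.+1) \sum_(0 <= j < k.+1) F j k =
  \sum_(0 <= j < n.+1) \sum_(0 <= i < (n - j).+1) F j (j + i)%N.
Proof.
elim: n => [|n IHn]; first by rewrite !big_nat1.
rewrite big_nat_recr //= IHn [RHS]big_nat_recr //= subnn big_nat1 addn0.
rewrite [\sum_(0 <= j < n.+2) F j n.+1]big_nat_recr //= addrA -big_split /=.
congr (_ + _); rewrite !big_mkord; apply: eq_bigr => -[j /= ltj] _.
by rewrite subSn // [RHS]big_nat_recr //= addnS subnKC.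
Qed.

Lemma walk_end_cat v s t : walk_end v (s ++ t) = walk_end (walk_end v s) t.
Proof. by rewrite /walk_end map_cat last_cat. Qed.

Fact pmulA : associative pmul.
Proof.
move=> f g h; apply: path_alg_eq => -[v s]; rewrite !pcoef_mul /pconv /=.
symmetry.
transitivity (\sum_(0 <= k < (size s).+1) \sum_(0 <= j < k.+1)
   pcoef f (v, take j s) * (pcoef g (walk_end v (take j s), drop j (take k s)) *
   pcoef h (walk_end v (take k s), drop k s))).
  apply: eq_big_nat => k /andP[_ lek]; rewrite pcoef_mul /pconv /= mulr_suml.
  rewrite size_take_min (minn_idPl _) //; apply: eq_big_nat => j /andP[_ lej].
  by rewrite take_takel // mulrA.
rewrite triangle_sum; apply: eq_big_nat => j /andP[_ lej].
rewrite pcoef_mul /pconv /= mulr_sumr size_drop; apply: eq_big_nat => i /andP[_ lei].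
by rewrite drop_drop takeD walk_end_cat -takeD take_drop (addnC i j).
Qed.

Fact pmul1 : left_id pone pmul.
Proof.
move=> f; apply: path_alg_eq => -[v s]; rewrite pcoef_mul /pconv /=.
rewrite big_nat_recl //= take0 drop0 mul1r big1_seq ?addr0 // => k /andP[_].
rewrite mem_index_iota => /andP[_ ltk]; rewrite /pcoef /= /pone_fun /=.
by case: s ltk => //= e s _; rewrite mul0r.
Qed.

Fact pmul1r : right_id pone pmul.
Proof.
move=> f; apply: path_alg_eq => -[v s]; rewrite pcoef_mul /pconv /=.
rewrite big_nat_recr //= take_size drop_size mulr1 big1_seq ?add0r // => k /andP[_].
rewrite mem_index_iota => /andP[_ ltk]; rewrite /pcoef /= /pone_fun /=.
by rewrite /nilp size_drop subn_eq0 leqNgt ltk mulr0.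
Qed.

Fact pmulDl : left_distributive pmul +%R.
Proof.
move=> f g h; apply: path_alg_eq => p; rewrite pcoef_mul /pconv.
rewrite [RHS](_ : _ = pcoef (pmul f h) p + pcoef (pmul g h) p) //.
rewrite !pcoef_mul /pconv -big_split /=; apply: eq_bigr => k _.
by rewrite -mulrDl.
Qed.

Fact pmulDr : right_distributive pmul +%R.
Proof.
move=> f g h; apply: path_alg_eq => p; rewrite pcoef_mul /pconv.
rewrite [RHS](_ : _ = pcoef (pmul f g) p + pcoef (pmul f h) p) //.
rewrite !pcoef_mul /pconv -big_split /=; apply: eq_bigr => k _.
by rewrite -mulrDr.
Qed.

Fact pone_neq0 : pone != 0.
Proof.
apply/eqP => /(congr1 (fun f => pcoef f (qvert0 Q, [::]))) /eqP.
by rewrite [X in _ == X](_ : _ = 0) // oner_eq0.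
Qed.

HB.instance Definition _ := GRing.Zmodule_isNzRing.Build path_alg
  pmulA pmul1 pmul1r pmulDl pmulDr pone_neq0.

Fact pscaleAl (a : K) (f g : path_alg) : a *: (f * g) = (a *: f) * g.
Proof.
apply: path_alg_eq => p; rewrite [RHS]pcoef_mul /pconv.
rewrite [LHS](_ : _ = a * pconv (pcoef f) (pcoef g) p) // /pconv mulr_sumr.
by apply: eq_bigr => k _; rewrite mulrA.
Qed.
HB.instance Definition _ :=
  GRing.Lmodule_isLalgebra.Build K path_alg pscaleAl.
Fact pscaleAr (a : K) (f g : path_alg) : a *: (f * g) = f * (a *: g).
Proof.
apply: path_alg_eq => p; rewrite [RHS]pcoef_mul /pconv.
rewrite [LHS](_ : _ = a * pconv (pcoef f) (pcoef g) p) // /pconv mulr_sumr.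
by apply: eq_bigr => k _; rewrite mulrCA.
Qed.
HB.instance Definition _ :=
  GRing.Lalgebra_isAlgebra.Build K path_alg pscaleAr.

(* The arrow e as an element of KQ. *)
Definition arrow_fun (e : qarr Q) (p : qpair) : K^o :=
  (p == (qsrc e, [:: e]))%:R.
Fact arrow_supp e : path_supp (arrow_fun e).
Proof.
split=> [p|]; rewrite /arrow_fun.
  by have [->|_] := eqVneq p _; rewrite /= ?eqxx.
by exists [:: (qsrc e, [:: e])] => p; rewrite inE; case: (p == _); rewrite ?eqxx.
Qed.
Definition arrow (e : qarr Q) : path_alg :=
  @to_submod _ _ path_submod _ (arrow_supp e).
End PathAlgebra.

Section TheAlgebra.
Variable K : closedFieldType.

(* The arrow a_i is (i, false) and b_i is (i, true). *)
Definition Gamma : quiver :=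
  @Quiver 'Z_4 ('Z_4 * bool)%type (fun e => e.1) (fun e => e.1 + 1) 0.

Definition xA : path_alg K Gamma := \sum_(i : 'Z_4) arrow K (Q := Gamma) (i, false).
Definition yA : path_alg K Gamma := \sum_(i : 'Z_4) arrow K (Q := Gamma) (i, true).

Definition relA (r : path_alg K Gamma) : Prop :=
  [\/ r = xA * yA, r = xA ^+ 2 + yA ^+ 2 | r = yA * xA].

Let no_short (d : nat) (f : path_alg K Gamma) : Prop :=
  forall p, (size p.2 < d)%N -> pcoef f p = 0.

Fact no_short_ideal d : two_sided_ideal (no_short d).
Proof.
split=> [p _ //|f g If Ig p ltp|f g Ig p ltp|f g Ig p ltp].
- by rewrite [LHS](_ : _ = pcoef f p + pcoef g p) // If // Ig // addr0.
- rewrite [LHS]pcoef_mul /pconv big1_seq // => k _; rewrite Ig ?mulr0 //=.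
  by rewrite size_drop (leq_ltn_trans (leq_subr _ _)).
- rewrite [LHS]pcoef_mul /pconv big1_seq // => k _; rewrite Ig ?mul0r //=.
  by rewrite size_take_min (leq_ltn_trans (geq_minr _ _)).
Qed.

Fact no_short_mul f g : no_short 1 f -> no_short 1 g -> no_short 1 (f * g).
Proof. by move=> If Ig; have [_ _ Il _] := no_short_ideal 1; apply: Il. Qed.

Fact no_short_arrows c : no_short 1 (\sum_(i : 'Z_4) arrow K (Q := Gamma) (i, c)).
Proof.
have [I0 ID _ _] := no_short_ideal 1.
apply: (big_ind (no_short 1)) => // i _ [v [|//]] _.
by rewrite /pcoef /= /arrow_fun; case: eqP.
Qed.

Fact relA_proper : ~ ideal_gen relA 1.
Proof.
have [_ ID _ _] := no_short_ideal 1.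
have [Ix Iy] := (no_short_arrows false, no_short_arrows true).
apply: (proper_gensP (no_short_ideal 1)) => [g|].
  by case=> ->; [|apply: ID|]; rewrite ?expr2; apply: no_short_mul.
move=> /(_ (0, [::]) isT) /eqP.
by rewrite [X in X == _](_ : _ = 1) // oner_eq0.
Qed.

Definition algA : algType K := quot_alg (ProperGens relA_proper).
End TheAlgebra.

Section Bimodules.
Variables (K : fieldType) (A : algType K).

(* A module over A^e = A^op (x)_K A is the same thing as an A-A-bimodule on
   which K acts centrally. *)
Record bimodule := Bimodule {
  bimod_sort :> lmodType K;
  lact : A -> bimod_sort -> bimod_sort;
  ract : bimod_sort -> A -> bimod_sort;
  lact_linear : forall a, linear (lact a);
  lact_linearl : forall m, linear (lact^~ m);
  lact1 : forall m, lact 1 m = m;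
  lactM : forall a b m, lact (a * b) m = lact a (lact b m);
  ract_linear : forall a, linear (ract^~ a);
  ract_linearr : forall m, linear (ract m);
  ract1 : forall m, ract m 1 = m;
  ractM : forall m a b, ract m (a * b) = ract (ract m a) b;
  lractA : forall a m b, lact a (ract m b) = ract (lact a m) b
}.

Definition bihom (M N : bimodule) (f : M -> N) : Prop :=
  [/\ linear f, forall a m, f (lact a m) = lact a (f m)
    & forall m a, f (ract m a) = ract (f m) a].

Definition projective (P : bimodule) : Prop :=
  forall (M N : bimodule) (p : M -> N) (f : P -> N),
    bihom p -> (forall n, exists m, p m = n) -> bihom f ->
    exists2 g : P -> M, bihom g & forall x, p (g x) = f x.

Record proj_resolution (M : bimodule) := ProjResolution {
  res :> nat -> bimodule;
  diff : forall n, res n.+1 -> res n;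
  aug : res 0 -> M;
  res_projective : forall n, projective (res n);
  diff_bihom : forall n, bihom (@diff n);
  aug_bihom : bihom aug;
  aug_surj : forall m, exists x, aug x = m;
  res_exact0 : forall x, aug x = 0 <-> exists y, diff y = x;
  res_exactS : forall n (x : res n.+1), diff x = 0 <-> exists y, diff y = x
}.

Fact reg_lact_linear (a : A) : linear ( *%R a : A -> A).
Proof. by move=> k u v; rewrite mulrDr scalerAr. Qed.
Fact reg_ract_linear (a : A) : linear (fun x : A => x * a).
Proof. by move=> k u v; rewrite mulrDl scalerAl. Qed.

(* A as a module over A^e. *)
Definition reg_bimod : bimodule :=
  @Bimodule A (fun a x => a * x) (fun x a => x * a)
    reg_lact_linear reg_ract_linear (@mul1r A)
    (fun a b m => esym (mulrA a b m)) reg_ract_linear reg_lact_linear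
    (@mulr1 A) (fun m a b => mulrA m a b) (fun a m b => mulrA a m b).

Section Hom.
Variables M N L : bimodule.
Implicit Types f g : M -> N.

Lemma bihomD f u v : bihom f -> f (u + v) = f u + f v.
Proof. by case=> lf _ _; rewrite -[u]scale1r lf !scale1r. Qed.
Lemma bihom0 f : bihom f -> f 0 = 0.
Proof. by move=> hf; apply: (addIr (f 0)); rewrite -bihomD // !add0r. Qed.
Lemma bihomB f u v : bihom f -> f (u - v) = f u - f v.
Proof. by case=> lf _ _; rewrite addrC -scaleN1r lf scaleN1r addrC. Qed.
Lemma bihom_sum f I r (P : pred I) F : bihom f ->
  f (\sum_(i <- r | P i) F i) = \sum_(i <- r | P i) f (F i).
Proof.
move=> hf; apply: (big_morph f) => [u v|]; [exact: bihomD|exact: bihom0].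
Qed.

Lemma bihom_cst0 : bihom (fun _ : M => 0 : N).
Proof.
split=> [k u v|a m|m a]; first by rewrite scaler0 addr0.
  have := lact_linear a 0 (0 : N); move/(_ (0 : N)) => e.
  by have := lact_linear a (-1) (0 : N) 0; rewrite scaler0 addr0 scaleN1r addNr.
by have := ract_linear a (-1) (0 : N) 0; rewrite scaler0 addr0 scaleN1r addNr.
Qed.

Lemma bihomP k f g : bihom f -> bihom g -> bihom (fun x => k *: f x + g x).
Proof.
move=> [lf fl fr] [lg gl gr]; split=> [c u v|a m|m a].
- by rewrite lf lg !scalerDr !scalerA [k * c]mulrC -!addrA; congr (_ + _); rewrite addrCA.
- by rewrite fl gl lact_linear.
- by rewrite fr gr ract_linear.
Qed.

Lemma bihom_comp f (h : N -> L) : bihom f -> bihom h -> bihom (fun x => h (f x)).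
Proof.
move=> [lf fl fr] [lh hl hr]; split=> [c u v|a m|m a].
- by rewrite lf lh.
- by rewrite fl hl.
- by rewrite fr hr.
Qed.
End Hom.

Lemma bihom_id (M : bimodule) : bihom (fun x : M => x).
Proof. by []. Qed.

Section HomSub.
Variables M N : bimodule.
Implicit Types f g : M -> N.
Lemma bihom_sub f g : bihom f -> bihom g -> bihom (fun x => f x - g x).
Proof.
move=> hf hg; have := bihomP (-1) hg hf.
by congr bihom; apply/funext => x; rewrite scaleN1r addrC.
Qed.
Lemma bihom_add f g : bihom f -> bihom g -> bihom (fun x => f x + g x).
Proof.
move=> hf hg; have := bihomP 1 hf hg.
by congr bihom; apply/funext => x; rewrite scale1r.
Qed.
Lemma bihom_bigsum I (r : seq I) (F : I -> M -> N) :
  (forall i, bihom (F i)) -> bihom (fun x => \sum_(i <- r) F i x).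
Proof.
move=> hF; elim: r => [|i r IHr].
  by have := bihom_cst0 M N; congr bihom; apply/funext => x; rewrite big_nil.
have := bihom_add (hF i) IHr.
by congr bihom; apply/funext => x; rewrite big_cons.
Qed.
End HomSub.

Section Image.
Variables (M N : bimodule) (p : M -> N) (hp : bihom p).
Let im n := exists m, p m = n.
Fact im0 : im 0. Proof. by exists 0; rewrite bihom0. Qed.
Fact imP k u v : im u -> im v -> im (k *: u + v).
Proof. by case: hp => lp _ _ [m <-] [n <-]; exists (k *: m + n); rewrite lp. Qed.
Definition im_submod : submod N := Submod im0 imP.

Fact im_lact a n : im n -> im (lact a n).
Proof. by case: hp => _ pl _ [m <-]; exists (lact a m). Qed.
Fact im_ract n a : im n -> im (ract n a).
Proof. by case: hp => _ _ pr [m <-]; exists (ract m a). Qed.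

Let T := submod_of im_submod.
Let l a (x : T) : T := to_submod (I := im_submod) (im_lact a (submod_valP x)).
Let r (x : T) a : T := to_submod (I := im_submod) (im_ract a (submod_valP x)).

Definition im_bimod : bimodule.
Proof.
refine (@Bimodule T l r _ _ _ _ _ _ _ _ _).
- by move=> a k u v; apply: val_inj; rewrite /= lact_linear.
- by move=> m k a b; apply: val_inj; rewrite /= lact_linearl.
- by move=> m; apply: val_inj; rewrite /= lact1.
- by move=> a b m; apply: val_inj; rewrite /= lactM.
- by move=> a k u v; apply: val_inj; rewrite /= ract_linear.
- by move=> m k a b; apply: val_inj; rewrite /= ract_linearr.
- by move=> m; apply: val_inj; rewrite /= ract1.
- by move=> m a b; apply: val_inj; rewrite /= ractM.
- by move=> a m b; apply: val_inj; rewrite /= lractA.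
Defined.

Lemma projective_lift (P : bimodule) (f : P -> N) :
  projective P -> bihom f -> (forall x, exists m, p m = f x) ->
  exists2 g : P -> M, bihom g & forall x, p (g x) = f x.
Proof.
move=> projP hf fim.
pose p' (m : M) : im_bimod := to_submod (I := im_submod) (ex_intro _ m erefl).
pose f' (x : P) : im_bimod := to_submod (I := im_submod) (fim x).
have hp' : bihom p'.
  by case: hp => lp pl pr; split=> [k u v|a m|m a]; apply: val_inj; rewrite /= ?lp ?pl ?pr.
have hf' : bihom f'.
  by case: hf => lf fl fr; split=> [k u v|a m|m a]; apply: val_inj; rewrite /= ?lf ?fl ?fr.
have [|g hg gE] := projP _ _ p' f' hp' _ hf'.
  by move=> y; have [m pm] := submod_valP y; exists m; apply: (@val_inj _ _ T); exact: pm.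
by exists g => // x; have /(congr1 val) := gE x.
Qed.
End Image.
End Bimodules.

Section Ext.
Variables (K : fieldType) (A : algType K) (M : bimodule A).
Variable P : proj_resolution M.
Local Notation eps := (@aug _ _ _ P).

(* A family of maps c_n : P_n -> M, as one function on the disjoint union of
   the P_n; the component c_n is cpt c n. *)
Definition cochain : Type := {n : nat & P n} -> M.
Definition cpt (c : cochain) n (x : P n) : M := c (existT _ n x).

Definition cocycle_fam (c : cochain) : Prop :=
  (forall n, bihom (@cpt c n)) /\ (forall n (x : P n.+1), cpt c (diff x) = 0).

(* The elements of the direct sum over n of
   ker (Hom_(A^e)(P_n, M) -> Hom_(A^e)(P_(n+1), M)). *)
Definition cocycle (c : cochain) : Prop :=
  cocycle_fam c /\
  (exists N, forall n, (N <= n)%N -> forall x : P n, cpt c x = 0).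

(* Each c_n lies in the image of Hom_(A^e)(P_(n-1), M). *)
Definition coboundary (c : cochain) : Prop :=
  (forall x : P 0, cpt c x = 0) /\
  (forall n, exists2 b : P n -> M, bihom b &
     forall x : P n.+1, cpt c x = b (diff x)).

Lemma cptP a (u v : cochain) n (x : P n) : cpt (a *: u + v) x = a *: cpt u x + cpt v x.
Proof. by []. Qed.

Fact cocycle0 : cocycle 0.
Proof. by split; [split=> // n; exact: bihom_cst0|exists 0]. Qed.

Lemma cocycle_famP a (u v : cochain) :
  cocycle_fam u -> cocycle_fam v -> cocycle_fam (a *: u + v).
Proof.
move=> [hu du] [hv dv]; split=> [n|n x]; first exact: bihomP.
by rewrite cptP du dv scaler0 addr0.
Qed.

Fact cocycleP a (u v : cochain) : cocycle u -> cocycle v -> cocycle (a *: u + v).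
Proof.
move=> [cu [m mP]] [cv [n nP]]; split; first exact: cocycle_famP.
exists (maxn m n) => k; rewrite geq_max => /andP[lemk lenk] x.
by rewrite cptP mP // nP // scaler0 addr0.
Qed.
Definition cocycle_submod : submod cochain := Submod cocycle0 cocycleP.
Definition cocycles : Type := submod_of cocycle_submod.
HB.instance Definition _ := GRing.Lmodule.on cocycles.

Lemma coboundary0 : coboundary 0.
Proof. by split=> // n; exists (fun=> 0) => //; exact: bihom_cst0. Qed.
Lemma coboundaryP a (u v : cochain) :
  coboundary u -> coboundary v -> coboundary (a *: u + v).
Proof.
move=> [u0 uS] [v0 vS]; split=> [x|n].
  by rewrite cptP u0 v0 scaler0 addr0.
have [[b hb bE] [b' hb' bE']] := (uS n, vS n).
exists (fun x => a *: b x + b' x) => [|x]; first exact: bihomP.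
by rewrite cptP bE bE'.
Qed.
Definition coboundary_submod : submod cocycles :=
  @Submod K cocycles (fun c => coboundary (val c)) coboundary0
    (fun a u v => @coboundaryP a (val u) (val v)).

(* The direct sum over t of Ext^t_(A^e)(M, M) = H^t(Hom_(A^e)(P, M)). *)
Definition ext : Type := quot_mod coboundary_submod.
HB.instance Definition _ := GRing.Lmodule.on ext.
Definition cls (c : cocycles) : ext := proj coboundary_submod c.
HB.instance Definition _ := GRing.isLinear.Build K cocycles ext _ cls
  (@proj_is_linear _ _ coboundary_submod).

Lemma cls_eqP (u v : cocycles) : cls u = cls v <-> coboundary (val u - val v).
Proof. exact: proj_eqP. Qed.
Lemma cls_surj x : exists c, x = cls c.
Proof. exact: proj_surj. Qed.

(* Elements of ext supported in the degrees that satisfy D. *)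
Definition ext_supp (D : pred nat) (z : ext) : Prop :=
  exists2 c : cocycles, z = cls c &
    forall n, ~~ D n -> forall x : P n, cpt (val c) x = 0.

(* The summand Ext^t. *)
Definition ext_deg (t : nat) : ext -> Prop := ext_supp (pred1 t).

(* f lifts c through the augmentation: the components of f from P_(n+m) to
   P_n, n >= 0, form a chain map over c_m : P_m -> M. *)
Record chain_lift (c : cochain) (f : forall n k, P n -> P k) : Prop := {
  lift_bihom : forall n k, bihom (f n k);
  lift_low : forall n k, (n < k)%N -> forall x, f n k x = 0;
  lift_aug : forall n x, eps (f n 0 x) = cpt c x;
  lift_diff : forall n k (x : P n.+1), diff (f n.+1 k.+1 x) = f n k (diff x)
}.

Definition yoneda_lift (c : cochain) (f : forall n k, P n -> P k) : Prop :=
  chain_lift c f /\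
  (forall n k, (k <= n)%N -> (forall x : P (n - k)%N, cpt c x = 0) ->
     forall x, f n k x = 0).

Lemma augD (x : P 1) : eps (diff x) = 0.
Proof. by apply/res_exact0; exists x. Qed.
Lemma diffD n (x : P n.+2) : diff (diff x) = 0.
Proof. by apply/res_exactS; exists x. Qed.

Definition cyc k : P k -> Prop :=
  match k return P k -> Prop with
  | 0 => fun y => eps y = 0
  | k'.+1 => fun y => diff y = 0
  end.

Lemma cycP k (y : P k) : cyc y <-> exists z, diff z = y.
Proof. by case: k y => [|k] y; [exact: res_exact0|exact: res_exactS]. Qed.

Lemma lift_ex (Q : bimodule A) k (g : Q -> P k) : projective Q -> bihom g ->
  (forall x, cyc (g x)) ->
  exists g' : Q -> P k.+1, [/\ bihom g', forall x, diff (g' x) = g x &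
    (forall x, g x = 0) -> forall x, g' x = 0].
Proof.
move=> projQ hg cg; have [g0|g0] := pselect (forall x, g x = 0).
  exists (fun=> 0); split=> // [|x]; first exact: bihom_cst0.
  by rewrite g0 bihom0 //; exact: diff_bihom.
have [x|g' hg' gE] := projective_lift (@diff_bihom _ _ _ P k) projQ hg.
  exact/cycP.
by exists g'.
Qed.

Lemma aug_lift_ex (Q : bimodule A) (g : Q -> M) : projective Q -> bihom g ->
  exists g' : Q -> P 0, [/\ bihom g', forall x, eps (g' x) = g x &
    (forall x, g x = 0) -> forall x, g' x = 0].
Proof.
move=> projQ hg; have [g0|g0] := pselect (forall x, g x = 0).
  exists (fun=> 0); split=> // [|x]; first exact: bihom_cst0.
  by rewrite g0 bihom0 //; exact: aug_bihom.
have [x|g' hg' gE] := projective_lift (aug_bihom P) projQ hg.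
  exact: aug_surj.
by exists g'.
Qed.

Definition row k := forall n, P n -> P k.

Definition pre k (h : row k) n : P n -> P k :=
  match n return P n -> P k with
  | 0 => fun=> 0
  | m.+1 => fun x => h m (diff x)
  end.

Lemma pre_bihom k (h : row k) n :
  (forall m, bihom (h m)) -> bihom (@pre k h n).
Proof.
move=> hh; case: n => [|n]; first exact: bihom_cst0.
exact: (bihom_comp (@diff_bihom _ _ _ P n) (hh n)).
Qed.

Lemma rows_ex (Inv : forall k, row k -> Prop)
    (step : forall k, row k -> row k.+1 -> Prop) (r0 : row 0) :
  Inv 0 r0 ->
  (forall k (r : row k), Inv k r -> exists r', Inv k.+1 r' /\ step k r r') ->
  exists f : forall k, row k,
    [/\ f 0 = r0, forall k, Inv k (f k) & forall k, step k (f k) (f k.+1)].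
Proof.
move=> I0 IS.
pose nxt k (r : {r | Inv k r}) : {r' | Inv k.+1 r'} :=
  let e := cid (IS k (sval r) (svalP r)) in exist _ (sval e) (svalP e).1.
pose F := fix F k : {r | Inv k r} :=
  if k is k'.+1 then nxt k' (F k') else exist _ r0 I0.
exists (fun k => sval (F k)); split=> // k; first exact: svalP.
by rewrite /=; case: cid => r' [].
Qed.

Lemma yoneda_lift_ex (c : cochain) : cocycle_fam c -> exists f, yoneda_lift c f.
Proof.
move=> [hc dc].
have [r0 r0P] : exists r0 : row 0, forall n, [/\ bihom (r0 n),
    forall x, eps (r0 n x) = cpt c x &
    (forall x : P n, cpt c x = 0) -> forall x, r0 n x = 0].
  have ex0 n := cid (aug_lift_ex (@res_projective _ _ _ P n) (hc n)).
  by exists (fun n => sval (ex0 n)) => n; exact: (svalP (ex0 n)).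
pose Inv k (r : row k) := (forall n, bihom (r n)) /\
  (forall n (x : P n.+1), cyc (r n (diff x))).
pose step k (r : row k) (r' : row k.+1) :=
  [/\ forall n x, diff (r' n x) = pre r x
    & forall n, (forall x, @pre k r n x = 0) -> forall x, r' n x = 0].
have I0 : Inv 0 r0.
  split=> [n|n x]; first by have [] := r0P n.
  by have [_ /= -> _] := r0P n.
have IS k (r : row k) : Inv k r -> exists r', Inv k.+1 r' /\ step k r r'.
  move=> [hr cr].
  have ex n : exists g' : P n -> P k.+1, [/\ bihom g',
     forall x, diff (g' x) = @pre k r n x &
     (forall x, @pre k r n x = 0) -> forall x, g' x = 0].
    apply: lift_ex; [exact: res_projective|exact: pre_bihom|].
    case: n => [|n] x /=; last exact: cr.
    by apply/cycP; exists 0; rewrite bihom0 //; exact: diff_bihom.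
  exists (fun n => sval (cid (ex n))); split; split=> n.
  - by case: cid => g' /= [].
  - move=> x /=; case: cid => g' /= [_ gE _]; rewrite gE; case: n x {g' gE} => //= n x.
    by rewrite diffD bihom0.
  - by move=> x; case: cid => g' /= [].
  - by case: cid => g' /= [].
have [f [f0 fI fS]] := rows_ex I0 IS.
have fE n k (x : P n.+1) : diff (f k.+1 n.+1 x) = f k n (diff x).
  by have [-> _] := fS k.
exists (fun n k => f k n); split; first split=> //.
- by move=> n k; have [] := fI k.
- move=> n k; elim: k n => // k IHk [|n] ltnk x; have [_ ->] := fS k => //= y.
  exact: IHk.
- by move=> n x; rewrite f0; have [_ ->] := r0P n.
move=> n k; elim: k n => [|k IHk] [|n] // lekn c0 x.
- by rewrite f0; have [_ _ ->] := r0P 0.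
- by rewrite f0; have [_ _ ->] := r0P n.+1.
- by have [_ ->] := fS k => //= y; apply: IHk.
Qed.

Definition ycomp (u : cochain) (f : forall n k, P n -> P k) : cochain :=
  fun p => \sum_(0 <= k < (projT1 p).+1) cpt u (f (projT1 p) k (projT2 p)).

Lemma cpt_ycomp u f n (x : P n) :
  cpt (ycomp u f) x = \sum_(0 <= k < n.+1) cpt u (f n k x).
Proof. by []. Qed.

Lemma ycomp_cocycle (u v : cochain) f :
  cocycle_fam u -> chain_lift v f -> cocycle_fam (ycomp u f).
Proof.
move=> [hu du] [hf lf af df]; split=> [n|n x].
  apply: (@bihom_bigsum _ _ (P n) M _ (index_iota 0 n.+1)
    (fun k x => cpt u (f n k x))) => k.
  exact: bihom_comp.
rewrite cpt_ycomp big1_seq // => k _; rewrite -df; exact: du.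
Qed.

Lemma ycomp_coboundaryl (u v : cochain) f :
  coboundary u -> chain_lift v f -> coboundary (ycomp u f).
Proof.
move=> [u0 uS] [hf lf af df]; split=> [x|n].
  by rewrite cpt_ycomp big_nat1 u0.
pose b m := s2val (cid2 (uS m)).
have bP m : bihom (b m) /\ forall x : P m.+1, cpt u x = b m (diff x).
  by split; [exact: (s2valP (cid2 (uS m)))|exact: (s2valP' (cid2 (uS m)))].
exists (fun y => \sum_(0 <= k < n.+1) b k (f n k y)) => [|x].
  apply: (@bihom_bigsum _ _ _ _ _ _ (fun k y => b k (f n k y))) => k.
  by apply: bihom_comp => //; have [] := bP k.
rewrite cpt_ycomp big_nat_recl //= u0 add0r; apply: eq_bigr => k _.
by have [_ ->] := bP k; rewrite df.
Qed.

Lemma ycomp_coboundaryr (u v : cochain) f :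
  cocycle_fam u -> coboundary v -> chain_lift v f -> coboundary (ycomp u f).
Proof.
move=> [hu du] [v0 vS] [hf lf af df].
pose b m := s2val (cid2 (vS m)).
have bP m : bihom (b m) /\ forall x : P m.+1, cpt v x = b m (diff x).
  by split; [exact: (s2valP (cid2 (vS m)))|exact: (s2valP' (cid2 (vS m)))].
have ex0 n : exists g' : P n -> P 0, bihom g' /\ forall x, eps (g' x) = b n x.
  have [hb _] := bP n.
  by have [g' [? ? _]] := aug_lift_ex (@res_projective _ _ _ P n) hb; exists g'.
pose h0 : row 0 := fun n => sval (cid (ex0 n)).
pose Inv k (h : row k) := (forall n, bihom (h n)) /\
  (forall n x, cyc (f n k x - @pre k h n x)).
pose step k (h : row k) (h' : row k.+1) :=
  forall n x, diff (h' n x) = f n k x - @pre k h n x.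
have I0 : Inv 0 h0.
  split=> [n|[|n] x] /=; first by rewrite /h0; case: cid => g' /= [].
    by rewrite subr0 af v0.
  rewrite (bihomB _ _ (aug_bihom P)) af /h0; case: cid => g' /= [_ gE]; rewrite gE.
  by have [_ ->] := bP n; rewrite subrr.
have IS k (h : row k) : Inv k h -> exists h', Inv k.+1 h' /\ step k h h'.
  move=> [hh ch].
  have ex n : exists g' : P n -> P k.+1, bihom g' /\
     forall x, diff (g' x) = f n k x - @pre k h n x.
    have [||g' [? ? _]] := @lift_ex (P n) k (fun x => f n k x - @pre k h n x)
      (@res_projective _ _ _ P n); [|exact: ch|by exists g'].
    by apply: bihom_sub => //; exact: pre_bihom.
  exists (fun n => sval (cid (ex n))); split; last first.
    by move=> n x; case: cid => g' /= [].
  split=> [n|[|n] x] /=; first by case: cid => g' /= [].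
    by rewrite subr0 lf // bihom0 //; exact: diff_bihom.
  rewrite (bihomB _ _ (@diff_bihom _ _ _ P k)) df; case: cid => g' /= [_ gE].
  rewrite gE; case: n x {g' gE} => [|n] x /=; first by rewrite subr0 subrr.
  by rewrite diffD bihom0 // subr0 subrr.
have [h [_ hI hS]] := rows_ex I0 IS.
have fE n k x : f n k x = diff (h k.+1 n x) + @pre k (h k) n x.
  by rewrite hS subrK.
have uf n k x : cpt u (f n k x) = cpt u (@pre k (h k) n x).
  by rewrite fE (bihomD _ _ (hu k)) du add0r.
split=> [x|n].
  by rewrite cpt_ycomp big_nat1 uf /= (bihom0 (hu 0)).
exists (fun y => \sum_(0 <= k < n.+2) cpt u (h k n y)) => [|x].
  apply: (@bihom_bigsum _ _ _ _ _ _ (fun k y => cpt u (h k n y))) => k.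
  by apply: bihom_comp => //; have [] := hI k.
by rewrite cpt_ycomp; apply: eq_bigr => k _; rewrite uf.
Qed.

Lemma chain_liftP a (u v : cochain) f g : chain_lift u f -> chain_lift v g ->
  chain_lift (a *: u + v) (fun n k x => a *: f n k x + g n k x).
Proof.
move=> [hf lf af df] [hg lg ag dg]; split=> [n k|n k lt x|n x|n k x].
- exact: bihomP.
- by rewrite lf // lg // scaler0 addr0.
- by have [lau _ _] := aug_bihom P; rewrite lau af ag.
- by have [ldi _ _] := @diff_bihom _ _ _ P k; rewrite ldi df dg.
Qed.

Lemma ycompDl a (u v : cochain) f : ycomp (a *: u + v) f = a *: ycomp u f + ycomp v f.
Proof.
apply/funext => -[n x]; rewrite -![_ (existT _ n x)]/(cpt _ x).
by rewrite cptP !cpt_ycomp scaler_sumr -big_split.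
Qed.

Lemma ycompDr a (u : cochain) f g : cocycle_fam u ->
  ycomp u (fun n k x => a *: f n k x + g n k x) = a *: ycomp u f + ycomp u g.
Proof.
move=> [hu _]; apply/funext => -[n x]; rewrite -![_ (existT _ n x)]/(cpt _ x).
rewrite cptP !cpt_ycomp scaler_sumr -big_split /=; apply: eq_bigr => k _.
by have [-> _ _] := hu k.
Qed.

Lemma ycomp_uniq (u v v' : cochain) f f' : cocycle_fam u ->
  chain_lift v f -> chain_lift v' f' -> coboundary (v - v') ->
  coboundary (ycomp u f - ycomp u f').
Proof.
move=> cu lf lf' bv; rewrite addrC -scaleN1r -ycompDr //.
apply: ycomp_coboundaryr (chain_liftP (-1) lf' lf) => //.
by rewrite scaleN1r addrC.
Qed.

Lemma chain_lift_comp (v w : cochain) f g : cocycle_fam v -> chain_lift v f -> chain_lift w g ->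
  chain_lift (ycomp v g) (fun n k x => \sum_(0 <= j < n.+1) f j k (g n j x)).
Proof.
move=> cv [hf lf af df] [hg lg ag dg]; split=> [n k|n k lt x|n x|n k x].
- apply: (@bihom_bigsum _ _ _ _ _ _ (fun j x => f j k (g n j x))) => j.
  exact: bihom_comp.
- rewrite big1_seq // => j /andP[_]; rewrite mem_index_iota => /andP[_ lej].
  by rewrite lf // (leq_trans lej).
- rewrite (bihom_sum _ _ _ (aug_bihom P)) cpt_ycomp; apply: eq_bigr => j _.
  by rewrite af.
- rewrite (bihom_sum _ _ _ (@diff_bihom _ _ _ P k)) big_nat_recl //=.
  rewrite lf // bihom0 ?add0r; last exact: diff_bihom.
  by apply: eq_bigr => j _; rewrite df dg.
Qed.

Lemma ycompA (u : cochain) f g : cocycle_fam u ->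
  (forall n k, (n < k)%N -> forall x, f n k x = 0) ->
  ycomp (ycomp u f) g =
  ycomp u (fun n k x => \sum_(0 <= j < n.+1) f j k (g n j x)) :> cochain.
Proof.
move=> [hu du] lf; apply/funext => -[n x]; rewrite -![_ (existT _ n x)]/(cpt _ x).
rewrite !cpt_ycomp.
under [RHS]eq_bigr => k _ do rewrite (bihom_sum _ _ _ (hu k)).
rewrite exchange_big_nat /=; apply: eq_big_nat => j /andP[_ lej].
rewrite cpt_ycomp [RHS](@big_cat_nat _ _ _ j.+1) //= [X in _ + X]big1_seq ?addr0 //.
move=> k /andP[_]; rewrite mem_index_iota => /andP[ltjk _].
by rewrite lf // (bihom0 (hu k)).
Qed.

Definition idl n k : P n -> P k :=
  match @eqP _ n k with
  | ReflectT e => fun x => ecast m (P m) e x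
  | ReflectF _ => fun=> 0
  end.

Lemma idl_id n x : @idl n n x = x.
Proof. by rewrite /idl; case: eqP => // e; rewrite eq_axiomK. Qed.
Lemma idl_neq n k x : n != k -> @idl n k x = 0.
Proof. by rewrite /idl; case: eqP => // e; rewrite e eqxx. Qed.

(* The class of the augmentation in Ext^0. *)
Definition unit_cochain : cochain := fun p =>
  match p with existT 0 x => eps x | existT _ _ => 0 end.

Lemma unit_cocycle : cocycle unit_cochain.
Proof.
split; first split=> [[|n]|[|n] x] //.
- exact: aug_bihom.
- exact: bihom_cst0.
- exact: augD.
- by exists 1 => -[].
Qed.

Lemma idl_lift : chain_lift unit_cochain idl.
Proof.
split=> [n k|n k lt x|[|n] x|n k x].
- have [->|nk] := eqVneq n k.
    have := @bihom_id _ _ (P k); congr bihom; apply/funext => x.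
    by rewrite idl_id.
  have := bihom_cst0 (P n) (P k); congr bihom; apply/funext => x.
  by rewrite idl_neq.
- by rewrite idl_neq // ltn_eqF.
- by rewrite idl_id.
- by rewrite idl_neq // (bihom0 (aug_bihom P)).
- have [e|nk] := eqVneq n k; first by case: k / e; rewrite !idl_id.
  by rewrite !idl_neq // (bihom0 (@diff_bihom _ _ _ P k)).
Qed.

Lemma ycomp_idl u : cocycle_fam u -> ycomp u idl = u.
Proof.
move=> [hu _]; apply/funext => -[n x]; rewrite -![_ (existT _ n x)]/(cpt _ x).
rewrite cpt_ycomp big_nat_recr //= idl_id big1_seq ?add0r // => k /andP[_].
rewrite mem_index_iota => /andP[_ ltk].
by rewrite idl_neq ?(bihom0 (hu k)) // gtn_eqF.
Qed.

Lemma ycomp_unit v f : chain_lift v f -> ycomp unit_cochain f = v.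
Proof.
move=> [hf lf af df]; apply/funext => -[n x].
rewrite -![_ (existT _ n x)]/(cpt _ x) cpt_ycomp big_nat_recl //=.
by rewrite big1_seq // addr0 -af.
Qed.

Lemma cocycles_fam (c : cocycles) : cocycle_fam (val c).
Proof. by have [] := submod_valP c. Qed.

Definition some_lift (c : cocycles) : forall n k, P n -> P k :=
  sval (cid (yoneda_lift_ex (cocycles_fam c))).

Lemma some_liftP c : yoneda_lift (val c) (some_lift c).
Proof. exact: svalP. Qed.

Lemma some_lift_lift c : chain_lift (val c) (some_lift c).
Proof. by have [] := some_liftP c. Qed.

Lemma ycomp_supp (u v : cocycles) (D D' : pred nat) :
  (forall n, ~~ D n -> forall x : P n, cpt (val u) x = 0) ->
  (forall n, ~~ D' n -> forall x : P n, cpt (val v) x = 0) ->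
  forall n, (forall k, (k <= n)%N -> ~~ (D k && D' (n - k)%N)) ->
  forall x : P n, cpt (ycomp (val u) (some_lift v)) x = 0.
Proof.
move=> Du Dv n nD x; rewrite cpt_ycomp big1_seq // => k /andP[_].
rewrite mem_index_iota ltnS => /andP[_ lekn].
have /nandP[Dk|Dk] := nD k lekn; first exact: Du.
have [_ ->//] := some_liftP v; last exact: Dv.
by rewrite bihom0 //; have [] := cocycles_fam u.
Qed.

Fact yprod_cocycle (u v : cocycles) : cocycle (ycomp (val u) (some_lift v)).
Proof.
split; first exact: ycomp_cocycle (cocycles_fam u) (some_lift_lift v).
have [[_ [m mP]] [_ [n nP]]] := (submod_valP u, submod_valP v).
exists (m + n)%N => k lek.
apply: (@ycomp_supp u v (fun i => i < m)%N (fun i => i < n)%N).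
- by move=> i; rewrite -leqNgt; exact: mP.
- by move=> i; rewrite -leqNgt; exact: nP.
- move=> j lejk; apply/negP => /andP[ltj]; rewrite ltn_subLR // => ltk.
  by have := leq_trans ltk (leq_trans (leq_add (ltnW ltj) (leqnn n)) lek); rewrite ltnn.
Qed.

(* The Yoneda product of u_m : P_m -> M and v_n : P_n -> M is u_m o f_m, where
   f_i : P_(n+i) -> P_i is a chain map that lifts v_n. *)
Definition yprod (u v : cocycles) : cocycles :=
  @to_submod _ _ cocycle_submod _ (yprod_cocycle u v).

Lemma cls_yprodE (u v : cocycles) f (w : cocycles) : chain_lift (val v) f ->
  val w = ycomp (val u) f -> cls (yprod u v) = cls w.
Proof.
move=> lf wE; apply/cls_eqP; rewrite wE.
apply: ycomp_uniq (cocycles_fam u) (some_lift_lift v) lf _.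
by rewrite subrr; exact: coboundary0.
Qed.

Lemma yprod_cls (u u' v v' : cocycles) : cls u = cls u' -> cls v = cls v' ->
  cls (yprod u v) = cls (yprod u' v').
Proof.
move=> /cls_eqP uu' /cls_eqP vv'; apply/cls_eqP => /=.
have -> : ycomp (val u) (some_lift v) - ycomp (val u') (some_lift v') =
   1 *: ycomp (-1 *: val u' + val u) (some_lift v) +
   (ycomp (val u') (some_lift v) - ycomp (val u') (some_lift v')).
  by rewrite ycompDl scale1r scaleN1r [- _ + _]addrC addrA subrK.
apply: coboundaryP.
  apply: ycomp_coboundaryl (some_lift_lift v).
  by rewrite scaleN1r addrC.
exact: ycomp_uniq (cocycles_fam u') (some_lift_lift v) (some_lift_lift v') vv'.
Qed.

Definition ext_mul (x y : ext) : ext := cls (yprod (lift_rep x) (lift_rep y)).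
Definition ext_one : ext := cls (@to_submod _ _ cocycle_submod _ unit_cocycle).

Lemma lift_rep_cls x : cls (lift_rep x) = x. Proof. exact: lift_repK. Qed.

Lemma ext_mulE (u v : cocycles) : ext_mul (cls u) (cls v) = cls (yprod u v).
Proof. by apply: yprod_cls; rewrite lift_rep_cls. Qed.

Fact ext_mulA : associative ext_mul.
Proof.
move=> x y z; have [[u ->] [v ->] [w ->]] := And3 (cls_surj x) (cls_surj y) (cls_surj z).
rewrite !ext_mulE.
have L : chain_lift (val (yprod v w)) _ := chain_lift_comp (cocycles_fam v)
  (some_lift_lift v) (some_lift_lift w).
apply: (cls_yprodE L); apply: ycompA (cocycles_fam u) _; exact: lift_low (some_lift_lift v).
Qed.

Fact ext_mul1 : left_id ext_one ext_mul.
Proof.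
move=> x; have [v ->] := cls_surj x; rewrite ext_mulE.
apply: (cls_yprodE (some_lift_lift v)).
by rewrite (ycomp_unit (some_lift_lift v)).
Qed.

Fact ext_mul1r : right_id ext_one ext_mul.
Proof.
move=> x; have [v ->] := cls_surj x; rewrite ext_mulE.
apply: (cls_yprodE (f := idl)); first exact: idl_lift.
by rewrite ycomp_idl //; exact: cocycles_fam.
Qed.

Lemma ext_mulPl a (u v w : ext) :
  ext_mul (a *: u + v) w = a *: ext_mul u w + ext_mul v w.
Proof.
have [[u' ->] [v' ->] [w' ->]] := And3 (cls_surj u) (cls_surj v) (cls_surj w).
rewrite -linearP !ext_mulE -linearP; apply: (cls_yprodE (some_lift_lift w')).
by rewrite [LHS]linearP ycompDl.
Qed.

Lemma ext_mulPr a (u v w : ext) :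
  ext_mul w (a *: u + v) = a *: ext_mul w u + ext_mul w v.
Proof.
have [[u' ->] [v' ->] [w' ->]] := And3 (cls_surj u) (cls_surj v) (cls_surj w).
rewrite -linearP !ext_mulE -linearP.
have L : chain_lift (val (a *: u' + v')) _ :=
  chain_liftP a (some_lift_lift u') (some_lift_lift v').
apply: (cls_yprodE L).
by rewrite [LHS]linearP ycompDr //; exact: cocycles_fam.
Qed.

Fact ext_mulDl : left_distributive ext_mul +%R.
Proof. by move=> x y z; rewrite -[x]scale1r ext_mulPl !scale1r. Qed.
Fact ext_mulDr : right_distributive ext_mul +%R.
Proof. by move=> x y z; rewrite -[y]scale1r ext_mulPr !scale1r. Qed.

Lemma ext_mul0l x : ext_mul 0 x = 0.
Proof. by apply: (addIr (ext_mul 0 x)); rewrite -ext_mulDl !add0r. Qed.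
Lemma ext_mul0r x : ext_mul x 0 = 0.
Proof. by apply: (addIr (ext_mul x 0)); rewrite -ext_mulDr !add0r. Qed.
Fact ext_mulZl a (u v : ext) : a *: ext_mul u v = ext_mul (a *: u) v.
Proof. by rewrite -[a *: u]addr0 ext_mulPl ext_mul0l addr0. Qed.
Fact ext_mulZr a (u v : ext) : a *: ext_mul u v = ext_mul u (a *: v).
Proof. by rewrite -[a *: v]addr0 ext_mulPr ext_mul0r addr0. Qed.
End Ext.

Section Graded.
Variable K : fieldType.

(* The grading induced on a quotient. *)
Definition quot_deg (R : algType K) (G : proper_gens R) (gr : nat -> R -> Prop)
    (t : nat) (x : quot_alg G) : Prop :=
  exists2 r, gr t r & x = qproj G r.

(* Isomorphism of graded algebras; gR t and gS t are the homogeneous elements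
   of degree t. *)
Definition graded_iso (R S : algType K)
    (gR : nat -> R -> Prop) (gS : nat -> S -> Prop) : Prop :=
  exists2 f : {lrmorphism R -> S}, bijective f &
    forall t x, gR t x <-> gS t (f x).

Definition subalgebra (R : algType K) (B : R -> Prop) : Prop :=
  [/\ B 1, forall a u v, B u -> B v -> B (a *: u + v)
    & forall u v, B u -> B v -> B (u * v)].

Definition finitely_generated (R : algType K) : Prop :=
  exists s : seq R, forall B : R -> Prop,
    subalgebra B -> (forall x, x \in s -> B x) -> forall x, B x.
End Graded.
Arguments graded_iso {K} R S gR gS.
Arguments finitely_generated {K} R.

Section HH.
Variables (K : fieldType) (A : algType K) (P : proj_resolution (reg_bimod A)).

(* HH^*(A), the direct sum of the Ext^t_(A^e)(A, A), with the Yoneda product. *)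
Definition HH : Type := ext P.
HB.instance Definition _ := GRing.Lmodule.on HH.

Fact HH_one_neq0 : ext_one P != 0 :> HH.
Proof.
rewrite -(raddf0 (@cls _ _ _ P)); apply/eqP => /cls_eqP[+ _].
have [x x1] := aug_surj P 1; move=> /(_ x)/eqP.
by rewrite [X in X == _](_ : _ = 1) ?oner_eq0 // -[RHS]x1 subr0.
Qed.
HB.instance Definition _ := GRing.Zmodule_isNzRing.Build HH
  (@ext_mulA _ _ _ P) (@ext_mul1 _ _ _ P) (@ext_mul1r _ _ _ P)
  (@ext_mulDl _ _ _ P) (@ext_mulDr _ _ _ P) HH_one_neq0.
HB.instance Definition _ :=
  GRing.Lmodule_isLalgebra.Build K HH (@ext_mulZl _ _ _ P).
HB.instance Definition _ :=
  GRing.Lalgebra_isAlgebra.Build K HH (@ext_mulZr _ _ _ P).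

(* HH^t(A) *)
Definition HH_deg : nat -> HH -> Prop := @ext_deg _ _ _ P.

Definition HH4_pred : {pred HH} :=
  [pred z | `[< @ext_supp _ _ _ P (fun n => 4 %| n)%N z >]].

Fact HH4_closed : GRing.subsemialg_closed HH4_pred.
Proof.
split; [|split| |].
- apply/asboolP; exists (@to_submod _ _ (cocycle_submod P) _ (unit_cocycle P)) => //.
  by case.
- by apply/asboolP; exists 0 => //; rewrite raddf0.
- move=> _ _ /asboolP[u -> Du] /asboolP[v -> Dv]; apply/asboolP.
  exists (u + v) => [|n nD x]; first by rewrite raddfD.
  by rewrite [LHS](_ : _ = cpt (val u) x + cpt (val v) x) // Du // Dv // addr0.
- move=> a _ /asboolP[u -> Du]; apply/asboolP.
  exists (a *: u) => [|n nD x]; first by rewrite linearZ.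
  by rewrite [LHS](_ : _ = a *: cpt (val u) x) // Du // scaler0.
- move=> _ _ /asboolP[u -> Du] /asboolP[v -> Dv]; apply/asboolP.
  exists (yprod u v) => [|n nD x]; first exact: ext_mulE.
  apply: ycomp_supp Du Dv _ _ _ => k lekn.
  by apply: contra nD => /andP[dk dnk]; rewrite -(subnKC lekn) dvdn_add.
Qed.
HB.instance Definition _ := GRing.isSubalgClosed.Build K HH HH4_pred HH4_closed.

(* The subalgebra of HH of the elements supported in degrees divisible by 4. *)
Record HH4 := HH4Sub { HH4_val : HH; _ : HH4_val \in HH4_pred }.
HB.instance Definition _ := [isSub for HH4_val].
HB.instance Definition _ := [Choice of HH4 by <:].
HB.instance Definition _ := [SubChoice_isSubNzRing of HH4 by <:].
HB.instance Definition _ := [SubZmodule_isSubLmodule of HH4 by <:].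
HB.instance Definition _ :=
  [SubNzRing_SubLmodule_isSubLalgebra of HH4 by <:].
HB.instance Definition _ := [SubLalgebra_isSubAlgebra of HH4 by <:].

Definition HH4_deg (t : nat) (z : HH4) : Prop := HH_deg t (val z).

Definition hnilpotent (z : HH) : Prop :=
  (exists t, HH_deg t z) /\ (exists n, z ^+ n = 0).

Lemma hnilpotent_proper : ~ ideal_gen hnilpotent 1.
Proof.
have [p p1] := aug_surj P 1.
have dep (c : cocycles P) (x y : P 0) :
    aug x = aug y -> cpt (val c) x = cpt (val c) y.
  move=> xy; have [hc dc] := cocycles_fam c.
  have /(res_exact0 (p := P))[z zE] : aug (x - y) = 0.
    by rewrite (bihomB _ _ (aug_bihom P)) xy subrr.
  by apply/eqP; rewrite -subr_eq0 -(bihomB _ _ (hc 0)) -zE dc.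
pose rho (z : HH) : A := cpt (val (lift_rep z)) p.
have rhoE (c : cocycles P) : rho (cls c) = cpt (val c) p.
  have /cls_eqP[/(_ p) + _] : cls (lift_rep (cls c)) = cls c by exact: lift_rep_cls.
  by move=> h; apply/eqP; rewrite -subr_eq0; apply/eqP.
have lE (c : cocycles P) x : cpt (val c) x = (aug x : A) * cpt (val c) p.
  have [/(_ 0)[_ hl _] _] := cocycles_fam c.
  rewrite -[RHS]hl; apply: dep; have [_ -> _] := aug_bihom P.
  by rewrite p1 /= mulr1.
have rE (c : cocycles P) x : cpt (val c) x = (cpt (val c) p : A) * aug x.
  have [/(_ 0)[_ _ hr] _] := cocycles_fam c.
  rewrite -[RHS]hr; apply: dep; have [_ _ ->] := aug_bihom P.
  by rewrite p1 /= mul1r.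
have rhoC x y : GRing.comm (rho x) (rho y).
  have [[u ->] [v ->]] := (cls_surj x, cls_surj y); rewrite !rhoE.
  have [q qE] := aug_surj P (cpt (val v) p).
  by rewrite /GRing.comm -qE -rE -lE.
have rhoM x y : rho (x * y) = rho x * rho y.
  have [[u ->] [v ->]] := (cls_surj x, cls_surj y).
  rewrite [X in rho X]ext_mulE !rhoE /= cpt_ycomp big_nat1 rE.
  by rewrite (lift_aug (some_lift_lift v)).
have rho1 : rho 1 = 1 by rewrite rhoE /= -p1.
have rhoD x y : rho (x + y) = rho x + rho y.
  by have [[u ->] [v ->]] := (cls_surj x, cls_surj y); rewrite -raddfD !rhoE.
have rhoX x n : rho (x ^+ n) = rho x ^+ n.
  by elim: n => // n IHn; rewrite !exprS rhoM IHn.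
have rho0 : rho 0 = 0 by apply: (addIr (rho 0)); rewrite -rhoD !add0r.
apply: (@proper_gensP _ _ _ (fun z => exists n, rho z ^+ n = 0)).
- split; first by exists 1; rewrite expr1.
  + move=> x y [m xm] [n yn]; exists (m + n)%N.
    rewrite rhoD (exprDn_comm _ (rhoC x y)) big1 // => -[i /= lei] _.
    case: (leqP n i) => [leni|ltin].
      by rewrite -(subnKC leni) exprD yn mul0r mulr0 mul0rn.
    have lem : (m <= m + n - i)%N by rewrite -addnBA ?leq_addr // ltnW.
    by rewrite -(subnKC lem) exprD xm !mul0r mul0rn.
  + by move=> r x [n xn]; exists n; rewrite rhoM (exprMn_comm _ (rhoC r x)) xn mulr0.
  + by move=> r x [n xn]; exists n; rewrite rhoM (exprMn_comm _ (rhoC x r)) xn mul0r.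
- by move=> z [_ [n zn]]; exists n; rewrite -rhoX zn.
- by move=> [n]; rewrite rho1 expr1n => /eqP; rewrite oner_eq0.
Qed.

(* HH^*(A) / N_A *)
Definition HH_red : algType K := quot_alg (ProperGens hnilpotent_proper).
Definition HH_red_deg : nat -> HH_red -> Prop := quot_deg HH_deg.
End HH.

Section Target.
Variable K : closedFieldType.

Definition zvar (j : nat) : {mpoly K[5]} := 'X_(inord j : 'I_5).
Local Notation z := zvar.

Definition zrels : seq {mpoly K[5]} :=
  [:: z 0 * z 2 - z 1 ^+ 2; z 0 * z 3 - z 1 * z 2; z 0 * z 4 - z 2 ^+ 2;
      z 0 * z 4 - z 1 * z 3; z 1 * z 4 - z 2 * z 3; z 2 * z 4 - z 3 ^+ 2].

Fact zrels_proper : ~ ideal_gen (fun r => r \in zrels) 1.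
Proof.
pose ev (p : {mpoly K[5]}) := p.@[fun=> 0].
apply: (@proper_gensP _ _ _ (fun p => ev p = 0)).
- split; rewrite /ev.
  + exact: raddf0.
  + by move=> x y x0 y0; rewrite mevalD x0 y0 addr0.
  + by move=> r x x0; rewrite mevalM x0 mulr0.
  + by move=> r x x0; rewrite mevalM x0 mul0r.
- move=> g; rewrite !inE /ev => /or4P[||| /or3P[||]] /eqP ->;
    by rewrite ?expr2 mevalB !mevalM !mevalXU !mul0r subr0.
- by rewrite /ev meval1 => /eqP; rewrite oner_eq0.
Qed.

Definition zalg : algType K := quot_alg (ProperGens zrels_proper).

(* The grading of the polynomial ring in which each z_j has degree 4. *)
Definition zdeg (t : nat) (p : {mpoly K[5]}) : Prop :=
  forall m, m \in msupp p -> t = (4 * mdeg m)%N.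
Definition zalg_deg : nat -> zalg -> Prop := quot_deg zdeg.
End Target.

(* Main.v *)
(** Put u = a_0 + b_1 + a_2 + b_3 and v = b_0 + a_1 + b_2 + a_3.  The relations
    become u^2 = v^2 = 0 and uv + vu = 0, so in every characteristic A is the
    Z/4-covering of the exterior algebra in two variables, and its Koszul dual is
    the Z/4-covering of K[s, t].  The Koszul bimodule resolution has generators
    g^n_0, ..., g^n_n in degree n, dual to the monomials s^j t^(n-j), and
      d g^n_j = u g_(j-1) + v g_j + (-1)^n (g_(j-1) u + g_j v).
    A bimodule map on degree n sends g^n_j into the span of the e_i A e_(i+n).
    For n = 4k + 3 this is 0; for n = 4k it is spanned by idempotents and the
    cocycles are the families of scalars (c_j), 0 <= j <= n; in the remaining
    degrees the values lie in the radical.  Reading a class modulo the radical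
    therefore gives a ring map from the Hochschild cohomology to K[s, t]
    (a cocycle acts on the generators by shifting j), which is injective in degrees
    divisible by 4, has as its image the fourth Veronese subring, and whose kernel
    is N_A: classes in degrees not divisible by 4 are nilpotent, and K[s, t] is a
    domain.  Finally the quadrics of the theorem rewrite every monomial in the z_j
    to some z_0^a z_r^e z_4^b with 0 < r < 4 and e <= 1, which is determined by its
    degree and its weight, so they generate the ideal of the rational normal quartic. *)

Require Import Defs.
From HB Require Import structures.
From mathcomp Require Import all_boot all_order all_algebra.
From mathcomp Require Import boolp functions.
From mathcomp Require Import mpoly.
From mathcomp Require Import ring zify.

Set Implicit Arguments.
Unset Strict Implicit.
Unset Printing Implicit Defensive.
Import GRing.Theory.
Local Open Scope ring_scope.

(** * The algebra as a covering of an exterior algebra *)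

(** The resolution [P] is arbitrary, so classes are read on the Koszul resolution through comparison
    maps in both directions. The proof avoids a full computation of the cohomology. A coboundary of
    degree 4k > 0 factors through degree 4k - 1, where all values are 0, so residues depend on the
    class only; conversely, a cocycle of degree 4k whose residues vanish is zero as a map on the
    Koszul bimodule. For the remaining degrees, nilpotency follows by multiplying until the degree
    is 3 modulo 4, or 0 modulo 4 with zero symbol. The three algebras of the theorem are then
    embedded in the same ring [{poly {poly K}}], each with image the polynomials whose n-th
    coefficient has degree at most 4n. Isomorphisms and gradings are compared inside this ring, so
    no formula for a map between two of the algebras is ever needed. *)

(* A pair of booleans (s, t) stands for the monomial u^s v^t. *)
Record ext_cover (K : fieldType) (A : algType K) := ExtCover {
  vtx : 'Z_4 -> A;
  gu : A;
  gv : A;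
  co : bool * bool -> 'Z_4 -> A -> K;
  vtx_mul : forall i j, vtx i * vtx j = vtx i *+ (i == j);
  sum_vtx : \sum_i vtx i = 1;
  vtx_u : forall i, vtx i * gu = gu * vtx (i + 1);
  vtx_v : forall i, vtx i * gv = gv * vtx (i + 1);
  gu_gu : gu * gu = 0;
  gv_gv : gv * gv = 0;
  gv_gu : gv * gu = - (gu * gv);
  co_linear : forall t i, linear (co t i : A -> K^o);
  co_basis : forall t i (s : bool * bool) j,
    co t i (vtx j * (gu ^+ s.1 * gv ^+ s.2)) = ((t == s) && (i == j))%:R;
  co_decomp : forall a,
    a = \sum_t \sum_i co t i a *: (vtx i * (gu ^+ t.1 * gv ^+ t.2))
}.

Local Arguments pcoef : simpl never.

(** * Paths as a basis of a path algebra *)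

Section PathBasis.
Variables (K : fieldType) (Q : quiver).
Local Notation PA := (path_alg K Q).
Implicit Types (v : qvert Q) (e : qarr Q) (s : seq (qarr Q)).

Definition vert_fun v (p : qpair Q) : K^o := (p == (v, [::]))%:R.
Fact vert_supp v : path_supp (vert_fun v).
Proof.
split=> [p|]; rewrite /vert_fun.
  by have [->|_] := eqVneq p _; rewrite /= ?eqxx.
by exists [:: (v, [::])] => p; rewrite inE; case: (p == _); rewrite ?eqxx.
Qed.
Definition vert v : PA := @to_submod _ _ (path_submod K Q) _ (vert_supp v).

Fixpoint ppath v s : PA :=
  if s is e :: s' then arrow K e * ppath (qtgt e) s' else vert v.

Lemma pcoefM (f g : PA) p : pcoef (f * g) p = pconv (pcoef f) (pcoef g) p.
Proof. exact: pcoef_mul. Qed.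

Lemma pcoef_vertM v (f : PA) p : pcoef (vert v * f) p = (p.1 == v)%:R * pcoef f p.
Proof.
case: p => w s; rewrite pcoefM /pconv big_nat_recl //= take0 drop0.
rewrite big1_seq ?addr0 => [|k /andP[_]].
  by rewrite /pcoef /= /vert_fun -pair_eqE /= eqxx andbT.
rewrite mem_index_iota /= => ltk; rewrite /pcoef /= /vert_fun.
case: s ltk => //= e s _; rewrite -pair_eqE /=. by rewrite andbF mulr0n mul0r.
Qed.

Lemma pcoef_arrowM e (f : PA) v s : pcoef (arrow K e * f) (v, s) =
  if s is e' :: s' then ((v == qsrc e) && (e' == e))%:R * pcoef f (qtgt e, s') else 0.
Proof.
have a0 w : pcoef (arrow K e) (w, [::]) = 0.
  by rewrite /pcoef /= /arrow_fun -pair_eqE /= andbF.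
have a2 w e1 e2 t : pcoef (arrow K e) (w, [:: e1, e2 & t]) = 0.
  by rewrite /pcoef /= /arrow_fun -pair_eqE /= eqseq_cons !andbF.
rewrite pcoefM /pconv; case: s => [|e' s]; first by rewrite big_nat1 a0 mul0r.
rewrite big_nat_recl //= a0 mul0r add0r big_nat_recl //= take0 drop0.
rewrite big1_seq ?addr0 => [|k /andP[_]].
  rewrite {1}/pcoef /= /arrow_fun -pair_eqE /= eqseq_cons eqxx andbT.
  by case: (e' =P e) => [->//|]; rewrite andbF !mul0r.
rewrite mem_index_iota /= => ltk.
by case: s ltk => //= e2 s _; rewrite a2 mul0r.
Qed.

Lemma pcoef_ppath v s p : is_walk v s -> pcoef (ppath v s) p = (p == (v, s))%:R.
Proof.
elim: s v p => [//|e s IHs] v [w t] /= /andP[/eqP ve ws].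
rewrite pcoef_arrowM -pair_eqE /=; case: t => [|e' t]; first by rewrite andbF.
rewrite IHs // -pair_eqE /= eqxx eqseq_cons ve /= -natrM mulnb.
by rewrite andbA.
Qed.

(** The list that bounds the support is filtered to walks and made duplicate-free, so that each path
    contributes its coefficient exactly once. *)
Lemma path_alg_span (f : PA) : exists2 r : seq (qpair Q),
  (forall p, p \in r -> is_walk p.1 p.2) & f = \sum_(p <- r) pcoef f p *: ppath p.1 p.2.
Proof.
have [wf [r sf]] := submod_valP f.
have pS I (t : seq I) (F : I -> PA) p :
    pcoef (\sum_(i <- t) F i) p = \sum_(i <- t) pcoef (F i) p.
  by apply: (big_morph (fun f : PA => pcoef f p)).
exists (undup [seq p <- r | is_walk p.1 p.2]) => [p|].
  by rewrite mem_undup mem_filter => /andP[].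
apply: path_alg_eq => p; rewrite pS.
have pE q : q \in undup [seq p <- r | is_walk p.1 p.2] ->
    pcoef (pcoef f q *: ppath q.1 q.2) p = pcoef f q * (p == q)%:R.
  rewrite mem_undup mem_filter => /andP[wq _]; case: q wq => v s wq.
  by rewrite -pcoef_ppath.
rewrite (eq_big_seq _ pE) {pE}.
have [pr|pr] := boolP (p \in undup [seq p <- r | is_walk p.1 p.2]).
  rewrite (bigD1_seq p) ?undup_uniq //= eqxx mulr1 big1 ?addr0 // => q qp.
  by rewrite eq_sym (negbTE qp) mulr0.
rewrite big1_seq => [|q /andP[_ qr]].
  apply/eqP; apply: contraNT pr => fp.
  by rewrite mem_undup mem_filter wf ?sf.
case: (p =P q) => [pq|_]; last by rewrite mulr0.
by rewrite pq qr in pr.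
Qed.
End PathBasis.

(** * The basis of A formed by the elements e_i u^s v^t *)

Section Cover.
Variable K : closedFieldType.
Local Notation PA := (path_alg K Gamma).
Local Notation A := (algA K).
Local Notation q := (@qproj K (path_alg K Gamma) (ProperGens (@relA_proper K))).
Local Notation ar i c := (@arrow K Gamma (i, c)).
Implicit Types (i j : 'Z_4) (f g : PA).

Let qM f g : q (f * g) = q f * q g. Proof. exact: rmorphM. Qed.

(** One arrow leaves each vertex, of colour [c i]. The elements x, y and the lifts of u, v are all
    of this form: constant colours for x and y, alternating ones for u and v. *)
Definition arsum (c : 'Z_4 -> bool) : PA := \sum_i ar i (c i).

Lemma vert_mul i j : vert K (Q := Gamma) i * vert K (Q := Gamma) j =
  vert K (Q := Gamma) i *+ (i == j).
Proof.
apply: path_alg_eq => -[v s]; rewrite pcoef_vertM /=.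
have [<-|ij] := eqVneq i j; rewrite ?mulr1n ?mulr0n /pcoef /= /vert_fun -!pair_eqE /=.
  by case: (v == i); rewrite ?mul1r ?mul0r.
rewrite -natrM mulnb; case: (v =P i) => [->|//].
by rewrite (negbTE ij).
Qed.

Lemma sum_vert : \sum_i vert K (Q := Gamma) i = 1.
Proof.
apply: path_alg_eq => -[v s].
rewrite (big_morph (fun f : PA => pcoef f (v, s)) (id1 := 0) (op1 := +%R)) //.
rewrite (bigD1 v) //= big1 ?addr0 => [|i iv].
  by rewrite /pcoef /= /vert_fun /pone_fun /= -pair_eqE /= eqxx; case: s.
by rewrite /pcoef /= /vert_fun -pair_eqE /= eq_sym (negbTE iv).
Qed.

Lemma vert_ar i j c : vert K (Q := Gamma) i * ar j c = ar j c *+ (i == j).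
Proof.
apply: path_alg_eq => -[v s]; rewrite pcoef_vertM /=.
have [<-|ij] := eqVneq i j; rewrite ?mulr1n ?mulr0n /pcoef /= /arrow_fun -!pair_eqE /=.
  by case: (v == i); rewrite ?mul1r ?mul0r.
rewrite -natrM mulnb; case: (v =P i) => [->|//].
by rewrite (negbTE ij).
Qed.

Lemma ar_vert i j c : ar j c * vert K (Q := Gamma) i = ar j c *+ (i == j + 1).
Proof.
apply: path_alg_eq => -[v s]; rewrite pcoef_arrowM /=.
case: s => [|e s].
  case: (i == _); rewrite ?mulr0n ?mulr1n //.
  by rewrite /pcoef /= /arrow_fun -!pair_eqE /= andbF.
rewrite {1}/pcoef /= /vert_fun -pair_eqE /=.
case: (eqVneq i (j + 1)) => [_|ij]; rewrite ?mulr1n ?mulr0n.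
  rewrite /pcoef /= /arrow_fun -!pair_eqE /= eqseq_cons -natrM mulnb.
  by rewrite -andbA.
by rewrite mulr0.
Qed.

Lemma vert_arsum i (c : 'Z_4 -> bool) : vert K (Q := Gamma) i * arsum c = ar i (c i).
Proof.
rewrite mulr_sumr (bigD1 i) //= vert_ar eqxx mulr1n big1 ?addr0 // => j ji.
by rewrite vert_ar eq_sym (negbTE ji).
Qed.

Lemma arsum_vert i (c : 'Z_4 -> bool) : arsum c * vert K (Q := Gamma) (i + 1) = ar i (c i).
Proof.
rewrite mulr_suml (bigD1 i) //= ar_vert eqxx mulr1n big1 ?addr0 // => j ji.
by rewrite ar_vert (inj_eq (addIr 1)) eq_sym (negbTE ji).
Qed.

Lemma pcoef_arsumM (c : 'Z_4 -> bool) f v s : pcoef (arsum c * f) (v, s) =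
  if s is e :: s' then (e == (v, c v))%:R * pcoef f (v + 1, s') else 0.
Proof.
rewrite mulr_suml (big_morph (fun f : PA => pcoef f (v, s)) (id1 := 0) (op1 := +%R)) //.
case: s => [|e s]; first by rewrite big1 // => i _; rewrite pcoef_arrowM.
rewrite (bigD1 v) //= big1 ?addr0 => [|i iv]; rewrite pcoef_arrowM /=.
  by rewrite eqxx.
by rewrite eq_sym (negbTE iv) mul0r.
Qed.

Lemma xA_arsum : xA K = arsum (fun=> false). Proof. by []. Qed.
Lemma yA_arsum : yA K = arsum (fun=> true). Proof. by []. Qed.

Lemma relA0 r : relA r -> q r = 0.
Proof.
move=> Ir; rewrite -(raddf0 q); apply/qproj_eqP; rewrite subr0.
by move=> I HI HG; exact: HG.
Qed.

Lemma vert_arsum2 i (c d : 'Z_4 -> bool) :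
  vert K (Q := Gamma) i * (arsum c * arsum d) = ar i (c i) * ar (i + 1) (d (i + 1)).
Proof.
by rewrite mulrA vert_arsum -(vert_arsum (i + 1) d) mulrA ar_vert eqxx.
Qed.

Lemma q_ar_neq i c d : c != d -> q (ar i c * ar (i + 1) d) = 0.
Proof.
move=> cd; rewrite -(vert_arsum2 i (fun=> c) (fun=> d)) qM [X in _ * X]relA0 ?mulr0 //.
by case: c d cd => [] [] // _; [apply: Or33|apply: Or31].
Qed.

Lemma q_ar_eq i c : q (ar i c * ar (i + 1) c) = - q (ar i (~~ c) * ar (i + 1) (~~ c)).
Proof.
apply/eqP; rewrite -addr_eq0 -raddfD /=.
rewrite -(vert_arsum2 i (fun=> c) (fun=> c)) -(vert_arsum2 i (fun=> ~~ c) (fun=> ~~ c)).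
rewrite -mulrDr qM [X in _ * X]relA0 ?mulr0 //; apply: Or32; rewrite !expr2 xA_arsum yA_arsum.
by case: c; rewrite // addrC.
Qed.

(** Two consecutive arrows of different colours give zero. A path of a single colour acquires such a
    pair once its first two arrows are recoloured by means of x^2 + y^2 = 0. *)
Lemma q_ar3 i c c' c'' : q (ar i c * (ar (i + 1) c' * ar (i + 1 + 1) c'')) = 0.
Proof.
have [<-|cd] := eqVneq c c'; last by rewrite mulrA qM q_ar_neq // mul0r.
have [<-|cd] := eqVneq c c''; last by rewrite qM q_ar_neq // mulr0.
by rewrite mulrA qM q_ar_eq mulNr -qM -mulrA qM q_ar_neq ?mulr0 ?oppr0 //; case: c.
Qed.

(* Since a_i a_(i+1) = - b_i b_(i+1), the coefficient of e_i u v on a path of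
   length 2 is a difference. *)
Definition pco (t : bool * bool) (i : 'Z_4) (f : PA) : K :=
  match t with
  | (false, false) => pcoef f (i, [::])
  | (true, false) => pcoef f (i, [:: (i, odd i)])
  | (false, true) => pcoef f (i, [:: (i, ~~ odd i)])
  | (true, true) => pcoef f (i, [:: (i, odd i); (i + 1, odd i)]) -
                    pcoef f (i, [:: (i, ~~ odd i); (i + 1, ~~ odd i)])
  end.

Lemma pco_linear t i a f g : pco t i (a *: f + g) = a * pco t i f + pco t i g.
Proof.
have pE p : pcoef (a *: f + g) p = a * pcoef f p + pcoef g p by [].
by case: t => [] [] []; rewrite /pco !pE //; ring.
Qed.

(** Used for linear independence: this ideal contains the relations, so [pco] descends to A. It is
    closed under products because the two one-coloured paths of length 2 from i have the same ends,
    so that a factor scales both coefficients alike. *)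
Lemma pco_ideal : two_sided_ideal (fun f => forall t i, pco t i f = 0).
Proof.
have p1 (f g : PA) v : pcoef (f * g) (v, [::]) = pcoef f (v, [::]) * pcoef g (v, [::]).
  by rewrite pcoefM /pconv big_nat1.
have p2 (f g : PA) v (e : qarr Gamma) : pcoef (f * g) (v, [:: e]) =
    pcoef f (v, [::]) * pcoef g (v, [:: e]) + pcoef f (v, [:: e]) * pcoef g (qtgt e, [::]).
  by rewrite pcoefM /pconv /= big_nat_recr //= big_nat1.
have p3 (f g : PA) v (e e' : qarr Gamma) : pcoef (f * g) (v, [:: e; e']) =
    pcoef f (v, [::]) * pcoef g (v, [:: e; e']) +
    pcoef f (v, [:: e]) * pcoef g (qtgt e, [:: e']) +
    pcoef f (v, [:: e; e']) * pcoef g (qtgt e', [::]).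
  by rewrite pcoefM /pconv /= !big_nat_recr //= big_geq // add0r.
have pc f : (forall t i, pco t i f = 0) -> [/\ forall i, pcoef f (i, [::]) = 0,
    forall i c, pcoef f (i, [:: (i, c)]) = 0 &
    forall i, pcoef f (i, [:: (i, odd i); (i + 1, odd i)]) =
              pcoef f (i, [:: (i, ~~ odd i); (i + 1, ~~ odd i)])].
  move=> pf; split=> i; first exact: (pf (false, false) i).
    move=> c; have [->|] := eqVneq c (odd i); first exact: (pf (true, false) i).
    by move/negPf => ci; have := pf (false, true) i; congr (pcoef f (_, [:: (_, _)]) = _);
       case: c ci; case: (odd i).
  by apply/eqP; rewrite -subr_eq0; apply/eqP; exact: (pf (true, true) i).
split=> [[[] []] i //|f g If Ig t i|r f If t i|r f If t i].
- by rewrite /= subr0.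
- by rewrite -[f]scale1r pco_linear If Ig mulr0 addr0.
- have [f0 f1 f2] := pc f If.
  by case: t => [] [] []; rewrite /= ?p3 ?p2 ?p1 /= ?f0 ?f1 ?f2 ?mulr0 ?addr0 ?subrr.
- have [f0 f1 f2] := pc f If.
  by case: t => [] [] []; rewrite /= ?p3 ?p2 ?p1 /= ?f0 ?f1 ?f2 ?mul0r ?add0r ?addr0 ?subrr.
Qed.

Lemma pco_q f g : q f = q g -> forall t i, pco t i f = pco t i g.
Proof.
move/qproj_eqP => fg t i; apply/eqP; rewrite -subr_eq0; apply/eqP.
rewrite -[pco t i g]mul1r -mulNr addrC -pco_linear scaleN1r addrC.
suff IG (r : PA) : relA r -> forall s j, pco s j r = 0.
  exact: (fg (fun f => forall s j, pco s j f = 0) pco_ideal IG t i).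
have a2 c d v e e' : pcoef (arsum c * arsum d) (v, [:: e; e']) =
    ((e == (v, c v)) && (e' == (v + 1, d (v + 1))))%:R.
  rewrite pcoef_arsumM -[arsum d]mulr1 pcoef_arsumM /pcoef /= /pone_fun /= mulr1.
  by rewrite -natrM mulnb.
have a1 c d v e : pcoef (arsum c * arsum d) (v, [:: e]) = 0.
  by rewrite pcoef_arsumM -[arsum d]mulr1 pcoef_arsumM mulr0.
have a0 c d v : pcoef (arsum c * arsum d) (v, [::]) = 0 by rewrite pcoef_arsumM.
have D (f' g' : PA) p : pcoef (f' + g') p = pcoef f' p + pcoef g' p by [].
move=> rr [[] []] j; case: rr => ->; rewrite !(xA_arsum, yA_arsum, expr2) /pco.
all: rewrite ?D ?a2 ?a1 ?a0 ?addr0 //.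
all: by case: (odd j); rewrite -!pair_eqE /= ?eqxx /= ?andbF ?andbT ?subrr ?addr0 ?add0r ?subrr.
Qed.

Definition aco t i (a : A) : K := pco t i (lift_rep a).

Lemma aco_q t i f : aco t i (q f) = pco t i f.
Proof. by apply: pco_q; exact: lift_repK. Qed.

Lemma aco_linear t i : linear (aco t i : A -> K^o).
Proof.
move=> k a b; have [[f ->] [g ->]] := (qproj_surj a, qproj_surj b).
by rewrite -linearP !aco_q pco_linear.
Qed.

Definition podd i : bool := odd i.
(** The alternation of colours closes up at the step from 3 to 0 because the cycle has even
    length. *)
Lemma poddS i : podd (i + 1) = ~~ podd i.
Proof. by case: i => [[|[|[|[|]]]]]. Qed.

Definition qu : A := q (arsum podd).
Definition qv : A := q (arsum (fun i => ~~ podd i)).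
Definition qe i : A := q (vert K (Q := Gamma) i).
Definition qbasis (t : bool * bool) : A := qu ^+ t.1 * qv ^+ t.2.

Lemma qe_arsum2 i (c d : 'Z_4 -> bool) : qe i * (q (arsum c) * q (arsum d)) =
  q (ar i (c i) * ar (i + 1) (d (i + 1))).
Proof. by rewrite -vert_arsum2 !qM. Qed.

Lemma qe_quu i : qe i * (qu * qu) = 0.
Proof. by rewrite qe_arsum2 q_ar_neq // poddS; case: podd. Qed.
Lemma qe_qvv i : qe i * (qv * qv) = 0.
Proof. by rewrite qe_arsum2 q_ar_neq // poddS; case: podd. Qed.
Lemma qe_quv i : qe i * (qu * qv) = q (ar i (podd i) * ar (i + 1) (podd i)).
Proof. by rewrite qe_arsum2 poddS negbK. Qed.
Lemma qe_qvu i : qe i * (qv * qu) = - (qe i * (qu * qv)).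
Proof. by rewrite qe_quv q_ar_eq opprK qe_arsum2 poddS. Qed.

Lemma sum_qe : \sum_i qe i = 1.
Proof. by rewrite -raddf_sum sum_vert. Qed.

Lemma qe_ext a b : (forall i, qe i * a = qe i * b) -> a = b.
Proof.
move=> ab; rewrite -[a]mul1r -[b]mul1r -sum_qe !mulr_suml.
by apply: eq_bigr => i _; exact: ab.
Qed.

Lemma qe_qu i : qe i * qu = q (ar i (podd i)).
Proof. by rewrite -qM vert_arsum. Qed.
Lemma qe_qv i : qe i * qv = q (ar i (~~ podd i)).
Proof. by rewrite -qM vert_arsum. Qed.

Lemma aco_qbasis t i s j : aco t i (qe j * qbasis s) = ((t == s) && (i == j))%:R.
Proof.
have -> : qe j * qbasis s =
    q (vert K (Q := Gamma) j * (arsum podd ^+ s.1 * arsum (fun i => ~~ podd i) ^+ s.2)).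
  by rewrite qM; congr (_ * _); rewrite qM !rmorphXn.
rewrite aco_q.
have pv f v r : pcoef (vert K (Q := Gamma) j * f) (v, r) = (v == j)%:R * pcoef f (v, r).
  exact: pcoef_vertM.
have p1 v r : pcoef (1 : PA) (v, r) = (nilp r)%:R by [].
have pS (c : 'Z_4 -> bool) v r : pcoef (arsum c) (v, r) =
  if r is e :: r' then (e == (v, c v))%:R * (nilp r')%:R else 0.
  by rewrite -[arsum c]mulr1 pcoef_arsumM; case: r.
case: s => [] [] []; rewrite /= ?expr0 ?expr1 ?mul1r ?(mulr1 (arsum _));
  case: t => [] [] []; rewrite /=; rewrite !pv ?pcoef_arsumM ?pS ?p1 /= -?pair_eqE ?poddS /= ?eqxx;
  rewrite ?mulr0 ?mul0r ?mulr1 ?mul1r ?subr0 // /podd;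
  by case: (odd i); rewrite /= ?mulr0 ?mul0r ?mulr1 ?subr0.
Qed.

Definition adec (a : A) := \sum_t \sum_i aco t i a *: (qe i * qbasis t).

Lemma adec_linear k a b : adec (k *: a + b) = k *: adec a + adec b.
Proof.
rewrite scaler_sumr -big_split; apply: eq_bigr => t _ /=.
rewrite scaler_sumr -big_split; apply: eq_bigr => i _ /=.
by rewrite aco_linear scalerDl scalerA.
Qed.

Lemma adec_qbasis i t : adec (qe i * qbasis t) = qe i * qbasis t.
Proof.
rewrite /adec (bigD1 t) //= (bigD1 i) //= aco_qbasis !eqxx scale1r.
rewrite big1 ?addr0 => [|j ji]; last by rewrite aco_qbasis (negbTE ji) andbF scale0r.
rewrite big1 ?addr0 // => s st; rewrite big1 // => j _.
by rewrite aco_qbasis (negbTE st) scale0r.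
Qed.

(** Spanning: in A a path of length at most 2 is zero or a basis element up to sign, and [q_ar3]
    kills the longer ones. *)
Lemma adecE a : a = adec a.
Proof.
have d0 : 0 = adec 0.
  by rewrite -[X in adec X](subrr (0 : A)) -scaleN1r addrC adec_linear scaleN1r addNr.
have dZ k x : x = adec x -> k *: x = adec (k *: x).
  by move=> xE; rewrite -[in RHS](addr0 (k *: x)) adec_linear -xE -d0 addr0.
have dN x : x = adec x -> - x = adec (- x) by rewrite -scaleN1r; exact: dZ.
have dq v s : is_walk v s -> q (ppath K v s) = adec (q (ppath K v s)).
  have qar i c : q (ar i c) = adec (q (ar i c)).
    have [->|/negPf ci] := eqVneq c (podd i).
      by have := adec_qbasis i (true, false); rewrite /qbasis /= expr0 mulr1 expr1 qe_qu.
    have -> : c = ~~ podd i by case: c ci; case: podd.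
    by have := adec_qbasis i (false, true); rewrite /qbasis /= expr0 mul1r expr1 qe_qv.
  have qar2 i c c' : q (ar i c * ar (i + 1) c') = adec (q (ar i c * ar (i + 1) c')).
    have [<-|cc] := eqVneq c c'; last by rewrite q_ar_neq.
    have := adec_qbasis i (true, true); rewrite /qbasis /= !expr1 qe_quv => dE.
    have [->|/negPf ci] := eqVneq c (podd i); first by rewrite dE.
    have -> : c = ~~ podd i by case: c ci; case: podd.
    by rewrite q_ar_eq negbK; exact: dN.
  case: s => [_|[i c] [|[i2 c2] [|[i3 c3] s]]] /=.
  - by have := adec_qbasis v (false, false); rewrite /qbasis /= !expr0 !mulr1.
  - by move=> _; rewrite ar_vert eqxx mulr1n.
  - case/and3P => _ /eqP /= -> _; rewrite ar_vert eqxx mulr1n; exact: qar2.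
  - case/and4P => _ /eqP /= -> /eqP /= -> _.
    by rewrite !mulrA -[_ * _ * ar _ _]mulrA qM q_ar3 mul0r.
have [f ->] := qproj_surj a; have [r rw ->] := path_alg_span f.
rewrite raddf_sum big_seq; apply: (big_ind (fun a => a = adec a)) => //.
  by move=> x y xE yE; rewrite -[x]scale1r adec_linear -xE -yE.
have qZ k g : q (k *: g) = k *: q g by exact: linearZ.
move=> p pr; suff : q (pcoef f p *: ppath K p.1 p.2) =
    adec (q (pcoef f p *: ppath K p.1 p.2)) by [].
rewrite !qZ.
by apply: dZ; apply: dq; exact: rw.
Qed.

Definition algA_cover : ext_cover A.
Proof.
refine (@ExtCover K A qe qu qv aco _ sum_qe _ _ _ _ _ aco_linear aco_qbasis adecE).
- by move=> i j; rewrite -qM vert_mul raddfMn.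
- by move=> i; rewrite qe_qu -qM arsum_vert.
- by move=> i; rewrite qe_qv -qM arsum_vert.
- by apply: qe_ext => i; rewrite qe_quu mulr0.
- by apply: qe_ext => i; rewrite qe_qvv mulr0.
- by apply: qe_ext => i; rewrite qe_qvu mulrN.
Defined.
End Cover.

(** * Maps that are linear over the vertices up to a rotation *)

Section TwistedLinear.
Variables (K : fieldType) (A : algType K) (C : ext_cover A).
Local Notation e := (vtx C).
Local Notation u := (gu C).
Local Notation v := (gv C).
Implicit Types (F G : A -> A) (s i : 'Z_4) (t : bool * bool).

Lemma uuA a : u * (u * a) = 0. Proof. by rewrite mulrA gu_gu mul0r. Qed.
Lemma vvA a : v * (v * a) = 0. Proof. by rewrite mulrA gv_gv mul0r. Qed.
Lemma vuA a : v * (u * a) = - (u * (v * a)).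
Proof. by rewrite mulrA gv_gu mulNr -mulrA. Qed.
Lemma uvu : u * (v * u) = 0. Proof. by rewrite gv_gu mulrN uuA oppr0. Qed.

Lemma u_vtx i : u * e i = e (i - 1) * u.
Proof. by rewrite vtx_u subrK. Qed.
Lemma v_vtx i : v * e i = e (i - 1) * v.
Proof. by rewrite vtx_v subrK. Qed.

Lemma cover_ind (S : A -> Prop) :
  (forall k a b, S a -> S b -> S (k *: a + b)) -> (forall a b, S a -> S b -> S (a * b)) ->
  (forall i, S (e i)) -> S u -> S v -> forall a, S a.
Proof.
move=> SP SM Se Su Sv a.
have S0 : S 0 by rewrite -(subrr (e 0)) addrC -scaleN1r; apply: SP.
have SD x y : S x -> S y -> S (x + y) by move=> Sx; rewrite -[x]scale1r; exact: SP.
have S1 : S 1 by rewrite -(sum_vtx C); apply: (big_ind S).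
have SX x (b : bool) : S x -> S (x ^+ b) by case: b.
rewrite (co_decomp C a); apply: (big_ind S) => // t _; apply: (big_ind S) => // i _.
by rewrite -[_ *: _]addr0; apply: SP => //; apply: (SM) => //; apply: (SM); apply: SX.
Qed.

Lemma co_vtx t i j a : co C t i (e j * a) = (i == j)%:R * co C t i a.
Proof.
have cD x y : co C t i (x + y) = co C t i x + co C t i y.
  by rewrite -[x]scale1r co_linear !scale1r.
have c0 : co C t i 0 = 0 by apply: (addIr (co C t i 0)); rewrite -cD !add0r.
have cZ k x : co C t i (k *: x) = k * co C t i x.
  by rewrite -[k *: x]addr0 co_linear c0 addr0.
have cS I (r : seq I) (F : I -> A) : co C t i (\sum_(k <- r) F k) = \sum_(k <- r) co C t i (F k).
  exact: (big_morph _ cD c0).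
rewrite {1 2}(co_decomp C a) mulr_sumr !cS mulr_sumr; apply: eq_bigr => s _.
rewrite mulr_sumr !cS mulr_sumr; apply: eq_bigr => k _.
rewrite -scalerAr !cZ [e j * _]mulrA vtx_mul co_basis.
have [->|jk] := eqVneq j k; first by rewrite mulr1n co_basis;
  case: (i == k); rewrite ?andbF ?andbT ?mul1r // !mulr0 ?mul0r.
rewrite mulr0n mul0r c0 mulr0; have [->|] := eqVneq i j; last by rewrite mul0r.
by rewrite (negbTE jk) andbF !mulr0.
Qed.

(* Maps that become E-linear, E the span of the vertices, after rotating the
   vertices of the target by s. *)
Definition twlinear s F := linear F /\ forall i a, F (e i * a) = e (i + s) * F a.

Lemma twlinear0 s F : twlinear s F -> F 0 = 0.
Proof.
by move=> [lF _]; have := lF (-1) 0 0; rewrite scaler0 addr0 scaleN1r addNr.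
Qed.
Lemma twlinearD s F a b : twlinear s F -> F (a + b) = F a + F b.
Proof. by move=> [lF _]; rewrite -[a]scale1r lF !scale1r. Qed.
Lemma twlinearN s F a : twlinear s F -> F (- a) = - F a.
Proof.
move=> sF; have [lF _] := sF; have := lF (-1) a 0.
by rewrite (twlinear0 sF) !addr0 !scaleN1r.
Qed.
Lemma twlinearZ s F k a : twlinear s F -> F (k *: a) = k *: F a.
Proof.
by move=> sF; have [lF _] := sF; have := lF k a 0; rewrite (twlinear0 sF) !addr0.
Qed.
Lemma twlinear_vtx s F i a : twlinear s F -> F (e i * a) = e (i + s) * F a.
Proof. by case. Qed.

Lemma twlinear_sum s F I (r : seq I) (P : pred I) (a : I -> A) : twlinear s F ->
  F (\sum_(i <- r | P i) a i) = \sum_(i <- r | P i) F (a i).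
Proof. by move=> sF; apply: (big_morph F) => [x y|]; [exact: twlinearD sF|exact: twlinear0 sF]. Qed.

(** The elements 1, u, v, uv span A over the vertices. Most identities between elements of the
    resolution are checked on these four values. *)
Lemma twlinear_ext s F G : twlinear s F -> twlinear s G ->
  F 1 = G 1 -> F u = G u -> F v = G v -> F (u * v) = G (u * v) -> forall a, F a = G a.
Proof.
move=> sF sG F1 Fu Fv Fw a; rewrite (co_decomp C a).
rewrite (twlinear_sum _ _ _ sF) (twlinear_sum _ _ _ sG); apply: eq_bigr => t _.
rewrite (twlinear_sum _ _ _ sF) (twlinear_sum _ _ _ sG); apply: eq_bigr => i _.
rewrite (twlinearZ _ _ sF) (twlinearZ _ _ sG) (twlinear_vtx _ _ sF) (twlinear_vtx _ _ sG).
by case: t => [] [] []; rewrite /= ?expr0 ?expr1 ?mulr1 ?mul1r ?Fw ?Fu ?Fv ?F1.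
Qed.

Lemma twlinear_cst0 s : twlinear s (fun=> 0).
Proof. by split=> [k a b|i a]; rewrite ?scaler0 ?addr0 ?mulr0. Qed.
Lemma twlinearP s k F G : twlinear s F -> twlinear s G ->
  twlinear s (fun a => k *: F a + G a).
Proof.
move=> [lF eF] [lG eG]; split=> [c a b|i a].
  by rewrite lF lG !scalerDr !scalerA [c * k]mulrC addrACA.
by rewrite eF eG mulrDr scalerAr.
Qed.
Lemma twlinear_add s F G : twlinear s F -> twlinear s G ->
  twlinear s (fun a => F a + G a).
Proof.
move=> sF sG; have := twlinearP 1 sF sG; congr (twlinear _ _).
by apply/funext => a; rewrite scale1r.
Qed.
Lemma twlinear_scale s k F : twlinear s F -> twlinear s (fun a => k *: F a).
Proof.
move=> sF; have := twlinearP k sF (twlinear_cst0 s); congr (twlinear _ _).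
by apply/funext => a; rewrite addr0.
Qed.
Lemma twlinear_opp s F : twlinear s F -> twlinear s (fun a => - F a).
Proof.
move=> sF; have := twlinear_scale (-1) sF; congr (twlinear _ _).
by apply/funext => a; rewrite scaleN1r.
Qed.
Lemma twlinear_rmulin s F b : twlinear s F -> twlinear s (fun a => F (a * b)).
Proof.
move=> [lF eF]; split=> [k x y|i x]; first by rewrite mulrDl -scalerAl lF.
by rewrite -mulrA eF.
Qed.
Lemma twlinear_rmul s F b : twlinear s F -> twlinear s (fun a => F a * b).
Proof.
move=> [lF eF]; split=> [k x y|i x]; first by rewrite lF mulrDl -scalerAl.
by rewrite eF mulrA.
Qed.
Lemma twlinear_inu s F : twlinear (s + 1) F -> twlinear s (fun a => F (u * a)).
Proof.
move=> [lF eF]; split=> [k x y|i x]; first by rewrite mulrDr -scalerAr lF.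
by rewrite mulrA u_vtx -mulrA eF addrACA addNr addr0.
Qed.
Lemma twlinear_inv s F : twlinear (s + 1) F -> twlinear s (fun a => F (v * a)).
Proof.
move=> [lF eF]; split=> [k x y|i x]; first by rewrite mulrDr -scalerAr lF.
by rewrite mulrA v_vtx -mulrA eF addrACA addNr addr0.
Qed.
Lemma twlinear_outu s F : twlinear (s + 1) F -> twlinear s (fun a => u * F a).
Proof.
move=> [lF eF]; split=> [k x y|i x]; first by rewrite lF mulrDr -scalerAr.
by rewrite eF mulrA u_vtx -mulrA addrA addrK.
Qed.
Lemma twlinear_outv s F : twlinear (s + 1) F -> twlinear s (fun a => v * F a).
Proof.
move=> [lF eF]; split=> [k x y|i x]; first by rewrite lF mulrDr -scalerAr.
by rewrite eF mulrA v_vtx -mulrA addrA addrK.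
Qed.

Definition twmap s (g : bool * bool -> A) (a : A) : A :=
  \sum_t \sum_i co C t i a *: (e (i + s) * g t).

Lemma twmap_twlinear s g : twlinear s (twmap s g).
Proof.
split=> [k a b|j a]; rewrite /twmap ?scaler_sumr ?mulr_sumr -?big_split; apply: eq_bigr => t _ /=.
  rewrite scaler_sumr -big_split; apply: eq_bigr => i _ /=.
  by rewrite co_linear scalerDl scalerA.
rewrite mulr_sumr; apply: eq_bigr => i _.
rewrite co_vtx -scalerAr mulrA vtx_mul (inj_eq (addIr s)) eq_sym.
by case: eqP => [->|_]; rewrite ?mul1r ?mulr1n // mul0r !mulr0n mul0r scaler0 scale0r.
Qed.

Lemma twmapE s g t : twmap s g (u ^+ t.1 * v ^+ t.2) = g t.
Proof.
have sl := twmap_twlinear s g.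
rewrite -[X in twmap _ _ X]mul1r -(sum_vtx C) mulr_suml (twlinear_sum _ _ _ sl).
rewrite -[RHS]mul1r -(sum_vtx C) [in RHS](reindex_inj (addIr s)) /= mulr_suml.
apply: eq_bigr => i _; rewrite /twmap (bigD1 t) //= (bigD1 i) //= co_basis !eqxx scale1r.
rewrite big1 ?addr0 => [|j ji]; last by rewrite co_basis (negbTE ji) andbF scale0r.
rewrite big1 ?addr0 // => t' tt; rewrite big1 // => j _.
by rewrite co_basis (negbTE tt) scale0r.
Qed.

Lemma twmap1 s g : twmap s g 1 = g (false, false).
Proof. by rewrite -[RHS](twmapE s) /= !expr0 mulr1. Qed.
Lemma twmapu s g : twmap s g u = g (true, false).
Proof. by rewrite -[RHS](twmapE s) /= expr0 mulr1. Qed.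
Lemma twmapv s g : twmap s g v = g (false, true).
Proof. by rewrite -[RHS](twmapE s) /= expr0 mul1r. Qed.
Lemma twmapw s g : twmap s g (u * v) = g (true, true).
Proof. by rewrite -[RHS](twmapE s). Qed.
End TwistedLinear.

(** * The Koszul bimodule resolution *)

Section Resolution.
Variables (K : fieldType) (A : algType K) (C : ext_cover A).
Local Notation e := (vtx C).
Local Notation u := (gu C).
Local Notation v := (gv C).
Implicit Types (F : nat -> A -> A) (n m : nat).

(** If r starts at i and l(r a) is nonzero, then r a has length 2: the generator g of degree n
    leaves i + 2, and b starts at i + n + 2. *)
Definition twist n : 'Z_4 := n.+2%:R.
Lemma twistS n : twist n.+1 = twist n + 1. Proof. by rewrite /twist mulrSr. Qed.

(* Let l be the Frobenius form e_i u v |-> e_i of A.  The element a g_m b of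
   A (x) A is represented by the map r |-> l(r a) b, rotated so as to be E-linear;
   F is the family of these maps for m = 0, ..., n.  In this form both actions
   are evident and no tensor product is needed. *)
Definition kos_pred n F : Prop :=
  (forall m, twlinear C (twist n) (F m)) /\ (forall m, (n < m)%N -> forall a, F m a = 0).

Fact kos_pred0 n : kos_pred n 0.
Proof. by split=> // m; exact: twlinear_cst0. Qed.
Fact kos_predP n k F G : kos_pred n F -> kos_pred n G -> kos_pred n (k *: F + G).
Proof.
move=> [sF bF] [sG bG]; split=> [m|m ltm a]; first exact: twlinearP.
by rewrite -[LHS]/(k *: F m a + G m a) bF // bG // scaler0 addr0.
Qed.
Definition kos_sub n : submod (nat -> A -> A) := Submod (@kos_pred0 n) (@kos_predP n).
Definition kosT n : Type := submod_of (kos_sub n).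
HB.instance Definition _ n := GRing.Lmodule.on (kosT n).

Fact kos_lact_pred n F a : kos_pred n F -> kos_pred n (fun m r => F m (r * a)).
Proof.
by move=> [sF bF]; split=> [m|m ltm r]; [exact: twlinear_rmulin|rewrite bF].
Qed.
Fact kos_ract_pred n F a : kos_pred n F -> kos_pred n (fun m r => F m r * a).
Proof.
by move=> [sF bF]; split=> [m|m ltm r]; [exact: twlinear_rmul|rewrite bF // mul0r].
Qed.

Definition kosl n (a : A) (x : kosT n) : kosT n :=
  @to_submod _ _ (kos_sub n) _ (kos_lact_pred a (submod_valP x)).
Definition kosr n (x : kosT n) (a : A) : kosT n :=
  @to_submod _ _ (kos_sub n) _ (kos_ract_pred a (submod_valP x)).

Definition kval n (x : kosT n) : nat -> A -> A := val x.
Lemma kvalP n (x : kosT n) : kos_pred n (kval x).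
Proof. exact: (@submod_valP _ _ (kos_sub n) x). Qed.
Lemma kval_sl n (x : kosT n) m : twlinear C (twist n) (kval x m).
Proof. by have [] := kvalP x. Qed.
Lemma kval_high n (x : kosT n) m a : (n < m)%N -> kval x m a = 0.
Proof. by move=> ltm; have [_ ->] := kvalP x. Qed.
Lemma kos_eq n (x y : kosT n) : (forall m a, kval x m a = kval y m a) -> x = y.
Proof. by move=> xy; apply/val_inj/funext => m; apply/funext => a; exact: xy. Qed.
Lemma kvalD n (x y : kosT n) m a : kval (x + y) m a = kval x m a + kval y m a.
Proof. by []. Qed.
Lemma kvalN n (x : kosT n) m a : kval (- x) m a = - kval x m a.
Proof. by []. Qed.
Lemma kvalZ n k (x : kosT n) m a : kval (k *: x) m a = k *: kval x m a.
Proof. by []. Qed.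
Lemma kval0 n m a : kval (0 : kosT n) m a = 0.
Proof. by []. Qed.
Lemma kval_sum n I (r : seq I) (x : I -> kosT n) m a :
  kval (\sum_(i <- r) x i) m a = \sum_(i <- r) kval (x i) m a.
Proof. exact: (big_morph (fun x : kosT n => kval x m a)). Qed.

Lemma kval_kosl n (x : kosT n) a m r : kval (kosl a x) m r = kval x m (r * a).
Proof. by []. Qed.
Lemma kval_kosr n (x : kosT n) a m r : kval (kosr x a) m r = kval x m r * a.
Proof. by []. Qed.

Fact kosl_linear n a : linear (@kosl n a).
Proof. by move=> k x y; apply: kos_eq => m r; rewrite kval_kosl !kvalD !kvalZ. Qed.
Fact kosl_linearl n (x : kosT n) : linear ((@kosl n)^~ x).
Proof.
move=> k a b; apply: kos_eq => m r; have [lx _] := kval_sl x m.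
by rewrite kvalD kvalZ !kval_kosl mulrDr -scalerAr lx.
Qed.
Fact kosl1 n (x : kosT n) : kosl 1 x = x.
Proof. by apply: kos_eq => m r; rewrite kval_kosl mulr1. Qed.
Fact koslM n a b (x : kosT n) : kosl (a * b) x = kosl a (kosl b x).
Proof. by apply: kos_eq => m r; rewrite !kval_kosl mulrA. Qed.
Fact kosr_linear n a : linear ((@kosr n)^~ a).
Proof.
move=> k x y; apply: kos_eq => m r.
by rewrite kvalD kvalZ !kval_kosr kvalD kvalZ mulrDl -scalerAl.
Qed.
Fact kosr_linearr n (x : kosT n) : linear (@kosr n x).
Proof.
move=> k a b; apply: kos_eq => m r.
by rewrite kvalD kvalZ !kval_kosr mulrDr -scalerAr.
Qed.
Fact kosr1 n (x : kosT n) : kosr x 1 = x.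
Proof. by apply: kos_eq => m r; rewrite kval_kosr mulr1. Qed.
Fact kosrM n (x : kosT n) a b : kosr x (a * b) = kosr (kosr x a) b.
Proof. by apply: kos_eq => m r; rewrite !kval_kosr mulrA. Qed.
Fact koslrA n a (x : kosT n) b : kosl a (kosr x b) = kosr (kosl a x) b.
Proof. by apply: kos_eq => m r; rewrite kval_kosl !kval_kosr kval_kosl. Qed.

Definition kos n : bimodule A :=
  @Bimodule K A (kosT n) (@kosl n) (@kosr n) (@kosl_linear n) (@kosl_linearl n)
    (@kosl1 n) (@koslM n) (@kosr_linear n) (@kosr_linearr n) (@kosr1 n) (@kosrM n)
    (@koslrA n).

Lemma kval_lact n (x : kos n) a m r : kval (lact a x) m r = kval x m (r * a).
Proof. by []. Qed.
Lemma kval_ract n (x : kos n) a m r : kval (ract x a) m r = kval x m r * a.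
Proof. by []. Qed.

(* d (a g_m b) read through l: since l(s u) = - l(u s) up to rotation,
   multiplying a by u on the right is - F(u _). *)
Definition kosd_fun n F m (r : A) : A :=
  if (m <= n)%N then
    - F m.+1 (u * r) - F m (v * r) + (-1) ^+ n.+1 *: (u * F m.+1 r + v * F m r)
  else 0.

Fact kosd_pred n F : kos_pred n.+1 F -> kos_pred n (kosd_fun n F).
Proof.
move=> [sF bF]; have sF' m : twlinear C (twist n + 1) (F m) by rewrite -twistS.
split=> [m|m ltnm r]; last by rewrite /kosd_fun leqNgt ltnm.
rewrite /kosd_fun; case: leqP => _; last exact: twlinear_cst0.
apply: twlinear_add; last apply: twlinear_scale.
  by apply: twlinear_add; apply: twlinear_opp; [exact: twlinear_inu|exact: twlinear_inv].
by apply: twlinear_add; [exact: twlinear_outu|exact: twlinear_outv].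
Qed.
Definition kosd n (x : kos n.+1) : kos n :=
  @to_submod _ _ (kos_sub n) _ (kosd_pred (submod_valP x)).

Lemma kval_kosd n (x : kos n.+1) m r : (m <= n)%N -> kval (kosd x) m r =
  - kval x m.+1 (u * r) - kval x m (v * r) +
  (-1) ^+ n.+1 *: (u * kval x m.+1 r + v * kval x m r).
Proof. by move=> lemn; rewrite /kval /= /kosd_fun lemn. Qed.

Fact kosd_linear_aux (V : lmodType K) (k s : K) (a a' b b' c c' d d' : V) :
  - (k *: a + a') - (k *: b + b') + s *: (k *: c + c' + (k *: d + d')) =
  k *: (- a - b + s *: (c + d)) + (- a' - b' + s *: (c' + d')).
Proof.
rewrite -!opprD (addrACA _ a') (addrACA _ c') -!scalerDr (scalerDr s).
by rewrite [in RHS]scalerDr scalerN !scalerA [k * s]mulrC (opprD (k *: _)) addrACA.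
Qed.

Lemma kosd_bihom n : bihom (@kosd n).
Proof.
split=> [k x y|a x|x a]; apply: kos_eq => m r.
- rewrite kvalD kvalZ; have [lemn|ltnm] := leqP m n; last first.
    by rewrite !kval_high // scaler0 addr0.
  rewrite !kval_kosd // !kvalD !kvalZ !mulrDr -!scalerAr.
  exact: kosd_linear_aux.
- rewrite kval_lact; have [lemn|ltnm] := leqP m n; last by rewrite !kval_high.
  by rewrite !kval_kosd // !kval_lact !mulrA.
- rewrite kval_ract; have [lemn|ltnm] := leqP m n; last by rewrite !kval_high // mul0r.
  by rewrite !kval_kosd // !kval_ract mulrDl mulrBl mulNr -scalerAl mulrDl !mulrA.
Qed.

Fact kosd_kosd_aux (V : lmodType K) (s : K) (x y a b c d : V) :
  - (x - s *: (a + b)) - (- x - s *: (c + d)) +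
  s *: (- a - c - s *: y + (- b - d - - (s *: y))) = 0.
Proof.
rewrite !opprD !opprK addrACA addNr add0r [(_ - _) + (- b - d + _)]addrACA.
rewrite addNr addr0 [- a - c + _]addrACA -!opprD scalerN -!scalerDr.
by rewrite subrr.
Qed.

(** Terms that act twice on the same side cancel by u^2 = v^2 = 0 and uv + vu = 0, those that act
    once on each side because the sign (-1)^n alternates. *)
Lemma kosd_kosd n (x : kos n.+2) : kosd (kosd x) = 0.
Proof.
apply: kos_eq => m r; rewrite kval0.
have [lemn|ltnm] := leqP m n; last by rewrite kval_high.
have sl k := kval_sl x k.
have lemn1 : (m <= n.+1)%N := leqW lemn.
rewrite kval_kosd // !kval_kosd //.
rewrite uuA vvA vuA !(twlinearN _ (sl _)) !(twlinear0 (sl _)) oppr0 opprK !(subr0, add0r).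
rewrite !mulrDr !mulrN -!scalerAr !mulrDr uuA vvA vuA !(add0r, addr0) scalerN.
rewrite [(-1) ^+ n.+2]exprS mulN1r !scaleNr.
exact: kosd_kosd_aux.
Qed.

End Resolution.

(** * Bimodule maps prescribed on a generator *)

Section Evaluation.
Variables (K : fieldType) (A : algType K) (C : ext_cover A).
Local Notation e := (vtx C).
Local Notation u := (gu C).
Local Notation v := (gv C).
Variable M : bimodule A.
Implicit Types (x : M) (a b : A).

Definition mid a x b : M := lact a (ract x b).

Lemma lactD a x y : lact a (x + y : M) = lact a x + lact a y.
Proof. by rewrite -[x]scale1r lact_linear !scale1r. Qed.
Lemma ractD a x y : ract (x + y : M) a = ract x a + ract y a.
Proof. by rewrite -[x]scale1r ract_linear !scale1r. Qed.
Lemma lact0 a : lact a (0 : M) = 0.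
Proof. by apply: (addIr (lact a 0)); rewrite -lactD !add0r. Qed.
Lemma ract0 a : ract (0 : M) a = 0.
Proof. by apply: (addIr (ract 0 a)); rewrite -ractD !add0r. Qed.
Lemma lactN a x : lact a (- x) = - lact a x.
Proof. by rewrite -[- x]addr0 -scaleN1r lact_linear lact0 addr0 scaleN1r. Qed.
Lemma lactDl a b x : lact (a + b) x = lact a x + lact b x.
Proof. by have := lact_linearl x 1 a b; rewrite !scale1r. Qed.
Lemma ractDr a b x : ract x (a + b) = ract x a + ract x b.
Proof. by have := ract_linearr x 1 a b; rewrite !scale1r. Qed.
Lemma lact0l x : lact 0 x = 0.
Proof. by apply: (addIr (lact 0 x)); rewrite -lactDl !add0r. Qed.
Lemma ract0r x : ract x 0 = 0.
Proof. by apply: (addIr (ract x 0)); rewrite -ractDr !add0r. Qed.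
Lemma lactNl a x : lact (- a) x = - lact a x.
Proof. by have := lact_linearl x (-1) a 0; rewrite lact0l !addr0 !scaleN1r. Qed.
Lemma ractNr a x : ract x (- a) = - ract x a.
Proof. by have := ract_linearr x (-1) a 0; rewrite ract0r !addr0 !scaleN1r. Qed.

Lemma lact_mid a b x c : lact a (mid b x c) = mid (a * b) x c.
Proof. by rewrite /mid lactM. Qed.
Lemma ract_mid a b x c : ract (mid a x b) c = mid a x (b * c).
Proof. by rewrite /mid -lractA ractM. Qed.

(* The bimodule map that sends the generator to x: with respect to l the bases
   (1, u, v, u v) and (u v, v, - u, 1) are dual. *)
Definition koseval1 x (F : A -> A) : M :=
  mid (u * v) x (F 1) + mid v x (F u) - mid u x (F v) + mid 1 x (F (u * v)).

Lemma mid_linear a x k b c : mid a x (k *: b + c) = k *: mid a x b + mid a x c.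
Proof. by rewrite /mid ract_linearr lact_linear. Qed.
Lemma mid0 a x : mid a x 0 = 0. Proof. by rewrite /mid ract0r lact0. Qed.
Lemma mid0l x b : mid 0 x b = 0. Proof. exact: lact0l. Qed.
Lemma midNl a x b : mid (- a) x b = - mid a x b. Proof. exact: lactNl. Qed.
Lemma midN a x b : mid a x (- b) = - mid a x b.
Proof. by rewrite /mid ractNr lactN. Qed.

Lemma koseval1_linear x k (F G : A -> A) :
  koseval1 x (fun a => k *: F a + G a) = k *: koseval1 x F + koseval1 x G.
Proof.
rewrite /koseval1 !mid_linear !scalerDr scalerN.
set a := k *: _; set b := k *: _; set c := k *: _; set d := k *: _.
by rewrite opprD (addrACA a) (addrACA (a + b)) (addrACA (a + b - c)).
Qed.

Lemma koseval1_ract x (F : A -> A) a :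
  koseval1 x (fun b => F b * a) = ract (koseval1 x F) a.
Proof.
have ractN y : ract (- y : M) a = - ract y a.
  by rewrite -[- y]addr0 -scaleN1r ract_linear ract0 addr0 scaleN1r.
by rewrite /koseval1 !ractD ractN !ract_mid.
Qed.

(** The generators of degree n run from i to i + n; these are the elements of M to which such a
    generator may be sent. *)
Definition commutes_vtx n x := forall i, lact (e i) x = ract x (e (i + n%:R)).

Lemma mid_vtx n x a b i : commutes_vtx n x ->
  mid (a * e i) x b = mid a x (e (i + n%:R) * b).
Proof. by move=> cx; rewrite /mid lactM !ractM -cx lractA. Qed.

(** This is the Casimir identity for dual bases b, b': the sums of b x F(b' a) and of a b x F(b')
    agree. With the claim stated for all [F], the valid [a] form a subalgebra, so only the vertices,
    u and v are to be checked; for the vertices the rotations of x and [F] have to match. *)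
Lemma koseval1_lact n x (F : A -> A) a : commutes_vtx n x -> twlinear C (twist n) F ->
  koseval1 x (fun b => F (b * a)) = lact a (koseval1 x F).
Proof.
move=> cx; move: a F; apply: (@cover_ind _ _ C) => [k a b Sa Sb|a b Sa Sb|i||] F sF.
- rewrite lact_linearl -Sa // -Sb // -koseval1_linear; congr koseval1.
  by apply/funext => c; rewrite mulrDr -scalerAr; have [-> _] := sF.
- rewrite lactM -Sb // -Sa; last exact: twlinear_rmulin.
  by congr koseval1; apply/funext => c; rewrite mulrA.
- have eE j b : F (e j * b) = e (j + twist n) * F b by have [_ ->] := sF.
  have tE : twist n = n%:R + 1 + 1 by rewrite /twist !mulrSr.
  have F1 : F (1 * e i) = e (i + 1 + 1 + n%:R) * F 1.
    by rewrite mul1r -[e i]mulr1 eE tE; congr (e _ * _); ring.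
  have Fu : F (u * e i) = e (i + 1 + n%:R) * F u.
    by rewrite u_vtx eE tE; congr (e _ * _); ring.
  have Fv : F (v * e i) = e (i + 1 + n%:R) * F v.
    by rewrite v_vtx eE tE; congr (e _ * _); ring.
  have Fw : F (u * v * e i) = e (i + n%:R) * F (u * v).
    by rewrite -mulrA v_vtx mulrA u_vtx -mulrA eE tE; congr (e _ * _); ring.
  rewrite /koseval1 F1 Fu Fv Fw -!(mid_vtx _ _ _ cx) !lactD lactN !lact_mid.
  by rewrite mulr1 mul1r mulrA !vtx_u -[u * e _ * v]mulrA !vtx_v mulrA.
- rewrite /koseval1 !lactD lactN !lact_mid mul1r mulr1 gu_gu -mulrA uvu uuA gv_gu.
  rewrite (twlinear0 sF) (twlinearN _ sF) !mid0 !mid0l midN opprK.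
  by rewrite !(subr0, addr0, add0r).
- rewrite /koseval1 !lactD lactN !lact_mid mul1r mulr1 gv_gv -mulrA gv_gv vuA gv_gv.
  rewrite !mulr0 oppr0 (twlinear0 sF) gv_gu !mid0 !mid0l midNl opprK.
  by rewrite !(subr0, addr0, add0r).
Qed.
End Evaluation.

(** * Generators, projectivity and the differential on generators *)

Section Generators.
Variables (K : fieldType) (A : algType K) (C : ext_cover A).
Local Notation e := (vtx C).
Local Notation u := (gu C).
Local Notation v := (gv C).
Local Notation Q := (kos C).
Implicit Types n m j : nat.

(** The Frobenius form l itself, rotated by [twist n]. Placed in slot j it represents a g_j b with a
    = b = 1. *)
Definition soc n : A -> A := twmap C (twist n) (fun t => (t == (true, true))%:R).

Lemma soc_twlinear n : twlinear C (twist n) (soc n).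
Proof. exact: twmap_twlinear. Qed.
Lemma soc1 n : soc n 1 = 0. Proof. by rewrite /soc twmap1. Qed.
Lemma socu n : soc n u = 0. Proof. by rewrite /soc twmapu. Qed.
Lemma socv n : soc n v = 0. Proof. by rewrite /soc twmapv. Qed.
Lemma socw n : soc n (u * v) = 1. Proof. by rewrite /soc twmapw. Qed.
Lemma soc0 n : soc n 0 = 0. Proof. exact: twlinear0 (soc_twlinear n). Qed.
Lemma socN n a : soc n (- a) = - soc n a.
Proof. exact: twlinearN (soc_twlinear n). Qed.

Fact kosgen_pred n j : kos_pred C n (fun m a => if (m == j) && (j <= n)%N then soc n a else 0).
Proof.
split=> [m|m ltnm a].
  by case: (_ && _); [exact: soc_twlinear|exact: twlinear_cst0].
by case: eqP => //= <-; rewrite leqNgt ltnm.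
Qed.
(** The value 0 for j > n lets the formula for d g_j hold at both ends of the range of j, where it
    mentions a generator that is out of range. *)
Definition kosgen n j : Q n := @to_submod _ _ (kos_sub C n) _ (kosgen_pred n j).

Lemma kval_kosgen n j m a :
  kval (kosgen n j) m a = if (m == j) && (j <= n)%N then soc n a else 0.
Proof. by []. Qed.

Lemma kosgen_high n j : (n < j)%N -> kosgen n j = 0.
Proof. by move=> ltnj; apply: kos_eq => m a; rewrite kval_kosgen leqNgt ltnj andbF. Qed.

Lemma kosgen_vtx n j : commutes_vtx C n (kosgen n j).
Proof.
move=> i; apply: kos_eq => m a.
rewrite kval_lact kval_ract !kval_kosgen; case: ifP => _; last by rewrite mul0r.
have tE : twist n = n%:R + 1 + 1 by rewrite /twist !mulrSr.
have sl := soc_twlinear n.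
move: a; apply: twlinear_ext (twlinear_rmulin _ sl) (twlinear_rmul _ sl) _ _ _ _.
- by rewrite mul1r soc1 mul0r -[e i]mulr1 (twlinear_vtx _ _ sl) soc1 mulr0.
- by rewrite u_vtx (twlinear_vtx _ _ sl) socu mulr0 mul0r.
- by rewrite v_vtx (twlinear_vtx _ _ sl) socv mulr0 mul0r.
- rewrite -mulrA v_vtx mulrA u_vtx -mulrA (twlinear_vtx _ _ sl) socw mul1r mulr1.
  by congr (e _); rewrite tE; ring.
Qed.

Section Koseval.
Variable M : bimodule A.
Implicit Type x : nat -> M.

Definition koseval n x (F : Q n) : M := \sum_(j < n.+1) koseval1 C (x j) (kval F j).

Lemma koseval_bihom n x : (forall j, (j <= n)%N -> commutes_vtx C n (x j)) ->
  bihom (@koseval n x).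
Proof.
move=> cx; split=> [k F G|a F|F a].
- rewrite /koseval scaler_sumr -big_split; apply: eq_bigr => j _ /=.
  by rewrite -koseval1_linear.
- rewrite /koseval (big_morph _ (@lactD _ _ _ a) (@lact0 _ _ _ a)).
  apply: eq_bigr => j _; rewrite -(koseval1_lact _ _ (kval_sl F j)) //.
  exact: cx (ltn_ord j).
- rewrite /koseval (big_morph (fun y : M => ract y a) (ractD a) (@ract0 _ _ _ a)).
  by apply: eq_bigr => j _; rewrite -koseval1_ract.
Qed.

Lemma mid11 (y : M) : mid 1 y 1 = y.
Proof. by rewrite /mid lact1 ract1. Qed.

Lemma koseval_kosgen n x j : (j <= n)%N -> koseval x (kosgen n j) = x j.
Proof.
move=> lejn; rewrite /koseval (bigD1 (Ordinal (lejn : (j < n.+1)%N))) //= big1 => [|i ij].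
  rewrite addr0 /koseval1 !kval_kosgen eqxx lejn /= soc1 socu socv socw !mid0 mid11.
  by rewrite subr0 !add0r.
have {}ij : (i == j :> nat) = false by apply: contraNF ij => /eqP ij; apply/eqP/val_inj.
by rewrite /koseval1 !kval_kosgen ij /= !mid0 subr0 !addr0.
Qed.
End Koseval.

(** The dual bases rebuild [F] from its values at 1, u, v and uv. Hence the g_j generate, and a
    bimodule map is determined by its values on them. *)
Lemma koseval_kosgen_id n (F : Q n) : koseval (kosgen n) F = F.
Proof.
apply: kos_eq => m a; rewrite kval_sum; have [lemn|ltnm] := leqP m n; last first.
  rewrite kval_high // big1 // => j _; rewrite /koseval1 !kvalD kvalN !kval_lact.
  by rewrite !kval_ract !kval_kosgen gtn_eqF ?(leq_trans (ltn_ord j)) //= !mul0r subr0 !addr0.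
rewrite (bigD1 (Ordinal (lemn : (m < n.+1)%N))) //= big1 ?addr0 => [|j jm]; last first.
  rewrite /koseval1 !kvalD kvalN !kval_lact !kval_ract !kval_kosgen.
  have -> : (m == j :> nat) = false.
    by apply: contraNF jm => /eqP jm; apply/eqP/val_inj.
  by rewrite /= !mul0r subr0 !addr0.
rewrite /koseval1 !kvalD kvalN !kval_lact !kval_ract !kval_kosgen eqxx lemn /= mulr1.
have sl := soc_twlinear n.
move: a; apply: twlinear_ext (kval_sl F m) _ _ _ _.
- apply: twlinear_add; last exact: twlinear_rmul.
  apply: twlinear_add; last by apply/twlinear_opp/twlinear_rmul/twlinear_rmulin.
  by apply: twlinear_add; apply/twlinear_rmul/twlinear_rmulin.
- by rewrite !mul1r socw socu socv soc1 !mul0r subr0 !addr0 mul1r.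
- by rewrite uuA gu_gu soc0 socw socu !mul0r mul1r subr0 addr0 add0r.
- rewrite vuA !gv_gv gv_gu mulr0 oppr0 socN soc0 socw socv !mul0r mulN1r opprK.
  by rewrite addr0 !add0r.
- rewrite -!mulrA uvu vuA gv_gv !mulr0 oppr0 mulr0 soc0 socw !mul0r.
  by rewrite subr0 !add0r mul1r.
Qed.

Lemma bihom_koseval n (M : bimodule A) (f : Q n -> M) (F : Q n) : bihom f ->
  f F = koseval (fun j => f (kosgen n j)) F.
Proof.
move=> hf; rewrite -{1}[F]koseval_kosgen_id (bihom_sum _ _ _ hf).
have [lf fl fr] := hf.
apply: eq_bigr => j _; rewrite /koseval1 /mid.
by rewrite (bihomD _ _ hf) (bihomB _ _ hf) (bihomD _ _ hf) !fl !fr.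
Qed.

Lemma bihom_kosgen_ext n (M : bimodule A) (f g : Q n -> M) : bihom f -> bihom g ->
  (forall j, (j <= n)%N -> f (kosgen n j) = g (kosgen n j)) -> forall F, f F = g F.
Proof.
move=> hf hg fg F; rewrite (bihom_koseval _ hf) (bihom_koseval _ hg).
by apply: eq_bigr => j _; rewrite fg // -ltnS.
Qed.

(** A preimage of g_j is cut by e_i on the left and by e_(i+n) on the right, then summed over i.
    This gives it the vertex behaviour of a generator and keeps its image. *)
Lemma kos_projective n : projective (Q n).
Proof.
move=> M N p f hp psurj hf.
pose m0 j : M := sval (cid (psurj (f (kosgen n j)))).
have m0E j : p (m0 j) = f (kosgen n j) by rewrite /m0; case: cid.
pose y j : M := \sum_i ract (lact (e i) (m0 j)) (e (i + n%:R)).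
have [lp pl pr] := hp; have [lf fl fr] := hf.
have yE j : p (y j) = f (kosgen n j).
  rewrite (bihom_sum _ _ _ hp) -[RHS](lact1 (f _)) -(sum_vtx C).
  rewrite (big_morph (fun a => lact a (f (kosgen n j))) (fun a b => lactDl a b _) (lact0l _)).
  apply: eq_bigr => i _; rewrite pr pl m0E -fl -fr -lractA -kosgen_vtx -lactM.
  by rewrite vtx_mul eqxx mulr1n fl.
have cy j : commutes_vtx C n (y j).
  move=> i; rewrite /y (big_morph _ (@lactD _ _ _ (e i)) (@lact0 _ _ _ (e i))).
  rewrite (big_morph (fun y : M => ract y (e (i + n%:R))) (ractD _) (@ract0 _ _ _ _)).
  apply: eq_bigr => k _; rewrite -!ractM lractA -lactM !vtx_mul (inj_eq (addIr _)) eq_sym.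
  by case: eqP => [->//|_]; rewrite !mulr0n lact0l ract0 ract0r.
exists (koseval y); first by apply: koseval_bihom => j _; exact: cy.
apply: bihom_kosgen_ext => // [|j lejn]; last by rewrite koseval_kosgen.
by apply: bihom_comp => //; apply: koseval_bihom => j _; exact: cy.
Qed.

(** Since vu = - uv, the form satisfies l(u a) = - l(a u), and likewise for v. This turns the minus
    signs of [kosd_fun] into left actions; the right actions come from moving u and v past the
    values of l, which are combinations of vertices. *)
Lemma kosd_kosgen n j : kosd (kosgen n.+1 j) =
  (if j is i.+1 then lact u (kosgen n i) else 0) + lact v (kosgen n j) +
  (-1) ^+ n.+1 *: ((if j is i.+1 then ract (kosgen n i) u else 0) + ract (kosgen n j) v).
Proof.
apply: kos_eq => m a; have [lemn|ltnm] := leqP m n; last by rewrite !kval_high.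
rewrite kval_kosd // !(kvalD, kvalZ).
have s1 := soc_twlinear n.
have s2 : twlinear C (twist n + 1) (soc n.+1) by rewrite -twistS; exact: soc_twlinear.
have uE : - soc n.+1 (u * a) = soc n (a * u).
  move: a; apply: twlinear_ext (twlinear_opp (twlinear_inu s2)) (twlinear_rmulin _ s1) _ _ _ _.
  - by rewrite mulr1 mul1r !socu oppr0.
  - by rewrite gu_gu !soc0 oppr0.
  - by rewrite gv_gu socN !socw.
  - by rewrite uuA -mulrA uvu !soc0 oppr0.
have vE : - soc n.+1 (v * a) = soc n (a * v).
  move: a {uE}; apply: twlinear_ext (twlinear_opp (twlinear_inv s2)) (twlinear_rmulin _ s1) _ _ _ _.
  - by rewrite mulr1 mul1r !socv oppr0.
  - by rewrite gv_gu socN !socw opprK.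
  - by rewrite gv_gv !soc0 oppr0.
  - by rewrite vuA -mulrA gv_gv !mulr0 oppr0 !soc0 oppr0.
have uE' : u * soc n.+1 a = soc n a * u.
  move: a {uE vE}; apply: twlinear_ext (twlinear_outu s2) (twlinear_rmul _ s1) _ _ _ _;
  by rewrite ?soc1 ?socu ?socv ?socw ?mulr0 ?mul0r ?mulr1 ?mul1r.
have vE' : v * soc n.+1 a = soc n a * v.
  move: a {uE vE uE'}; apply: twlinear_ext (twlinear_outv s2) (twlinear_rmul _ s1) _ _ _ _;
  by rewrite ?soc1 ?socu ?socv ?socw ?mulr0 ?mul0r ?mulr1 ?mul1r.
rewrite kval_lact kval_ract !kval_kosgen.
have -> : (m == j) && (j <= n.+1)%N = (m == j) && (j <= n)%N.
  by case: eqP => //= <-; rewrite lemn leqW.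
case: j => [|j]; rewrite ?kval_lact ?kval_ract ?kval_kosgen ?kval0 ?eqSS ?ltnS.
  by rewrite andFb oppr0 mulr0 !add0r; case: ifP => _; rewrite ?vE ?vE' // !mulr0 mul0r oppr0.
congr (_ + _ + _ *: (_ + _)).
- by case: ifP => _; rewrite ?uE ?oppr0.
- by case: ifP => _; rewrite ?vE ?oppr0.
- by case: ifP => _; rewrite ?uE' ?mul0r ?mulr0.
- by case: ifP => _; rewrite ?vE' ?mul0r ?mulr0.
Qed.
End Generators.

(** * Exactness of the Koszul complex *)

Section Exactness.
Variables (K : fieldType) (A : algType K) (C : ext_cover A).
Local Notation e := (vtx C).
Local Notation u := (gu C).
Local Notation v := (gv C).
Local Notation Q := (kos C).
Implicit Types n m j : nat.

Definition kosaug : Q 0 -> reg_bimod A := koseval (fun=> 1 : reg_bimod A).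

Lemma kosaugE (F : Q 0) : kosaug F =
  u * v * kval F 0 1 + v * kval F 0 u - u * kval F 0 v + kval F 0 (u * v) :> A.
Proof. by rewrite /kosaug /koseval big_ord1 /koseval1 /mid /= !mul1r. Qed.

Lemma kosaug_bihom : bihom kosaug.
Proof.
by apply: koseval_bihom => j _ i; rewrite addr0 [LHS]mulr1 [RHS]mul1r.
Qed.

Lemma kosaug_kosgen : kosaug (kosgen C 0 0) = 1.
Proof. exact: koseval_kosgen. Qed.

Lemma kosaug_surj a : exists x, kosaug x = a.
Proof.
exists (ract (kosgen C 0 0) a); have [_ _ ->] := kosaug_bihom.
by rewrite kosaug_kosgen [LHS]mul1r.
Qed.

Lemma kosaug_kosd (x : Q 1) : kosaug (kosd x) = 0.
Proof.
have [lf fl fr] := kosaug_bihom.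
apply: (bihom_kosgen_ext (bihom_comp (@kosd_bihom _ _ C 0) kosaug_bihom)
  (bihom_cst0 (Q 1) (reg_bimod A))).
move=> j lej; rewrite kosd_kosgen expr1 scaleN1r !(bihomB _ _ kosaug_bihom, bihomD _ _ kosaug_bihom).
case: j lej => [|[|//]] _; rewrite ?fl ?fr ?(bihom0 kosaug_bihom) ?kosaug_kosgen /=.
  by rewrite mulr1 mul1r subrr.
rewrite kosgen_high // (bihom0 kosaug_bihom) mulr0 mul0r !addr0.
by rewrite mulr1 mul1r subrr.
Qed.

(* A contracting homotopy of right modules; on left multiples of generators it is
   u g_n |-> g_(n+1), v g_m |-> g_m, u v g_m |-> u g_m, with the correction
   u v g_n |-> u g_n + (-1)^n g_(n+1) v. *)
Definition kosh_val n (F : nat -> A -> A) m (t : bool * bool) : A :=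
  if (m <= n)%N then
    match t with (false, true) => - F m 1 | (true, true) => F m u | _ => 0 end
  else if (m == n.+1) && (t == (true, true)) then
    - F n v + (-1) ^+ n *: (v * F n 1)
  else 0.

Fact kosh_pred n F : kos_pred C n.+1 (fun m => if (m <= n.+1)%N
  then twmap C (twist n.+1) (kosh_val n F m) else (fun=> 0)).
Proof.
split=> [m|m ltnm a]; last by rewrite leqNgt ltnm.
by case: leqP => _; [exact: twmap_twlinear|exact: twlinear_cst0].
Qed.
Definition kosh n (x : Q n) : Q n.+1 :=
  @to_submod _ _ (kos_sub C n.+1) _ (kosh_pred n (kval x)).

(** Both sides are compared at 1, u, v and uv. At 1 and u they agree for every x, at v in slot n the
    correction term of the homotopy does the work, and the remaining values are the three
    hypotheses. *)
Lemma kosd_kosh n (x : Q n) (F := kval x) (s : K := (-1) ^+ n) :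
  (forall m, (m < n)%N -> F m v = - F m.+1 u + s *: (u * F m.+1 1 + v * F m 1)) ->
  (forall m, (m < n)%N -> F m (u * v) = - (s *: (u * F m.+1 u + v * F m u))) ->
  F n (u * v) = s *: (u * F n v) - s *: (v * F n u) - u * v * F n 1 ->
  kosd (kosh x) = x.
Proof.
move=> Fv Fw Fn; apply: kos_eq => m r; have [lemn|ltnm] := leqP m n; last by rewrite !kval_high.
rewrite kval_kosd // exprS mulN1r scaleNr -/s -/F.
have H m' : (m' <= n)%N -> [/\ kval (kosh x) m' 1 = 0, kval (kosh x) m' u = 0,
    kval (kosh x) m' v = - F m' 1 & kval (kosh x) m' (u * v) = F m' u].
  move=> lem; rewrite {1 2 3 4}/kval /= leqW //.
  by rewrite twmap1 twmapu twmapv twmapw /kosh_val lem.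
have [H1 Hu Hv Hw] : [/\ kval (kosh x) n.+1 1 = 0, kval (kosh x) n.+1 u = 0,
    kval (kosh x) n.+1 v = 0 &
    kval (kosh x) n.+1 (u * v) = - F n v + s *: (v * F n 1)].
  rewrite {1 2 3 4}/kval /= leqnn.
  by rewrite twmap1 twmapu twmapv twmapw /kosh_val ltnn eqxx.
have sl m' : twlinear C (twist n + 1) (kval (kosh x) m').
  by rewrite -twistS; exact: kval_sl.
have H0 m' : kval (kosh x) m' 0 = 0 := twlinear0 (sl m').
move: r; apply: twlinear_ext (kval_sl x m) _ _ _ _.
- apply: twlinear_add; last apply/twlinear_opp/twlinear_scale.
    by apply: twlinear_add; apply: twlinear_opp; [exact: twlinear_inu|exact: twlinear_inv].
  by apply: twlinear_add; [exact: twlinear_outu|exact: twlinear_outv].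
- have [m1 mu mv mw] := H m lemn.
  rewrite !mulr1 mv m1 opprK mulr0 addr0.
  have -> : kval (kosh x) m.+1 u = 0.
    by case: (ltngtP m n) lemn => [/H[]//|//|-> //].
  have -> : kval (kosh x) m.+1 1 = 0.
    by case: (ltngtP m n) lemn => [/H[]//|//|-> //].
  by rewrite mulr0 scaler0 !oppr0 addr0 add0r.
- have [m1 mu mv mw] := H m lemn.
  rewrite gu_gu H0 gv_gu (twlinearN _ (sl m)) mw mu opprK oppr0 add0r mulr0 addr0.
  have -> : kval (kosh x) m.+1 u = 0.
    by case: (ltngtP m n) lemn => [/H[]//|//|-> //].
  by rewrite mulr0 scaler0 subr0.
- have [m1 mu mv mw] := H m lemn.
  rewrite -/F gv_gv H0 subr0 mv; case: (ltngtP m n) lemn => [ltmn _|//|mn _].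
    by have [_ _ -> ->] := H _ ltmn; rewrite [RHS](Fv _ ltmn) !mulrN -(opprD (u * _)) scalerN opprK.
  by rewrite mn Hw Hv mulr0 add0r mulrN scalerN opprK opprD opprK addrNK.
- have [m1 mu mv mw] := H m lemn.
  rewrite -/F uuA vuA gv_gv mulr0 oppr0 !H0 !oppr0 !add0r mw.
  case: (ltngtP m n) lemn => [ltmn _|//|mn _].
    by have [_ _ _ ->] := H _ ltmn; rewrite Fw.
  rewrite mn Hw Fn mulrDr mulrN -scalerAr !scalerDr scalerN scalerA -expr2 sqrr_sign scale1r.
  by rewrite !opprD opprK mulrA addrAC.
Qed.

(** For n = 0 the first two conditions of [kosd_kosh] are void and the third one is the vanishing of
    the augmentation. *)
Lemma kos_exact0 (x : Q 0) : kosaug x = 0 <-> exists y, kosd y = x.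
Proof.
split=> [|[y <-]]; last exact: kosaug_kosd.
rewrite kosaugE => x0; exists (kosh x); apply: kosd_kosh => //.
rewrite expr0 !scale1r; apply/eqP; rewrite -subr_eq0 -x0.
by apply/eqP; rewrite !opprB [RHS]addrC (addrA (u * v * _)).
Qed.

(** The first two conditions of [kosd_kosh] are d x = 0 read at 1 and at u; the third is the top
    slot read at v, combined with its reading at 1. *)
Lemma kos_exactS n (x : Q n.+1) : kosd x = 0 <-> exists y, kosd y = x.
Proof.
split=> [dx|[y <-]]; last exact: kosd_kosd.
have sl m := kval_sl x m; have sl0 m := twlinear0 (sl m).
have dE m r : (m <= n)%N -> kval x m.+1 (u * r) + kval x m (v * r) =
    (-1) ^+ n.+1 *: (u * kval x m.+1 r + v * kval x m r).
  move=> lem; have := congr1 (fun y => kval y m r) dx.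
  by rewrite kval_kosd // kval0 -opprD addrC => /eqP; rewrite subr_eq0 => /eqP ->.
have Fv m : (m <= n)%N -> kval x m v = - kval x m.+1 u +
    (-1) ^+ n.+1 *: (u * kval x m.+1 1 + v * kval x m 1).
  by move=> lem; rewrite -dE // !mulr1 addKr.
exists (kosh x); apply: kosd_kosh => [m|m|]; first exact: Fv.
  by move=> lem; rewrite -dE // gu_gu sl0 add0r gv_gu (twlinearN _ (sl m)) opprK.
have := dE n v (leqnn n); rewrite gv_gv sl0 addr0 => ->.
rewrite (Fv n (leqnn n)) mulrDr mulrN -scalerAr mulrDr vvA addr0 vuA.
by rewrite !scalerDr scalerN scalerA -expr2 sqrr_sign scale1r addrA mulrA.
Qed.

Definition kos_resolution : proj_resolution (reg_bimod A) :=
  @ProjResolution K A (reg_bimod A) Q (@kosd _ _ C) kosaug (@kos_projective _ _ C)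
    (@kosd_bihom _ _ C) kosaug_bihom kosaug_surj kos_exact0 kos_exactS.
End Exactness.

(** * Maps from the resolution to the algebra *)

Section Residue.
Variables (K : fieldType) (A : algType K) (C : ext_cover A).
Local Notation e := (vtx C).
Local Notation u := (gu C).
Local Notation v := (gv C).
Local Notation Q := (kos C).
Implicit Types (n m j : nat) (t : bool * bool) (i k : 'Z_4) (a b : A).

Lemma coD t i a b : co C t i (a + b) = co C t i a + co C t i b.
Proof. by rewrite -[a]scale1r co_linear !scale1r. Qed.
Lemma co0 t i : co C t i 0 = 0.
Proof. by apply: (addIr (co C t i 0)); rewrite -coD !add0r. Qed.
Lemma coZ t i (c : K) a : co C t i (c *: a) = c * co C t i a.
Proof. by rewrite -[c *: a]addr0 co_linear co0 addr0. Qed.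
Lemma coN t i a : co C t i (- a) = - co C t i a.
Proof. by rewrite -scaleN1r coZ mulN1r. Qed.
Lemma co_sum t i I (r : seq I) (P : pred I) (F : I -> A) :
  co C t i (\sum_(x <- r | P x) F x) = \sum_(x <- r | P x) co C t i (F x).
Proof. exact: (big_morph _ (coD t i) (co0 t i)). Qed.

Lemma co_mul_vtx t i k a : co C t i (a * e k) = (i + (t.1 + t.2)%:R == k)%:R * co C t i a.
Proof.
rewrite {1 2}(co_decomp C a) mulr_suml !co_sum mulr_sumr; apply: eq_bigr => s _.
rewrite mulr_suml !co_sum mulr_sumr; apply: eq_bigr => l _.
have bE : u ^+ s.1 * v ^+ s.2 * e k = e (k - (s.1 + s.2)%:R) * (u ^+ s.1 * v ^+ s.2).
  case: s => [] [] [] /=; rewrite ?expr0 ?expr1 ?mulr1 ?mul1r ?subr0 //.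
  - by rewrite -mulrA v_vtx mulrA u_vtx -mulrA; congr (e _ * _); rewrite [(_ + _)%:R]mulrSr; ring.
  - exact: u_vtx.
  - exact: v_vtx.
have {}bE : e l * (u ^+ s.1 * v ^+ s.2) * e k =
    e l * e (k - (s.1 + s.2)%:R) * (u ^+ s.1 * v ^+ s.2) by rewrite -mulrA bE mulrA.
rewrite -scalerAl !coZ bE vtx_mul.
have -> : (l == k - (s.1 + s.2)%:R) = (l + (s.1 + s.2)%:R == k).
  by rewrite eq_sym subr_eq eq_sym.
rewrite co_basis; case: (eqVneq t s) => [->|ts]; last first.
  rewrite !mulr0; case: eqP => _; last by rewrite mulr0n mul0r co0 mulr0.
  by rewrite mulr1n co_basis (negbTE ts) mulr0.
case: (eqVneq i l) => [->|il] /=; last first.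
  rewrite !mulr0; case: eqP => _; last by rewrite mulr0n mul0r co0 mulr0.
  by rewrite mulr1n co_basis (negbTE il) andbF mulr0.
by case: eqP => _; rewrite ?mulr1n ?mulr0n ?mul0r ?co0 ?co_basis ?eqxx ?mulr1 ?mul1r ?mulr0.
Qed.

(** The basis element e_i u^s v^t ends at i + s + t, so only lengths congruent to n modulo 4
    survive. *)
Lemma co_commutes n a : commutes_vtx C n (a : reg_bimod A) ->
  forall t i, (t.1 + t.2)%:R != n%:R :> 'Z_4 -> co C t i a = 0.
Proof.
move=> ca t i tn; have := congr1 (co C t i) (ca i).
rewrite [lact _ _]/(e i * a) [ract _ _]/(a * e (i + n%:R)) co_vtx eqxx mul1r => ->.
by rewrite co_mul_vtx (inj_eq (addrI i)) (negbTE tn) mul0r.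
Qed.

Lemma co_eq0 a : (forall t i, co C t i a = 0) -> a = 0.
Proof.
move=> a0; rewrite (co_decomp C a) big1 // => t _; rewrite big1 // => i _.
by rewrite a0 scale0r.
Qed.

(** A character of A: reduction modulo the radical, read at vertex 0. One vertex suffices because by
    [cocycle_kosgen] a cocycle of degree 4k takes multiples of 1 on the generators. *)
Definition chi a : K := co C (false, false) 0 a.
Lemma chiD a b : chi (a + b) = chi a + chi b. Proof. exact: coD. Qed.
Lemma chiZ (c : K) a : chi (c *: a) = c * chi a. Proof. exact: coZ. Qed.
Lemma chi0 : chi 0 = 0. Proof. exact: co0. Qed.
Lemma chiN a : chi (- a) = - chi a. Proof. exact: coN. Qed.
Lemma chi_vtxM i a : chi (e i * a) = (0 == i)%:R * chi a.
Proof. exact: co_vtx. Qed.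
Lemma chi_mul_vtx i a : chi (a * e i) = (0 == i)%:R * chi a.
Proof. by rewrite /chi co_mul_vtx addr0. Qed.

Lemma chi1 : chi 1 = 1.
Proof.
rewrite -(sum_vtx C) /chi co_sum (bigD1 0) //= big1 ?addr0 => [|i i0].
  by have := co_basis C (false, false) 0 (false, false) 0; rewrite /= !expr0 !mulr1.
have := co_basis C (false, false) 0 (false, false) i; rewrite /= !expr0 !mulr1 => ->.
by rewrite eq_sym (negbTE i0).
Qed.

Lemma chi_uM a : chi (u * a) = 0.
Proof.
rewrite (co_decomp C a) mulr_sumr /chi co_sum big1 // => t _.
rewrite mulr_sumr co_sum big1 // => i _; rewrite -scalerAr coZ (mulrA u) u_vtx -mulrA co_vtx.
suff -> : co C (false, false) 0 (u * (u ^+ t.1 * v ^+ t.2)) = 0 by rewrite !mulr0.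
have b1 s : (false, false) != s -> co C (false, false) 0 (u ^+ s.1 * v ^+ s.2) = 0.
  move=> st; rewrite -[X in co _ _ _ X]mul1r -(sum_vtx C) mulr_suml co_sum big1 // => k _.
  by rewrite co_basis (negbTE st).
case: t => [] [] [] /=; rewrite ?expr0 ?expr1 ?mulr1 ?mul1r ?uuA ?gu_gu ?co0 //.
  by rewrite -[v]expr1 -[u]expr1 (b1 (true, true)).
by have := b1 (true, false); rewrite /= expr0 mulr1 => ->.
Qed.

Lemma chi_vM a : chi (v * a) = 0.
Proof.
rewrite (co_decomp C a) mulr_sumr /chi co_sum big1 // => t _.
rewrite mulr_sumr co_sum big1 // => i _; rewrite -scalerAr coZ (mulrA v) v_vtx -mulrA co_vtx.
suff -> : co C (false, false) 0 (v * (u ^+ t.1 * v ^+ t.2)) = 0 by rewrite !mulr0.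
have b1 s : (false, false) != s -> co C (false, false) 0 (u ^+ s.1 * v ^+ s.2) = 0.
  move=> st; rewrite -[X in co _ _ _ X]mul1r -(sum_vtx C) mulr_suml co_sum big1 // => k _.
  by rewrite co_basis (negbTE st).
case: t => [] [] [] /=; rewrite ?expr0 ?expr1 ?mulr1 ?mul1r ?vuA ?gv_gv ?gv_gu
  ?mulr0 ?coN ?co0 ?oppr0 //.
  by have := b1 (true, true); rewrite /= => ->; rewrite ?oppr0.
by have := b1 (false, true); rewrite /= expr0 mul1r => ->.
Qed.

Lemma chiM a b : chi (a * b) = chi a * chi b.
Proof.
move: a b; apply: (@cover_ind _ _ C) => [c a a' Sa Sa'|a a' Sa Sa'|i||] b.
- by rewrite mulrDl -scalerAl !(chiD, chiZ) Sa Sa' mulrDl mulrA.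
- by rewrite -mulrA !Sa Sa' mulrA.
- by rewrite chi_vtxM -[e i]mulr1 chi_vtxM chi1 mulr1.
- by rewrite chi_uM -[u]mulr1 chi_uM mul0r.
- by rewrite chi_vM -[v]mulr1 chi_vM mul0r.
Qed.

Lemma bihom_commutes n (f : Q n -> reg_bimod A) j : bihom f -> commutes_vtx C n (f (kosgen C n j)).
Proof. by move=> [_ fl fr] i; rewrite -fl -fr kosgen_vtx. Qed.

(** All terms of [koseval1] but the last have a left factor u or v, which the character kills. *)
Lemma chi_bihomE n (f : Q n -> reg_bimod A) (F : Q n) : bihom f ->
  chi (f F) = \sum_(j < n.+1) chi (f (kosgen C n j)) * chi (kval F j (u * v)).
Proof.
move=> hf; rewrite (bihom_koseval F hf) /koseval (big_morph chi chiD chi0).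
apply: eq_bigr => j _; rewrite /koseval1 /mid /= -!mulrA mul1r.
by rewrite !(chiD, chiN) !(chi_uM, chi_vM) oppr0 !add0r chiM.
Qed.

Lemma Z4_natr0 n : (n%:R == 0 :> 'Z_4) = (4 %| n)%N.
Proof. by rewrite -val_eqE /= val_Zp_nat. Qed.

Lemma chi_bihom0 n (f : Q n -> reg_bimod A) (F : Q n) :
  ~~ (4 %| n)%N -> bihom f -> chi (f F) = 0.
Proof.
move=> n4 hf; rewrite chi_bihomE // big1 // => j _.
have /(congr1 chi) := bihom_commutes j hf 0.
rewrite [lact _ _]/(e 0 * f (kosgen C n j)) [ract _ _]/(f (kosgen C n j) * e (0 + n%:R)).
rewrite chi_vtxM eqxx mul1r chi_mul_vtx add0r eq_sym Z4_natr0 (negbTE n4) mul0r => ->.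
by rewrite mul0r.
Qed.

(** The basis elements of A have length 0, 1 or 2, never 3 modulo 4. *)
Lemma bihom3_eq0 n (f : Q n -> reg_bimod A) F : (n %% 4 = 3)%N -> bihom f -> f F = 0.
Proof.
move=> n3 hf; apply: (bihom_kosgen_ext hf (bihom_cst0 _ (reg_bimod A))) => j _.
apply: co_eq0 => t i; apply: (co_commutes (bihom_commutes j hf)).
by rewrite -val_eqE /= !val_Zp_nat // n3; case: t => [] [] [].
Qed.

(** As 4 divides n, the value on g_j is a sum of c_i e_i, and d g_j is a sum of commutators with u
    and v. The coefficient of e_i v in f (d g_j) = 0 is c_(i+1) - c_i, so going around the cycle all
    c_i agree. *)
Lemma cocycle_kosgen n (f : Q n -> reg_bimod A) j : (4 %| n)%N -> bihom f ->
  (forall F : Q n.+1, f (kosd F) = 0) -> f (kosgen C n j) = (chi (f (kosgen C n j)))%:A.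
Proof.
move=> n4 hf df; have n0 : n%:R = 0 :> 'Z_4 by apply/eqP; rewrite Z4_natr0.
have aE l : f (kosgen C n l) = \sum_i co C (false, false) i (f (kosgen C n l)) *: e i.
  rewrite [LHS](co_decomp C) (bigD1 (false, false)) //= [X in _ + X]big1 ?addr0 => [|t tn].
    by apply: eq_bigr => i _; rewrite !expr0 !mulr1.
  rewrite big1 // => i _; rewrite (co_commutes (bihom_commutes l hf)) ?scale0r //.
  by rewrite n0 Z4_natr0; case: t tn => [] [] [].
have [_ fl fr] := hf.
have sE : (-1) ^+ n.+1 = -1 :> K.
  by rewrite -signr_odd oddS -[odd n]negbK -dvdn2 (dvdn_trans _ n4).
(* Reading the coordinate of v discards the terms of d g_j with u, which involve g_(j-1). *)
have eu i k : co C (false, true) i (e k * u) = 0.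
  by have := co_basis C (false, true) i (true, false) k; rewrite /= expr0 mulr1.
have ev i k : co C (false, true) i (e k * v) = (i == k)%:R.
  by have := co_basis C (false, true) i (false, true) k; rewrite /= expr0 mul1r.
have fu l i : co C (false, true) i (u * f (kosgen C n l)) = 0.
  rewrite [f _]aE mulr_sumr co_sum big1 // => k _.
  by rewrite -scalerAr coZ u_vtx eu mulr0.
have uf l i : co C (false, true) i (f (kosgen C n l) * u) = 0.
  rewrite [f _]aE mulr_suml co_sum big1 // => k _.
  by rewrite -scalerAl coZ eu mulr0.
have ca i : co C (false, false) i (f (kosgen C n j)) = co C (false, false) (i + 1) (f (kosgen C n j)).
  have fv : co C (false, true) i (v * f (kosgen C n j)) = co C (false, false) (i + 1) (f (kosgen C n j)).
    rewrite [in LHS]aE mulr_sumr co_sum (bigD1 (i + 1)) //= big1 ?addr0 => [|k ki].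
      by rewrite -scalerAr coZ v_vtx ev addrK eqxx mulr1.
    by rewrite -scalerAr coZ v_vtx ev eq_sym subr_eq (negbTE ki) mulr0.
  have vf : co C (false, true) i (f (kosgen C n j) * v) = co C (false, false) i (f (kosgen C n j)).
    rewrite [in LHS]aE mulr_suml co_sum (bigD1 i) //= big1 ?addr0 => [|k ki].
      by rewrite -scalerAl coZ ev eqxx mulr1.
    by rewrite -scalerAl coZ ev eq_sym (negbTE ki) mulr0.
  have := congr1 (co C (false, true) i) (df (kosgen C n.+1 j)).
  rewrite kosd_kosgen sE scaleN1r (bihomB _ _ hf) !(bihomD _ _ hf) co0 coD coN !coD.
  rewrite fl fr /= fv vf.
  case: (j) => [|l]; rewrite ?fl ?fr ?(bihom0 hf) ?co0.
    by rewrite !add0r => /eqP; rewrite subr_eq0 => /eqP ->.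
  have -> : co C (false, true) i (lact u (f (kosgen C n l)) : A) = 0 := fu l i.
  have -> : co C (false, true) i (ract (f (kosgen C n l)) u : A) = 0 := uf l i.
  by rewrite !add0r => /eqP; rewrite subr_eq0 => /eqP ->.
have c0 i : co C (false, false) i (f (kosgen C n j)) = chi (f (kosgen C n j)).
  have cn m : co C (false, false) m%:R (f (kosgen C n j)) = chi (f (kosgen C n j)).
    by elim: m => [|m IHm]; rewrite ?mulr0n // mulrSr -ca.
  by rewrite -(cn i) natr_Zp.
rewrite [LHS]aE -(sum_vtx C) scaler_sumr; apply: eq_bigr => i _.
by rewrite c0.
Qed.
End Residue.

(** * Comparison of resolutions *)

Section Comparison.
Variables (K : fieldType) (A : algType K) (M : bimodule A).

Record chain_map (P R : proj_resolution M) := ChainMap {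
  cm :> forall n, P n -> R n;
  cm_bihom : forall n, bihom (@cm n);
  cm_aug : forall x, aug (cm x) = aug x;
  cm_diff : forall n (x : P n.+1), diff (cm x) = cm (diff x)
}.

Lemma chain_map_ex (P R : proj_resolution M) : inhabited (chain_map P R).
Proof.
pose T n := {f : P n -> R n | bihom f /\ forall x : P n.+1, cyc (f (diff x))}.
have ex0 : exists f : T 0, forall x, aug (sval f x) = aug x.
  have [f [hf fE _]] := aug_lift_ex R (@res_projective _ _ _ P 0) (aug_bihom P).
  have cf x : cyc (f (diff x)) by rewrite /= fE; exact: augD.
  by exists (exist _ f (conj hf cf)).
have ex n (f : T n) : exists g : T n.+1, forall x, diff (sval g x) = sval f (diff x).
  case: f => f [hf cf].
  have [g [hg gE _]] := lift_ex (@res_projective _ _ _ P n.+1)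
    (bihom_comp (@diff_bihom _ _ _ P n) hf) cf.
  have cg x : cyc (g (diff x)) by rewrite /= gE diffD bihom0.
  by exists (exist _ g (conj hg cg)).
pose F := fix F n : T n :=
  if n is m.+1 then sval (cid (ex m (F m))) else sval (cid ex0).
exists; apply: (@ChainMap P R (fun n => sval (F n))) => [n|x|n x].
- by case: (svalP (F n)).
- by rewrite /=; case: cid.
- by rewrite /=; case: cid.
Qed.

(** Placed on the diagonal n = k, the endomorphism is a chain lift of the unit cochain, as is the
    identity. The independence of the Yoneda product from the lift then takes the place of an
    explicit homotopy. *)
Lemma chain_endo_coboundary (P : proj_resolution M) (f : chain_map P P) (c : cochain P) :
  cocycle_fam c -> coboundary ((fun p => cpt c (f _ (projT2 p))) - c : cochain P).
Proof.
move=> cc; have [hc _] := cc.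
pose g n k (x : P n) := idl k (f n x).
have lg : chain_lift (@unit_cochain _ _ _ P) g.
  have [hi li ai di] := idl_lift P; split=> [n k|n k lt x|n x|n k x].
  - exact: bihom_comp (cm_bihom f n) (hi n k).
  - exact: li.
  - by rewrite /g ai; case: n x => //= x; exact: cm_aug.
  - by rewrite /g di cm_diff.
have := ycomp_uniq cc lg (idl_lift P).
rewrite ycomp_idl // subrr => /(_ (@coboundary0 _ _ _ P)); congr (coboundary (_ - _)).
apply/funext => -[n x]; rewrite -![_ (existT _ n x)]/(cpt _ x) cpt_ycomp.
rewrite big_nat_recr //= big1_seq ?add0r /g ?idl_id // => k /andP[_].
by rewrite mem_index_iota => /andP[_ ltk]; rewrite idl_neq ?gtn_eqF // (bihom0 (hc k)).
Qed.

Section Pullback.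
Variables (P R : proj_resolution M) (f : chain_map P R).

Definition pullback (c : cochain R) : cochain P := fun p => cpt c (f _ (projT2 p)).

Lemma cpt_pullback c n (x : P n) : cpt (pullback c) x = cpt c (f n x).
Proof. by []. Qed.

Lemma pullback_fam c : cocycle_fam c -> cocycle_fam (pullback c).
Proof.
move=> [hc dc]; split=> [n|n x]; first exact: bihom_comp (cm_bihom f n) (hc n).
by rewrite cpt_pullback -cm_diff dc.
Qed.

Lemma pullback_coboundary c : coboundary c -> coboundary (pullback c).
Proof.
move=> [c0 cS]; split=> [x|n]; first by rewrite cpt_pullback.
have [b hb bE] := cS n; exists (fun x => b (f n x)).
  exact: bihom_comp (cm_bihom f n) hb.
by move=> x; rewrite cpt_pullback bE cm_diff.
Qed.
End Pullback.

Lemma pullback2_coboundary (P R : proj_resolution M) (f : chain_map P R) (g : chain_map R P)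
  (c : cochain R) : cocycle_fam c -> coboundary (pullback g (pullback f c) - c).
Proof.
move=> cc.
have hb n : bihom (fun x => f n (g n x)) by exact: bihom_comp (cm_bihom g n) (cm_bihom f n).
have ha x : aug (f 0 (g 0 x)) = aug x by rewrite !cm_aug.
have hd n (x : R n.+1) : diff (f n.+1 (g n.+1 x)) = f n (g n (diff x)) by rewrite !cm_diff.
exact: (@chain_endo_coboundary R (@ChainMap R R (fun n x => f n (g n x)) hb ha hd) c cc).
Qed.
End Comparison.

Lemma big_nat_mul4 (V : zmodType) (F : nat -> V) n :
  (forall k, ~~ (4 %| k)%N -> F k = 0) ->
  \sum_(0 <= k < (4 * n).+1) F k = \sum_(0 <= k < n.+1) F (4 * k)%N.
Proof.
move=> F0; elim: n => [|n IHn]; first by rewrite !big_nat1.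
rewrite [RHS]big_nat_recr //= -IHn mulnS addnC !addnS addn0 !big_nat_recr //=.
have F4 r : (0 < r < 4)%N -> F (4 * n + r)%N = 0.
  by move=> /andP[r0 r4]; apply: F0; rewrite dvdn_addr ?dvdn_mulr // gtnNdvd.
by have := (F4 1%N isT, F4 2%N isT, F4 3%N isT); rewrite !addnS !addn0 => -[[-> ->] ->];
  rewrite !addr0.
Qed.

Lemma big_ord_leq (V : zmodType) (F : nat -> V) d j :
  (forall b, (d <= b)%N -> F b = 0) ->
  \sum_(b < d) (if (b <= j)%N then F b else 0) = \sum_(b < j.+1) F b.
Proof.
move=> F0; rewrite -(big_mkord xpredT (fun b => if (b <= j)%N then F b else 0)).
rewrite -(big_mkord xpredT F); have [ledj|ltjd] := leqP d j.+1.
  rewrite [RHS](@big_cat_nat _ _ _ d) //= [X in _ + X]big1_seq ?addr0 => [|b /andP[_]].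
    by apply: eq_big_nat => b /andP[_ ltb]; rewrite -ltnS (leq_trans ltb).
  by rewrite mem_index_iota => /andP[/F0].
rewrite [LHS](@big_cat_nat _ _ _ j.+1) ?(ltnW ltjd) //=
  [X in _ + X]big1_seq ?addr0 => [|b /andP[_]].
  by apply: eq_big_nat => b /andP[_]; rewrite ltnS => ->.
by rewrite mem_index_iota => /andP[ltb _]; rewrite leqNgt ltb.
Qed.

(** * Products of cocycles *)

Section ShiftLift.
Variables (K : fieldType) (A : algType K) (C : ext_cover A).
Local Notation e := (vtx C).
Local Notation u := (gu C).
Local Notation v := (gv C).
Local Notation Q := (kos C).
Local Notation R := (kos_resolution C).
Implicit Types n k m j b d : nat.

(** The generator g_(j-b); the test is essential, since truncated subtraction would give g_0 for b >
    j. *)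
Definition shifted_gen n j b : Q n := if (b <= j)%N then kosgen C n (j - b) else 0.

Lemma shifted_gen_vtx n j b : commutes_vtx C n (shifted_gen n j b).
Proof.
by rewrite /shifted_gen; case: leqP => _ i; [exact: kosgen_vtx|rewrite lact0 ract0].
Qed.

Lemma kosd_shifted_gen n j b : kosd (shifted_gen n.+1 j b) =
  (if j is i.+1 then lact u (shifted_gen n i b) else 0) + lact v (shifted_gen n j b) +
  (-1) ^+ n.+1 *: ((if j is i.+1 then ract (shifted_gen n i b) u else 0) + ract (shifted_gen n j b) v).
Proof.
rewrite /shifted_gen; have [lebj|ltjb] := leqP b j.
  rewrite kosd_kosgen; case: j lebj => [|j]; first by rewrite leqn0 => /eqP ->.
  rewrite leq_eqVlt => /orP[/eqP ->|]; first by rewrite subnn ltnn lact0 ract0.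
  by rewrite ltnS => lebj; rewrite lebj subSn.
rewrite (bihom0 (@kosd_bihom _ _ C n)) lact0 ract0.
case: j ltjb => [|j] ltjb; first by rewrite !(addr0, scaler0).
have -> : (b <= j)%N = false by rewrite leqNgt ltnW.
by rewrite lact0 ract0 !(addr0, scaler0).
Qed.

Variable c : nat -> nat -> K.

(** The image of g_j under the dual of multiplication by the form with coefficients [c d b] at s^b
    t^(d-b). *)
Definition shift_value k d j : Q k := \sum_(b < d.+1) c d b *: shifted_gen k j b.

Lemma lactZ (M : bimodule A) a (r : K) (x : M) : lact a (r *: x) = r *: lact a x.
Proof. by rewrite -[r *: x]addr0 lact_linear lact0 addr0. Qed.
Lemma ractZ (M : bimodule A) a (r : K) (x : M) : ract (r *: x) a = r *: ract x a.
Proof. by rewrite -[r *: x]addr0 ract_linear ract0 addr0. Qed.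

Lemma lact_shift_value k d j a : lact a (shift_value k d j) = \sum_(b < d.+1) c d b *: lact a (shifted_gen k j b).
Proof.
rewrite /shift_value (big_morph _ (@lactD _ _ _ a) (@lact0 _ _ _ a)).
by apply: eq_bigr => b _; rewrite lactZ.
Qed.
Lemma ract_shift_value k d j a : ract (shift_value k d j) a = \sum_(b < d.+1) c d b *: ract (shifted_gen k j b) a.
Proof.
rewrite /shift_value (big_morph (fun y => ract y a) (ractD a) (@ract0 _ _ _ a)).
by apply: eq_bigr => b _; rewrite ractZ.
Qed.

Lemma shift_value_vtx k d j : commutes_vtx C k (shift_value k d j).
Proof.
by move=> i; rewrite lact_shift_value ract_shift_value; apply: eq_bigr => b _; rewrite shifted_gen_vtx.
Qed.

(** The differential of the top generator mentions the index one beyond the range; the shift has to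
    agree there with the convention that this generator is 0. *)
Lemma shift_value_high n d : shift_value n d (n + d).+1 = 0.
Proof.
rewrite /shift_value big1 // => b _; have lebd : (b <= d)%N by rewrite -ltnS.
rewrite /shifted_gen kosgen_high; first by rewrite if_same scaler0.
by rewrite ltn_subRL ltnS addnC leq_add2l.
Qed.

(** The formula for d g_j has the same shape for all j, so it is preserved by translations of j and
    by their linear combinations. *)
Lemma kosd_shift_value n d j : kosd (shift_value n.+1 d j) =
  (if j is i.+1 then lact u (shift_value n d i) else 0) + lact v (shift_value n d j) +
  (-1) ^+ n.+1 *: ((if j is i.+1 then ract (shift_value n d i) u else 0) + ract (shift_value n d j) v).
Proof.
have [ld _ _] := @kosd_bihom _ _ C n.
have dZ r x : kosd (r *: x : Q n.+1) = r *: kosd x.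
  by rewrite -[r *: x]addr0 ld (bihom0 (@kosd_bihom _ _ C n)) addr0.
rewrite {1}/shift_value (bihom_sum _ _ _ (@kosd_bihom _ _ C n)).
have scA (r s : K) (x : Q n) : r *: (s *: x) = s *: (r *: x) by rewrite !scalerA mulrC.
case: j => [|j]; rewrite !lact_shift_value !ract_shift_value ?add0r -?big_split scaler_sumr -big_split;
  apply: eq_bigr => b _; rewrite dZ kosd_shifted_gen ?add0r !scalerDr.
  by rewrite scA.
by rewrite !(scA (c d b)).
Qed.

Lemma kosaug_shifted_gen j b : kosaug (shifted_gen 0 j b) = (j == b)%:R :> A.
Proof.
rewrite /shifted_gen; case: (ltngtP b j) => [ltbj|ltjb|->].
- by rewrite kosgen_high ?subn_gt0 // (bihom0 (kosaug_bihom C)).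
- by rewrite (bihom0 (kosaug_bihom C)).
- by rewrite subnn kosaug_kosgen.
Qed.

Lemma kosaug_shift_value d j : kosaug (shift_value 0 d j) = (if (j <= d)%N then c d j else 0)%:A :> A.
Proof.
rewrite /shift_value (bihom_sum _ _ _ (kosaug_bihom C)); have [la _ _] := kosaug_bihom C.
have aZ (r : K) (x : Q 0) : kosaug (r *: x) = r *: (kosaug x : A).
  by rewrite -[r *: x]addr0 la (bihom0 (kosaug_bihom C)) addr0.
under eq_bigr => b _ do rewrite aZ kosaug_shifted_gen.
have [lejd|ltdj] := leqP j d; last first.
  rewrite scale0r big1 // => b _.
  by rewrite gtn_eqF ?scaler0 // (leq_trans (ltn_ord b)).
rewrite (bigD1 (Ordinal (lejd : (j < d.+1)%N))) //= eqxx big1 ?addr0 // => b bj.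
rewrite (_ : (j == b :> nat) = false) ?scaler0 //.
by apply: contraNF bj => /eqP jb; apply/eqP/val_inj.
Qed.

(* Lifts a cocycle with values c d j on the generators of degree d, 4 | d. *)
Definition cup_map n k (F : Q n) : Q k :=
  if (k <= n)%N && (4 %| n - k)%N then koseval (shift_value k (n - k)) F else 0.

Lemma commutes_vtx4 (M : bimodule A) n k (x : M) : (k <= n)%N -> (4 %| n - k)%N ->
  commutes_vtx C k x -> commutes_vtx C n x.
Proof.
move=> lekn; rewrite -Z4_natr0 natrB // subr_eq0 => /eqP nk cx i.
by rewrite nk.
Qed.

Lemma cup_map_bihom n k : bihom (@cup_map n k).
Proof.
rewrite /cup_map; case: (boolP ((k <= n)%N && (4 %| n - k)%N)) => [/andP[lekn nk4]|_];
  last exact: bihom_cst0.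
by apply: koseval_bihom => j _; apply: commutes_vtx4 lekn nk4 _; exact: shift_value_vtx.
Qed.

Lemma cup_map_kosgen n k j : (k <= n)%N -> (4 %| n - k)%N -> (j <= n.+1)%N ->
  cup_map k (kosgen C n j) = shift_value k (n - k) j.
Proof.
move=> lekn nk4; rewrite leq_eqVlt => /orP[/eqP ->|lejn].
  by rewrite kosgen_high // (bihom0 (cup_map_bihom n k)) -{2}(subnKC lekn) shift_value_high.
by rewrite /cup_map lekn nk4 koseval_kosgen.
Qed.

Lemma kosd_cup_map n k (F : Q n.+1) : kosd (cup_map k.+1 F) = cup_map k (kosd F).
Proof.
have hd m := @kosd_bihom _ _ C m.
move: F; apply: bihom_kosgen_ext => [||j lej].
- exact: bihom_comp (cup_map_bihom n.+1 k.+1) (hd k).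
- exact: bihom_comp (hd n) (cup_map_bihom n k).
have [/andP[lekn nk4]|nk] := boolP ((k <= n)%N && (4 %| n - k)%N); last first.
  by rewrite /cup_map ltnS subSS (negbTE nk) (bihom0 (hd k)).
have lej1 := leqW lej.
rewrite cup_map_kosgen ?subSS // kosd_shift_value kosd_kosgen.
have hG := cup_map_bihom n k; have [lG Gl Gr] := hG.
(* The shift lowers the degree by a multiple of 4, so the two differentials carry the same sign. *)
have sE : (-1) ^+ k.+1 = (-1) ^+ n.+1 :> K.
  rewrite -(subnKC lekn) -addSn exprD -[X in _ = _ * X]signr_odd.
  by rewrite -[odd _]negbK -dvdn2 (dvdn_trans _ nk4) ?mulr1.
have GZ (r : K) (x : Q n) : cup_map k (r *: x) = r *: cup_map k x.
  by rewrite -[r *: x]addr0 lG (bihom0 hG) addr0.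
rewrite !(bihomD _ _ hG) GZ !(bihomD _ _ hG) !Gl !Gr cup_map_kosgen // sE.
case: j lej {lej1} => [|j] lej; first by rewrite (bihom0 hG).
by rewrite !Gl !Gr cup_map_kosgen // ltnW.
Qed.
End ShiftLift.

Section ResidueProduct.
Variables (K : fieldType) (A : algType K) (C : ext_cover A).
Local Notation u := (gu C).
Local Notation v := (gv C).
Local Notation Q := (kos C).
Local Notation R := (kos_resolution C).
Implicit Types (n k m j b d : nat) (x y : cochain R).

Definition residue_at x d j : K := chi C (cpt x (kosgen C d j : R d)).
Definition residue x n j : K := residue_at x (4 * n) j.

Lemma residue_at_high x d j : cocycle_fam x -> (d < j)%N -> residue_at x d j = 0.
Proof. by move=> [hx _] ltj; rewrite /residue_at kosgen_high // (bihom0 (hx d)) chi0. Qed.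

(** In degree 4n > 0 a coboundary factors through degree 4n - 1, where [chi] vanishes on every
    bimodule map; in degree 0 it is zero. *)
Lemma chi_coboundary x n (F : R (4 * n)%N) : coboundary x -> chi C (cpt x F) = 0.
Proof.
move=> [x0 xS]; case: n F => [|n] F; first by rewrite x0 chi0.
have [b hb bE] := xS (4 * n + 3)%N.
have e4 : (4 * n.+1)%N = (4 * n + 3).+1 by rewrite mulnS addnC !addnS.
move: F; rewrite e4 => F; rewrite bE; apply: chi_bihom0 hb.
by rewrite dvdn_addr ?dvdn_mulr.
Qed.

Lemma residue_coboundary x y n j : coboundary (x - y) -> residue x n j = residue y n j.
Proof.
move=> /(@chi_coboundary _ n (kosgen C (4 * n) j)) /eqP.
by rewrite [cpt _ _](_ : _ = cpt x (kosgen C (4 * n) j : R _) - cpt y (kosgen C (4 * n) j : R _)) //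
  chiD chiN subr_eq0 => /eqP.
Qed.

Definition part4 x : cochain R := fun p => if (4 %| projT1 p)%N then cpt x (projT2 p) else 0.
Lemma cpt_part4 x n (F : R n) : cpt (part4 x) F = if (4 %| n)%N then cpt x F else 0.
Proof. by []. Qed.

Lemma part4_fam x : cocycle_fam x -> cocycle_fam (part4 x).
Proof.
move=> [hx dx]; split=> n; last by move=> F; rewrite cpt_part4; case: ifP.
rewrite [cpt _ (n:=n)](_ : _ = fun F : R n => if (4 %| n)%N then cpt x F else 0) //.
by case: (4 %| n)%N; [exact: hx|exact: bihom_cst0].
Qed.

(** Compatibility with the augmentation is [cocycle_kosgen]: in degrees divisible by 4 the residues
    determine the cocycle. *)
Lemma cup_map_lift x : cocycle_fam x ->
  chain_lift (part4 x) (cup_map (C := C) (residue_at x)).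
Proof.
move=> cx; have [hx dx] := cx; split=> [n k|n k lt F|n F|n k F].
- exact: cup_map_bihom.
- by rewrite /cup_map leqNgt lt.
- move: F; apply: (@bihom_kosgen_ext _ _ C n (reg_bimod A) (fun F => kosaug (cup_map (residue_at x) 0 F))
    (cpt (part4 x) (n:=n))) => [||j lej].
  + exact: bihom_comp (@cup_map_bihom _ _ C (residue_at x) n 0) (kosaug_bihom C).
  + by have [+ _] := part4_fam cx; apply.
  rewrite cpt_part4; case: (boolP (4 %| n)%N) => n4; last first.
    by rewrite /cup_map subn0 (negbTE n4) andbF (bihom0 (kosaug_bihom C)).
  rewrite cup_map_kosgen ?subn0 ?leqW // [LHS]kosaug_shift_value lej /residue_at.
  exact: esym (cocycle_kosgen j n4 (hx n) (dx n)).
- exact: kosd_cup_map.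
Qed.

(* The residue depends on the class only, so y may be lifted by the explicit map
   on its components in degrees 4k plus any lift of the others; the latter vanishes
   from degree 4n to degree 4k. *)
Lemma residue_ycomp x y f n j : cocycle_fam x -> cocycle_fam y -> chain_lift y f ->
  residue (ycomp x f) n j =
  \sum_(k < n.+1) \sum_(i < j.+1) residue x k i * residue y (n - k) (j - i).
Proof.
move=> cx cy lf; have [hx _] := cx.
have c4 := part4_fam cy; have cw := cocycle_famP (-1) c4 cy.
have [g [lg g0]] := yoneda_lift_ex cw.
have lG := chain_liftP 1 (cup_map_lift cy) lg.
have yE : 1 *: part4 y + (-1 *: part4 y + y) = y by rewrite scale1r scaleN1r addNKr.
rewrite yE in lG.
have := ycomp_uniq cx lf lG; rewrite subrr => /(_ (@coboundary0 _ _ _ R)).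
move/residue_coboundary ->; rewrite [LHS]/residue [LHS]/residue_at cpt_ycomp.
(* In a degree k that 4 does not divide, [chi] kills the values of x. *)
rewrite (big_morph _ (chiD C) (chi0 C)) big_nat_mul4 => [|k k4];
  last exact: (chi_bihom0 _ k4 (hx k)).
rewrite big_mkord; apply: eq_bigr => -[k /=]; rewrite ltnS => lekn _.
have lek4 : (4 * k <= 4 * n)%N by rewrite leq_mul2l lekn orbT.
have nk4 : (4 %| 4 * n - 4 * k)%N by rewrite -mulnBr dvdn_mulr.
rewrite (g0 (4 * n)%N (4 * k)%N lek4) ?addr0 => [|F]; last first.
  by rewrite cptP cpt_part4 nk4 scaleN1r addNr.
(* [cup_map_kosgen] covers j up to 4n + 1. Beyond that the generator is 0, and so is each summand on
   the right, as i > 4k or j - i > 4(n - k). *)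
rewrite scale1r; have [lejn|ltnj] := leqP j (4 * n).+1; last first.
  rewrite kosgen_high ?(ltnW ltnj) // (bihom0 (@cup_map_bihom _ _ C _ _ _)) (bihom0 (hx _)) chi0.
  rewrite big1 // => i _; have [lei|lti] := leqP i (4 * k).
    rewrite [X in _ * X](residue_at_high cy) ?mulr0 //.
    rewrite mulnBr ltn_subRL (leq_ltn_trans _ (ltnW ltnj)) // -[X in (_ <= X)%N](subnKC lek4).
    by rewrite leq_add2r.
  by rewrite [X in X * _](residue_at_high cx) ?mul0r.
rewrite cup_map_kosgen // /shift_value -mulnBr (bihom_sum _ _ _ (hx _)).
rewrite (big_morph _ (chiD C) (chi0 C)).
have xZ (r : K) (F : R (4 * k)%N) : cpt x (r *: F) = r *: (cpt x F : A).
  by have [lx _ _] := hx (4 * k)%N; rewrite -[r *: F]addr0 lx (bihom0 (hx _)) addr0.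
transitivity (\sum_(b < (4 * (n - k)).+1) if (b <= j)%N then
    residue_at y (4 * (n - k)) b * residue_at x (4 * k) (j - b) else 0).
  apply: eq_bigr => b _; rewrite xZ chiZ /shifted_gen; case: leqP => // _.
  by rewrite (bihom0 (hx _)) chi0 mulr0.
rewrite (@big_ord_leq _ (fun b => residue_at y (4 * (n - k)) b * residue_at x (4 * k) (j - b))).
  rewrite (reindex_inj rev_ord_inj) /=; apply: eq_bigr => i _.
  by rewrite subSS mulrC subKn // -ltnS.
by move=> b ltb; rewrite residue_at_high // mul0r.
Qed.
End ResidueProduct.

(** * The symbol of a Hochschild class *)

Section Symbol.
Variables (K : fieldType) (A : algType K) (C : ext_cover A).
Variable P : proj_resolution (reg_bimod A).
Local Notation R := (kos_resolution C).
Variables (phi : chain_map R P) (psi : chain_map P R).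
Implicit Types (c d : cocycles P) (z : HH P) (n j t : nat) (q : {poly {poly K}}).

Definition res_cocycle c n j : K := residue (pullback phi (val c)) n j.

Lemma res_cocycle_eq c d n j : cls c = cls d -> res_cocycle c n j = res_cocycle d n j.
Proof.
move=> /cls_eqP cd; apply: residue_coboundary.
exact: (pullback_coboundary phi cd).
Qed.

Lemma res_cocycle_high c n j : (4 * n < j)%N -> res_cocycle c n j = 0.
Proof. exact/residue_at_high/pullback_fam/cocycles_fam. Qed.

Lemma res_cocycleP (a : K) c d n j :
  res_cocycle (a *: c + d) n j = a * res_cocycle c n j + res_cocycle d n j.
Proof. by rewrite /res_cocycle /residue /residue_at -chiZ -chiD. Qed.

Lemma res_cocycle_bound c : exists N, forall n j, (N <= n)%N -> res_cocycle c n j = 0.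
Proof.
have [_ [N cN]] := submod_valP c; exists N => n j leNn.
rewrite /res_cocycle /residue /residue_at cpt_pullback cN ?chi0 //.
by rewrite (leq_trans leNn) // leq_pmull.
Qed.

(** A lift [G] of the pulled back d on the Koszul side, conjugated by the comparison maps, lifts a
    cocycle cohomologous to d. The product formed with it is cohomologous to [yprod c d] and pulls
    back to the product on the Koszul side. *)
Lemma res_yprod c d n j : res_cocycle (yprod c d) n j =
  \sum_(k < n.+1) \sum_(i < j.+1) res_cocycle c k i * res_cocycle d (n - k) (j - i).
Proof.
have [cc cd] := (cocycles_fam c, cocycles_fam d).
have pc := pullback_fam phi cc; have pd := pullback_fam phi cd.
have [G [lG _]] := yoneda_lift_ex pd.
rewrite -(residue_ycomp _ _ pc pd lG).
pose g n k (x : P n) : P k := phi k (G n k (psi n x)).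
have lg : chain_lift (pullback psi (pullback phi (val d))) g.
  have [hG Gl Ga Gd] := lG; split=> [m k|m k lt x|m x|m k x].
  - exact: bihom_comp (cm_bihom psi m) (bihom_comp (hG m k) (cm_bihom phi k)).
  - by rewrite /g Gl // (bihom0 (cm_bihom phi k)).
  - by rewrite /g cm_aug Ga.
  - by rewrite /g cm_diff Gd cm_diff.
have dd := pullback2_coboundary phi psi cd.
have := ycomp_uniq cc lg (some_lift_lift d) dd.
move/(pullback_coboundary phi) => Ecb.
have -> : res_cocycle (yprod c d) n j = residue (pullback phi (ycomp (val c) g)) n j.
  by apply/esym/residue_coboundary; exact: Ecb.
have cw : cocycle_fam (ycomp (pullback phi (val c)) G) := ycomp_cocycle pc lG.
apply: residue_coboundary.
exact: (pullback2_coboundary psi phi cw).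
Qed.

Lemma res_unit n j :
  res_cocycle (@to_submod _ _ (cocycle_submod P) _ (unit_cocycle P)) n j =
  ((n == 0) && (j == 0))%:R.
Proof.
rewrite /res_cocycle /residue /residue_at cpt_pullback /=.
case: n => [|n]; last by rewrite chi0.
rewrite [cpt _ _](_ : _ = aug (phi 0 (kosgen C 0 j : R 0))) // cm_aug.
case: j => [|j]; first by rewrite [aug _]kosaug_kosgen chi1.
by rewrite kosgen_high // (bihom0 (aug_bihom R)) chi0.
Qed.

(* K[s, t] is dehomogenized: the coefficient of 'X^n is the polynomial in s/t
   of a class in degree 4n. *)
Definition symbol z : {poly {poly K}} :=
  \poly_(n < sval (cid (res_cocycle_bound (lift_rep z))))
    \poly_(j < (4 * n).+1) res_cocycle (lift_rep z) n j.

Lemma symbolE c n j : (symbol (cls c))`_n`_j = res_cocycle c n j.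
Proof.
rewrite (@res_cocycle_eq c (lift_rep (cls c))) ?lift_rep_cls //.
rewrite /symbol coef_poly; case: cid => N /= NP.
case: leqP => [/NP->|_]; first by rewrite coef0.
by rewrite coef_poly; case: leqP => // /res_cocycle_high ->.
Qed.

Lemma symbolP (a : K) z z' : symbol (a *: z + z') = a%:P%:P * symbol z + symbol z'.
Proof.
have [[c ->] [d ->]] := (cls_surj z, cls_surj z').
apply/polyP => n; apply/polyP => j; rewrite -linearP coefD coefCM coefD coefCM.
by rewrite !symbolE res_cocycleP.
Qed.

Lemma symbolM z z' : symbol (z * z') = symbol z * symbol z'.
Proof.
have [[c ->] [d ->]] := (cls_surj z, cls_surj z').
have -> : (cls c : HH P) * cls d = cls (yprod c d) := ext_mulE c d.
apply/polyP => n; apply/polyP => j; rewrite symbolE res_yprod coefM coef_sum.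
apply: eq_bigr => k _; rewrite coefM; apply: eq_bigr => i _.
by rewrite !symbolE.
Qed.

Lemma symbol1 : symbol 1 = 1.
Proof.
apply/polyP => n; apply/polyP => j; rewrite [LHS]symbolE res_unit coef1.
by case: n => [|n]; rewrite ?coef1 ?coef0.
Qed.

Lemma symbol0 : symbol 0 = 0.
Proof.
have := symbolP (-1) 0 0; rewrite scaler0 addr0 => ->.
by rewrite !(polyCN, polyC1) mulN1r addNr.
Qed.
Lemma symbolD z z' : symbol (z + z') = symbol z + symbol z'.
Proof. by have := symbolP 1 z z'; rewrite scale1r mul1r. Qed.
Lemma symbolX z n : symbol (z ^+ n) = symbol z ^+ n.
Proof. by elim: n => [|n IHn]; rewrite ?expr0 ?symbol1 // !exprS symbolM IHn. Qed.

Lemma size_symbol z n : (size (nth 0%R (symbol z) n) <= (4 * n).+1)%N.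
Proof.
have [c ->] := cls_surj z; apply/leq_sizeP => j ltj.
by rewrite symbolE res_cocycle_high.
Qed.

Lemma cls_eq0 c : (forall n (F : R n), cpt (pullback phi (val c)) F = 0) -> cls c = 0.
Proof.
move=> c0; have cc := cocycles_fam c.
have p0 : pullback psi (pullback phi (val c)) = 0.
  by apply/funext => -[n x]; exact: c0.
have := pullback2_coboundary phi psi cc; rewrite p0 sub0r => Nc.
have c0' : val (0 : cocycles P) = 0 by [].
rewrite -[RHS](raddf0 (@cls _ _ _ P)); apply/esym/cls_eqP.
by rewrite c0' sub0r.
Qed.

Definition supported (D : pred nat) c : Prop :=
  forall n, ~~ D n -> forall x : P n, cpt (val c) x = 0.

(** No coboundary has to be found on the Koszul side: zero residues make the pulled back cocycle
    itself zero. *)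
Lemma symbol_inj4 z : z \in @HH4_pred _ _ P -> symbol z = 0 -> z = 0.
Proof.
move=> /asboolP[c -> c4] z0; apply: cls_eq0 => n.
have := pullback_fam phi (cocycles_fam c); set x := pullback _ _ => -[hx dx].
have [n4|n4] := boolP (4 %| n)%N; last by move=> F; rewrite /x cpt_pullback c4.
apply: (bihom_kosgen_ext (hx n) (bihom_cst0 _ (reg_bimod A))) => j _.
have rE : residue_at x n j = 0.
  have := symbolE c (n %/ 4) j; rewrite z0 !coef0 /res_cocycle /residue.
  by rewrite mulnC divnK.
by rewrite (cocycle_kosgen j n4 (hx n) (dx n)) -[chi _ _]/(residue_at x n j) rE scale0r.
Qed.

Lemma symbol_deg t z n : HH_deg t z -> t != (4 * n)%N -> (symbol z)`_n = 0.
Proof.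
move=> [c -> ct] tn; apply/polyP => j; rewrite symbolE coef0.
by rewrite /res_cocycle /residue /residue_at cpt_pullback ct ?chi0 // inE eq_sym.
Qed.

Lemma HH_deg3 t z : (t %% 4 = 3)%N -> HH_deg t z -> z = 0.
Proof.
move=> t3 [c -> ct]; apply: cls_eq0 => n F.
have [hx _] := pullback_fam phi (cocycles_fam c).
have [nt|nt] := eqVneq n t; last by rewrite cpt_pullback ct.
by apply: bihom3_eq0 (hx n); rewrite nt.
Qed.

Lemma HH_degM s t z z' : HH_deg s z -> HH_deg t z' -> HH_deg (s + t) (z * z').
Proof.
move=> [c -> cs] [d -> dt]; exists (yprod c d); first exact: ext_mulE.
move=> n nst x; apply: ycomp_supp cs dt _ _ _ => k lekn.
by apply: contra nst => /andP[/eqP ks /eqP nt]; rewrite inE -ks -nt subnKC.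
Qed.

Lemma HH_deg_pred4 t z : (4 %| t)%N -> HH_deg t z -> z \in @HH4_pred _ _ P.
Proof.
move=> t4 [c -> ct]; apply/asboolP; exists c => // n n4 x; apply: ct.
by apply: contra n4 => /eqP ->.
Qed.

(** If t is 3 modulo 4 the class is zero; if t is 1, its cube lies in degree 3 modulo 4; if t is 2,
    its square lies in a degree divisible by 4 and has zero symbol, so [symbol_inj4] applies. *)
Lemma HH_deg_nilpotent t z : ~~ (4 %| t)%N -> HH_deg t z -> exists n, z ^+ n = 0.
Proof.
move=> t4 zt.
have [t3|t3] := eqVneq (t %% 4)%N 3%N; first by exists 1; rewrite expr1; exact: HH_deg3 t3 zt.
have z2 := HH_degM zt zt.
have [t1|t1] := eqVneq (t %% 4)%N 1%N.
  exists 3%N; rewrite exprS expr2; apply: (HH_deg3 _ (HH_degM zt z2)).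
  by rewrite -modnDm -[((t + t) %% 4)%N]modnDm t1.
have t2 : (t %% 4 = 2)%N.
  have := ltn_pmod t (isT : (0 < 4)%N); move: t4 t3 t1; rewrite /dvdn.
  by case: (t %% 4)%N => [|[|[|[|]]]].
exists 2; rewrite expr2; apply: symbol_inj4.
  by apply: HH_deg_pred4 z2; rewrite /dvdn -modnDm t2.
rewrite symbolM [symbol z](_ : _ = 0) ?mul0r //; apply/polyP => n; rewrite coef0.
apply: symbol_deg zt _; apply: contra t4 => /eqP ->; exact: dvdn_mulr.
Qed.

Fact restr_cocycle (D : pred nat) c :
  cocycle (fun p : {n : nat & P n} => if D (projT1 p) then val c p else 0 : A).
Proof.
have [[hc dc] [N cN]] := submod_valP c.
split; first split=> [n|n x].
- rewrite [cpt _ (n:=n)](_ : _ = fun x : P n => if D n then cpt (val c) x else 0) //.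
  by case: (D n); [exact: hc|exact: bihom_cst0].
- by rewrite /cpt /=; case: ifP => // _; exact: dc.
- by exists N => n leNn x; rewrite /cpt /=; case: ifP => // _; exact: cN.
Qed.
Definition restr D c : cocycles P := @to_submod _ _ (cocycle_submod P) _ (restr_cocycle D c).

Lemma cpt_restr D c n (x : P n) :
  cpt (val (restr D c)) x = if D n then cpt (val c) x else 0.
Proof. by []. Qed.

Lemma supported_restr D c : supported D (restr D c).
Proof. by move=> n nD x; rewrite cpt_restr (negbTE nD). Qed.

Lemma symbol_restr D c n :
  (symbol (cls (restr D c)))`_n = if D (4 * n)%N then (symbol (cls c))`_n else 0.
Proof.
apply/polyP => j; rewrite symbolE /res_cocycle /residue /residue_at cpt_pullback cpt_restr.
by case: ifP => _; rewrite ?symbolE // coef0 chi0.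
Qed.

Lemma restrC D c : c = restr D c + restr (predC D) c.
Proof.
apply/val_inj/funext => -[n x].
rewrite [RHS](_ : _ = cpt (val (restr D c)) x + cpt (val (restr (predC D) c)) x) //.
by rewrite !cpt_restr /=; case: (D n); rewrite ?addr0 ?add0r.
Qed.

Lemma restr_sum c : exists N, c = \sum_(t < N) restr (pred1 (t : nat)) c.
Proof.
have [_ [N cN]] := submod_valP c; exists N.
have sumE n (x : P n) I (r : seq I) (F : I -> cocycles P) :
    cpt (val (\sum_(i <- r) F i)) x = \sum_(i <- r) cpt (val (F i)) x.
  by apply: (big_morph (fun d => cpt (val d) x)).
apply/val_inj/funext => -[n x]; rewrite -![_ (existT _ n x)]/(cpt _ x) sumE.
have [leNn|ltnN] := leqP N n.
  rewrite cN // big1 // => t _; rewrite cpt_restr /=; case: eqP => // nt.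
  by have := ltn_ord t; rewrite -nt ltnNge leNn.
rewrite (bigD1 (Ordinal ltnN)) // big1 => [|t tn].
  by rewrite [RHS]addr0 cpt_restr /= eqxx.
by rewrite cpt_restr /=; case: eqP => // nt; move/eqP: tn; case; apply/val_inj.
Qed.

Lemma HH_deg_restr t c : HH_deg t (cls (restr (pred1 t) c)).
Proof. by exists (restr (pred1 t) c) => //; exact: supported_restr. Qed.

(** Nilpotent classes have zero symbol because the target is a domain. Conversely, if the symbol is
    zero, the part in degrees divisible by 4 vanishes by [symbol_inj4], and the rest is a finite sum
    of homogeneous nilpotent classes. *)
Lemma symbol_nil z : symbol z = 0 <-> ideal_gen (@hnilpotent _ _ P) z.
Proof.
split=> [z0|]; last first.
  move=> Gz; apply: (Gz (fun y => symbol y = 0)); last first.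
    move=> y [_ [n yn]]; have : symbol y ^+ n == 0 by rewrite -symbolX yn symbol0.
    by rewrite expf_eq0 => /andP[_ /eqP].
  split=> [|x y x0 y0|r x x0|r x x0]; first exact: symbol0.
  - by rewrite symbolD x0 y0 addr0.
  - by rewrite symbolM x0 mulr0.
  - by rewrite symbolM x0 mul0r.
have [c cE] := cls_surj z; rewrite {}cE in z0 *.
have [_ ID _ _] := ideal_gen_ideal (@hnilpotent _ _ P).
pose D n := (4 %| n)%N.
have c4 : cls (restr D c) = 0.
  apply: symbol_inj4; last by apply/polyP => n; rewrite symbol_restr z0 coef0 if_same.
  by apply/asboolP; exists (restr D c) => //; exact: supported_restr.
have -> : cls c = cls (restr (predC D) c) by rewrite {1}(restrC D c) raddfD [X in X + _]c4 add0r.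
have [N ->] := restr_sum (restr (predC D) c).
rewrite raddf_sum; apply: (big_ind (ideal_gen (@hnilpotent _ _ P))) => //.
  exact: ideal_gen0.
move=> t _ I HI; apply; split; first by exists t; exact: HH_deg_restr.
have [t4|t4] := boolP (4 %| t)%N; last exact: HH_deg_nilpotent t4 (HH_deg_restr _ _).
exists 1; rewrite expr1; apply: cls_eq0 => n F; rewrite cpt_pullback !cpt_restr /=.
by case: eqP => // nt; rewrite [D n](_ : _ = true) // nt.
Qed.
Definition poly_fun (q : {poly {poly K}}) n : R n -> reg_bimod A :=
  if (4 %| n)%N then koseval (fun j => (q`_(n %/ 4)%N`_j)%:A : reg_bimod A)
  else fun=> 0.

Lemma commutes_vtx_scalar n (r : K) : (4 %| n)%N -> commutes_vtx C n (r%:A : reg_bimod A).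
Proof.
rewrite -Z4_natr0 => /eqP n0 i; rewrite n0 addr0.
rewrite -[LHS]/(vtx C i * r%:A) -[RHS]/(r%:A * vtx C i).
by rewrite -scalerAr -scalerAl mulr1 mul1r.
Qed.

Lemma poly_fun_bihom q n : bihom (poly_fun q (n := n)).
Proof.
rewrite /poly_fun; case: (boolP (4 %| n)%N) => n4; last exact: bihom_cst0.
by apply: koseval_bihom => j _; exact: commutes_vtx_scalar.
Qed.

Lemma poly_fun_kosgen q n j : (size (nth 0%R q n) <= (4 * n).+1)%N ->
  poly_fun q (kosgen C (4 * n) j : R (4 * n)%N) = (q`_n`_j)%:A :> A.
Proof.
move=> sq; have [lej|ltj] := leqP j (4 * n).
  by rewrite /poly_fun dvdn_mulr // koseval_kosgen // mulKn.
rewrite kosgen_high // (bihom0 (poly_fun_bihom q (4 * n))) nth_default ?scale0r //.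
exact: leq_trans sq ltj.
Qed.

(** For n divisible by 4, d g_j is a sum of commutators with u and v, and scalars commute with
    both. *)
Lemma poly_fun_diff q n (F : R n.+1) : (forall n, size (nth 0%R q n) <= (4 * n).+1)%N ->
  poly_fun q (diff F) = 0.
Proof.
move=> sq; have [n4|n4] := boolP (4 %| n)%N; last by rewrite /poly_fun (negbTE n4).
have hf := poly_fun_bihom q n; have [lf fl fr] := hf.
move: F; apply: (bihom_kosgen_ext (bihom_comp (@diff_bihom _ _ _ R n) hf)
  (bihom_cst0 _ (reg_bimod A))) => j _.
have sE : (-1) ^+ n.+1 = -1 :> K.
  by rewrite -signr_odd oddS -[odd n]negbK -dvdn2 (dvdn_trans _ n4).
rewrite [diff _]kosd_kosgen sE scaleN1r (bihomB _ _ hf) !(bihomD _ _ hf).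
have nE : n = (4 * (n %/ 4))%N by rewrite mulnC divnK.
have gE l : poly_fun q (kosgen C n l : R n) = (q`_(n %/ 4)%N`_l)%:A :> A.
  by move: (poly_fun_kosgen l (sq (n %/ 4)%N)); rewrite -nE.
have cE a l : lact a (poly_fun q (kosgen C n l : R n)) = ract (poly_fun q (kosgen C n l : R n)) a.
  by rewrite gE /= -scalerAr -scalerAl mulr1 mul1r.
apply/eqP; rewrite subr_eq0; apply/eqP; rewrite fl fr cE; congr (_ + _).
by case: j => [|j] //; rewrite fl fr cE.
Qed.

Lemma symbol_surj4 (q : {poly {poly K}}) :
  (forall n, size (nth 0%R q n) <= (4 * n).+1)%N ->
  exists2 z, z \in @HH4_pred _ _ P & symbol z = q.
Proof.
move=> sq; pose x : cochain R := fun p => poly_fun q (projT2 p).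
have cx : cocycle_fam x.
  by split=> n; [exact: poly_fun_bihom|move=> F; exact: poly_fun_diff].
have cP : cocycle (pullback psi x).
  split; first exact: pullback_fam; exists (4 * size q)%N => n len y.
  rewrite cpt_pullback [cpt _ _](_ : _ = poly_fun q (psi n y)) // /poly_fun.
  case: ifP => // n4; rewrite /koseval big1 // => j _.
  rewrite [q`_ _]nth_default ?coef0 ?scale0r.
    by rewrite /koseval1 /mid /= !(mul0r, mulr0) subr0 !addr0.
  by rewrite leq_divRL // mulnC.
pose c : cocycles P := @to_submod _ _ (cocycle_submod P) _ cP.
exists (cls c).
  apply/asboolP; exists c => // n n4 y.
  by rewrite [cpt _ _](_ : _ = poly_fun q (psi n y)) // /poly_fun (negbTE n4).
apply/polyP => n; apply/polyP => j; rewrite symbolE.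
rewrite /res_cocycle (residue_coboundary _ _ (pullback2_coboundary psi phi cx)).
by rewrite /residue /residue_at [cpt _ _]poly_fun_kosgen // chiZ chi1 mulr1.
Qed.
End Symbol.

(** * The rational normal quartic *)

Section Veronese.
Variable K : closedFieldType.
Local Notation MP := {mpoly K[5]}.
Local Notation B := {poly {poly K}}.
Local Notation I := (ideal_gen (fun g : MP => g \in zrels K)).
Local Notation q := (@qproj K MP (ProperGens (@zrels_proper K))).
Local Notation z := (zvar K).
Implicit Types (p : MP) (n j a b r : nat) (m : 'X_{1..5}).

(** z_j goes to s^j t^(4-j), dehomogenized: the inner variable records the power of s, the outer one
    a quarter of the degree. *)
Definition vero : MP -> B :=
  mmap (polyC \o polyC) (fun i : 'I_5 => ('X^i)%:P * 'X).
HB.instance Definition _ := GRing.RMorphism.on vero.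

Lemma veroZ (c : K) p : vero (c *: p) = c%:P%:P * vero p.
Proof. exact: mmapZ. Qed.

Lemma vero_z j : (j < 5)%N -> vero (z j) = ('X^j)%:P * 'X.
Proof. by move=> ltj; rewrite /vero mmapX mmap1U inordK. Qed.

Definition zmid r : MP := if r is 0 then 1 else z r.
Definition nform a r b : MP := z 0 ^+ a * zmid r * z 4 ^+ b.
(* The normal monomial of degree n and weight j = 4 b + r, where z_i has weight i;
   meaningful for j <= 4 n only. *)
Definition nf n j : MP := nform (n - (j %/ 4 + (j %% 4 != 0)%N)) (j %% 4) (j %/ 4).

Lemma nform_nf a r b : (r < 4)%N -> nform a r b = nf (a + (b + (r != 0))) (b * 4 + r).
Proof.
by move=> ltr; rewrite /nf divnMDl // modnMDl (divn_small ltr) (modn_small ltr) addn0 addnK.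
Qed.

Lemma nf_nform n j : (j <= 4 * n)%N -> exists a r b, [/\ (r < 4)%N,
  nf n j = nform a r b, n = (a + (b + (r != 0)))%N & j = (b * 4 + r)%N].
Proof.
move=> lej; exists (n - (j %/ 4 + (j %% 4 != 0)%N))%N, (j %% 4)%N, (j %/ 4)%N.
split; rewrite ?ltn_pmod ?subnK -?divn_eq //.
(* It remains to see that the subtraction in [nf] is not truncated: j/4 rounded up is at most n. *)
have lejn := leq_div2r 4 lej; rewrite mulKn // in lejn.
have [j0|j0] := eqVneq (j %% 4)%N 0%N; first by rewrite addn0.
rewrite addn1 ltn_neqAle lejn andbT; apply: contra j0 => /eqP jn.
by have := divn_eq j 4; rewrite jn mulnC; case: (j %% 4)%N => // r jE;
  move: lej; rewrite jE addnS ltnNge leq_addr.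
Qed.

Lemma zrels_ideal (x y : MP) : x - y \in zrels K -> forall c, q (c * x) = q (c * y).
Proof.
move=> xy c; apply/qproj_eqP; rewrite -mulrBr.
have [_ _ Il _] := ideal_gen_ideal (fun g : MP => g \in zrels K); apply: Il.
by move=> J HJ; apply.
Qed.

(** If i is 0 or 4, or r = 0, the product is already normal. Otherwise z_i z_r is one of nine
    products with 0 < i, r < 4, and a single quadric replaces it by some z_s z_t of the same weight
    with s = 0 or t = 4. *)
Lemma z_nform i a r b : (i < 5)%N -> (r < 4)%N ->
  q (z i * nform a r b) = q (nf (a + (b + (r != 0))).+1 (i + (b * 4 + r))).
Proof.
move=> lti ltr; rewrite /nform.
have [->|i0] := eqVneq i 0%N.
  rewrite (_ : nf _ _ = nform a.+1 r b); last by rewrite nform_nf //; congr nf; lia.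
  by congr q; rewrite /nform exprS; ring.
have [->|i4] := eqVneq i 4%N.
  rewrite (_ : nf _ _ = nform a r b.+1); last by rewrite nform_nf //; congr nf; lia.
  by congr q; rewrite /nform exprS; ring.
have [r0|r0] := eqVneq r 0%N.
  rewrite r0 /= mulr1 (_ : nf _ _ = nform a i b); last first.
    rewrite nform_nf; last lia.
    by congr nf; lia.
  by congr q; rewrite /nform; case: i lti i0 i4 => // i _ _ _ /=; ring.
have zE : zmid r = z r by case: r r0 {ltr}.
rewrite zE; set c := z 0 ^+ a * z 4 ^+ b.
have -> : z i * (z 0 ^+ a * z r * z 4 ^+ b) = c * (z i * z r) by rewrite /c; ring.
have rel (s t : nat) a' r' b' : (r' < 4)%N ->
    (z s * z t - z i * z r) \in zrels K -> nform a' r' b' = c * (z s * z t) ->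
    (a' + (b' + (r' != 0%N)) = a + b + 2)%N -> (b' * 4 + r' = i + (b * 4 + r))%N ->
    q (c * (z i * z r)) = q (nf (a + (b + (r != 0%N))).+1 (i + (b * 4 + r))).
  move=> ltr' /zrels_ideal/(_ c) <- <- e1 e2; congr q; rewrite nform_nf // e1 e2.
  by congr nf; lia.
have hi : i \in [:: 1; 2; 3]%N by rewrite !inE; lia.
have hr : r \in [:: 1; 2; 3]%N by rewrite !inE; lia.
move: hi hr; rewrite !inE.
case/or3P => /eqP iE; case/or3P => /eqP rE; rewrite iE rE in rel *.
- by apply: (rel 0%N 2%N a.+1 2%N b); rewrite ?inE ?expr2 ?eqxx ?orbT //;
    first (rewrite /c /nform /zmid ?exprS; ring); lia.
- by apply: (rel 0%N 3%N a.+1 3%N b); rewrite ?inE ?eqxx ?orbT //;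
    first (rewrite /c /nform /zmid ?exprS; ring); lia.
- by apply: (rel 0%N 4%N a.+1 0%N b.+1); rewrite ?inE ?eqxx ?orbT //;
    first (rewrite /c /nform /zmid ?exprS; ring); lia.
- by apply: (rel 0%N 3%N a.+1 3%N b); rewrite ?inE ?[z 2 * z 1]mulrC ?eqxx ?orbT //;
    first (rewrite /c /nform /zmid ?exprS; ring); lia.
- by apply: (rel 0%N 4%N a.+1 0%N b.+1); rewrite ?inE ?expr2 ?eqxx ?orbT //;
    first (rewrite /c /nform /zmid ?exprS; ring); lia.
- by apply: (rel 1%N 4%N a 1%N b.+1); rewrite ?inE ?eqxx ?orbT //;
    first (rewrite /c /nform /zmid ?exprS; ring); lia.
- by apply: (rel 0%N 4%N a.+1 0%N b.+1); rewrite ?inE ?[z 3 * z 1]mulrC ?eqxx ?orbT //;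
    first (rewrite /c /nform /zmid ?exprS; ring); lia.
- by apply: (rel 1%N 4%N a 1%N b.+1); rewrite ?inE ?[z 3 * z 2]mulrC ?eqxx ?orbT //;
    first (rewrite /c /nform /zmid ?exprS; ring); lia.
- by apply: (rel 2%N 4%N a 2%N b.+1); rewrite ?inE ?expr2 ?eqxx ?orbT //;
    first (rewrite /c /nform /zmid ?exprS; ring); lia.
Qed.
End Veronese.

Section VeroneseRing.
Variable K : closedFieldType.
Local Notation MP := {mpoly K[5]}.
Local Notation B := {poly {poly K}}.
Local Notation I := (ideal_gen (fun g : MP => g \in zrels K)).
Local Notation q := (@qproj K MP (ProperGens (@zrels_proper K))).
Local Notation z := (zvar K).
Implicit Types (p : MP) (Q : B) (n j : nat) (m : 'X_{1..5}).

Let qM p p' : q (p * p') = q p * q p'. Proof. exact: rmorphM. Qed.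
Let qZ c p : q (c *: p) = c *: q p. Proof. exact: linearZ. Qed.

Lemma veroD p p' : vero (p + p') = vero p + vero p'. Proof. exact: rmorphD. Qed.
Lemma veroB p p' : vero (p - p') = vero p - vero p'. Proof. exact: rmorphB. Qed.
Lemma veroM p p' : vero (p * p') = vero p * vero p'. Proof. exact: rmorphM. Qed.
Lemma veroX p n : vero (p ^+ n) = vero p ^+ n. Proof. exact: rmorphXn. Qed.

Lemma z_nf i n j : (i < 5)%N -> (j <= 4 * n)%N ->
  q (z i * nf K n j) = q (nf K n.+1 (i + j)).
Proof.
move=> lti lej; have [a [r [b [ltr -> -> ->]]]] := nf_nform K lej.
exact: z_nform.
Qed.

Definition weight m : nat := \sum_(i < 5) i * m i.

Lemma weight_le m : (weight m <= 4 * mdeg m)%N.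
Proof.
rewrite /weight mdegE big_distrr /=; apply: leq_sum => i _.
by rewrite leq_mul2r -ltnS ltn_ord orbT.
Qed.

Lemma mpolyX_z m : 'X_[m] = \prod_(i < 5) z i ^+ m i :> MP.
Proof. by rewrite mpolyXE_id; apply: eq_bigr => i _; rewrite /zvar inord_val. Qed.

(** The variables are multiplied in one at a time; the bound on the weight is carried along because
    [z_nf] requires it. *)
Lemma q_mpolyX m : q 'X_[m] = q (nf K (mdeg m) (weight m)).
Proof.
rewrite mpolyX_z mdegE /weight.
pose T n j p := q p = q (nf K n j) /\ (j <= 4 * n)%N.
suff [] : T (\sum_(i < 5) m i)%N (\sum_(i < 5) i * m i)%N (\prod_(i < 5) z i ^+ m i) by [].
elim/big_rec3: _ => [|i p n j _ Tp]; first by rewrite /T /nf /nform /= !expr0 !mul1r.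
elim: (m i) => [|k [IHq IHle]]; first by rewrite muln0 expr0 mul1r.
split; last by rewrite mulnS addSn mulnS -addnA leq_add // -ltnS.
by rewrite exprS -mulrA qM IHq -qM z_nf // mulnS addSn addnA.
Qed.

Lemma vero_mpolyX m : vero ('X_[m] : MP) = ('X^(weight m))%:P * 'X^(mdeg m).
Proof.
rewrite mpolyX_z rmorph_prod mdegE /weight.
elim/big_rec3: _ => [|i p n j _ ->]; first by rewrite !expr0 polyC1 mul1r.
rewrite rmorphXn /= vero_z // exprMn -polyC_exp -exprM !exprD polyCM.
by rewrite mulrACA.
Qed.

Lemma veroE p : vero p = \sum_(m <- msupp p) (p@_m)%:P%:P * (('X^(weight m))%:P * 'X^(mdeg m)).
Proof.
rewrite {1}(mpolyE p) raddf_sum; apply: eq_bigr => m _.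
by rewrite [LHS]veroZ vero_mpolyX.
Qed.

Lemma coef_mono (c : K) (w d n : nat) :
  (c%:P%:P * (('X^w)%:P * 'X^d) : B)`_n = (c%:P * 'X^w) *+ (n == d).
Proof.
by rewrite mulrA -polyCM coefCM coefXn; case: eqP; rewrite ?mulr1 ?mulr0.
Qed.

Lemma size_vero p n : (size (nth 0%R (vero p) n) <= (4 * n).+1)%N.
Proof.
rewrite veroE coef_sum; apply: (big_ind (fun r : {poly K} => (size r <= (4 * n).+1)%N)).
- by rewrite size_poly0.
- by move=> r s lr ls; rewrite (leq_trans (size_polyD _ _)) // geq_max lr.
- move=> m _; rewrite coef_mono; case: eqP => [->|_]; last by rewrite size_poly0.
  rewrite mulr1n mul_polyC (leq_trans (size_scale_leq _ _)) // size_polyXn ltnS.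
  exact: weight_le.
Qed.

(** On images of polynomials of size at most N this is a linear inverse to the map that [vero]
    induces on the quotient, whence the kernel of [vero]. A cutoff N independent of [Q] keeps it
    linear. *)
Definition nfsum N Q : zalg K :=
  \sum_(n < N) \sum_(j < (4 * n).+1) Q`_n`_j *: q (nf K n j).

Lemma nfsumP N c Q Q' : nfsum N (c%:P%:P * Q + Q') = c *: nfsum N Q + nfsum N Q'.
Proof.
rewrite /nfsum scaler_sumr -big_split; apply: eq_bigr => n _ /=.
rewrite scaler_sumr -big_split; apply: eq_bigr => j _ /=.
by rewrite coefD coefCM coefD coefCM scalerDl scalerA.
Qed.

Lemma nfsum0 N : nfsum N 0 = 0.
Proof. by rewrite /nfsum big1 // => n _; rewrite big1 // => j _; rewrite !coef0 scale0r. Qed.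

Lemma nfsum_mono N (w d : nat) : (d < N)%N -> (w <= 4 * d)%N ->
  nfsum N (('X^w)%:P * 'X^d) = q (nf K d w).
Proof.
move=> ltd lew; have cE n : (('X^w)%:P * 'X^d : B)`_n = 'X^w *+ (n == d).
  by have := coef_mono 1 w d n; rewrite !polyC1 !mul1r.
rewrite /nfsum (bigD1 (Ordinal ltd)) //= [X in _ + X]big1 ?addr0 => [|n nd]; last first.
  rewrite big1 // => j _; rewrite cE; case: eqP => [nd'|_]; last by rewrite coef0 scale0r.
  by case/eqP: nd; exact/val_inj.
rewrite (bigD1 (Ordinal (lew : (w < (4 * d).+1)%N))) //= big1 ?addr0 => [|j jw].
  by rewrite cE eqxx coefXn eqxx scale1r.
rewrite cE eqxx coefXn; case: eqP => [jw'|_]; last by rewrite scale0r.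
by case/eqP: jw; exact/val_inj.
Qed.

Lemma nfsum_vero N p : (msize p <= N)%N -> nfsum N (vero p) = q p.
Proof.
move=> lep; rewrite veroE [in RHS](mpolyE p) raddf_sum.
have nD Q Q' : nfsum N (Q + Q') = nfsum N Q + nfsum N Q'.
  by have := nfsumP N 1 Q Q'; rewrite !polyC1 mul1r scale1r.
rewrite (big_morph _ nD (nfsum0 N)) !big_seq; apply: eq_bigr => m mp.
have := nfsumP N (p@_m) (('X^(weight m))%:P * 'X^(mdeg m)) 0; rewrite !addr0 nfsum0 addr0 => ->.
rewrite nfsum_mono ?weight_le //; last exact: leq_trans (msize_mdeg_lt mp) lep.
by rewrite -q_mpolyX -qZ.
Qed.

Lemma vero_ker p : vero p = 0 <-> I p.
Proof.
split=> [p0|Ip].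
  have := nfsum_vero (leqnn (msize p)); rewrite p0 nfsum0 -(raddf0 q).
  by move/esym/qproj_eqP; rewrite subr0.
apply: (Ip (fun p => vero p = 0)).
  split=> [|r s r0 s0|r s s0|r s s0]; first exact: rmorph0.
  - by rewrite veroD r0 s0 addr0.
  - by rewrite veroM s0 mulr0.
  - by rewrite veroM s0 mul0r.
move=> g; rewrite !inE => /or4P[||| /or3P[||]] /eqP ->;
  rewrite veroB ?expr2 !veroM !vero_z // !(polyCM, expr2, exprS) ?expr0 ?mulr1;
  ring.
Qed.

Lemma nf_homog n j : (j <= 4 * n)%N -> nf K n j \is n.-homog.
Proof.
move=> lej; have [a [r [b [ltr -> -> _]]]] := nf_nform K lej.
have zH i : z i \is 1.-homog by rewrite /zvar dhomogX /= mdeg1.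
have zX i k : z i ^+ k \is k.-homog.
  by have := dhomogMn k (zH i); rewrite mul1n.
have mH : zmid K r \is (r != 0%N).-homog by case: r ltr => [|r] _; [exact: dhomog1|exact: zH].
by rewrite [(b + _)%N]addnC addnA; apply: dhomogM => //; apply: dhomogM.
Qed.

Lemma vero_nf n j : (j <= 4 * n)%N -> vero (nf K n j) = ('X^j)%:P * 'X^n.
Proof.
move=> lej; have [a [r [b [ltr -> -> ->]]]] := nf_nform K lej.
rewrite /nform !veroM !veroX !vero_z // expr0 polyC1 mul1r.
have -> : vero (zmid K r) = ('X^r)%:P * 'X^(r != 0%N).
  case: r ltr => [|r] ltr; first by rewrite rmorph1 !expr0 polyC1 mul1r.
  by rewrite vero_z // ltnW.
have -> : (('X^4)%:P * 'X) ^+ b = ('X^(b * 4))%:P * 'X^b :> B.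
  by rewrite exprMn -polyC_exp -exprM mulnC.
by rewrite [in RHS](exprD _ (b * 4)) polyCM !exprD; ring.
Qed.

Lemma vero_surj Q t : (forall n, size (nth 0%R Q n) <= (4 * n).+1)%N ->
  exists p, vero p = Q /\ ((forall n, t != (4 * n)%N -> Q`_n = 0) -> zdeg t p).
Proof.
move=> sQ; pose p : MP := \sum_(n < size Q) \sum_(j < (4 * n).+1) Q`_n`_j *: nf K n j.
have vS J (s : seq J) (F : J -> MP) : vero (\sum_(i <- s) F i) = \sum_(i <- s) vero (F i).
  by apply: (big_morph _ veroD); exact: rmorph0.
have pQ : vero p = Q.
  apply/polyP => n; rewrite /p vS coef_sum.
  have tE (k : 'I_(size Q)) : (vero (\sum_(j < (4 * k).+1) Q`_k`_j *: nf K k j))`_n =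
      Q`_k *+ (n == k).
    have jE (j : 'I_(4 * k).+1) : (vero (Q`_k`_j *: nf K k j))`_n =
        ((Q`_k`_j)%:P * 'X^j) *+ (n == k).
      have lej : (j <= 4 * k)%N by rewrite -ltnS.
      by rewrite veroZ vero_nf // coef_mono.
    rewrite vS coef_sum (eq_bigr _ (fun l _ => jE l)) sumrMnl; congr (_ *+ _).
    transitivity (\poly_(j < (4 * k).+1) Q`_k`_j).
      by rewrite poly_def; apply: eq_bigr => j _; rewrite mul_polyC.
    apply/polyP => j; rewrite coef_poly; case: leqP => // ltj.
    by rewrite nth_default // (leq_trans (sQ k)).
  rewrite (eq_bigr _ (fun k _ => tE k)); have [len|ltn] := leqP (size Q) n.
    rewrite nth_default // big1 // => k _; case: eqP => // nk.
    by have := ltn_ord k; rewrite -nk ltnNge len.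
  rewrite (bigD1 (Ordinal ltn)) //= eqxx mulr1n big1 ?addr0 // => k kn.
  by case: eqP => // nk; case/eqP: kn; exact/val_inj.
exists p; split=> // Qt.
(* The zero polynomial singles out no degree; p then has no monomials and the condition is void. *)
have [Q0|Q0] := eqVneq Q 0.
  by move=> m; rewrite /p Q0 size_poly0 big_ord0 msupp0.
have [n Qn] : exists n, Q`_n != 0 by exists (size Q).-1; rewrite -lead_coefE lead_coef_eq0.
have tn : t = (4 * n)%N by apply/eqP; apply: contraNT Qn => /Qt ->.
have pH : p \is n.-homog.
  apply: rpred_sum => k _; have [kn|kn] := eqVneq (k : nat) n.
    by apply: rpred_sum => j _; rewrite -kn; apply: rpredZ; apply: nf_homog; rewrite -ltnS.
  rewrite Qt ?tn ?eqn_mul2l //= 1?eq_sym // big1 ?rpred0 // => j _.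
  by rewrite coef0 scale0r.
by move=> m /(dhomogP _ _ _ pH) mE; rewrite tn mE.
Qed.

Lemma vero_deg t p : zdeg t p -> forall n, t != (4 * n)%N -> (vero p)`_n = 0.
Proof.
move=> tp n tn; rewrite veroE coef_sum big_seq big1 // => m /tp tm.
by rewrite coef_mono; case: eqP => // nm; rewrite nm tm eqxx in tn.
Qed.
End VeroneseRing.

(** * Graded algebras embedded in a common ring *)

Section Transport.
Variable K : fieldType.
Local Notation B := {poly {poly K}}.

Record embedding (R : algType K) (f : R -> B) : Prop := Embedding {
  emb_linear : forall (a : K) x y, f (a *: x + y) = a%:P%:P * f x + f y;
  emb1 : f 1 = 1;
  embM : forall x y, f (x * y) = f x * f y;
  emb_inj : injective f
}.

(** If 4 does not divide t, this forces [Q] to be 0. *)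
Definition poly_deg (t : nat) (Q : B) : Prop := forall n, t != (4 * n)%N -> Q`_n = 0.

(** Each x has a y with g y = f x; as g is injective, this choice is linear and multiplicative. *)
Lemma embedding_iso (R S : algType K) (f : R -> B) (g : S -> B)
    (gR : nat -> R -> Prop) (gS : nat -> S -> Prop) :
  embedding f -> embedding g ->
  (forall x, exists y, g y = f x) -> (forall y, exists x, f x = g y) ->
  (forall t x, gR t x <-> poly_deg t (f x)) -> (forall t y, gS t y <-> poly_deg t (g y)) ->
  graded_iso R S gR gS.
Proof.
move=> ef eg fg gf gRE gSE.
pose h x : S := sval (cid (fg x)).
pose k y : R := sval (cid (gf y)).
have hE x : g (h x) = f x by rewrite /h; case: cid.
have kE y : f (k y) = g y by rewrite /k; case: cid.
have hl : linear h.
  move=> a x y; apply: (emb_inj eg); rewrite (emb_linear eg) !hE.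
  exact: emb_linear ef _ _ _.
have hm : monoid_morphism h.
  split; first by apply: (emb_inj eg); rewrite hE (emb1 ef) (emb1 eg).
  by move=> x y; apply: (emb_inj eg); rewrite (embM eg) !hE (embM ef).
pose H : {lrmorphism R -> S} := HB.pack h (GRing.isLinear.Build K R S _ h hl)
  (GRing.isMonoidMorphism.Build R S h hm).
exists H; first exists k.
- by move=> x; apply: (emb_inj ef); rewrite kE hE.
- by move=> y; apply: (emb_inj eg); rewrite hE kE.
- by move=> t x; rewrite gRE gSE /= hE.
Qed.
End Transport.

Theorem theorem4p1 (K : closedFieldType)
    (P : proj_resolution (reg_bimod (algA K))) :
  [/\ graded_iso (HH_red P) (HH4 P) (HH_red_deg (P := P)) (HH4_deg (P := P)),
      graded_iso (HH4 P) (zalg K) (HH4_deg (P := P)) (zalg_deg (K := K))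
    & finitely_generated (HH_red P)].
Proof.
pose C := algA_cover K.
have [phi] := chain_map_ex (kos_resolution C) P.
have [psi] := chain_map_ex P (kos_resolution C).
pose sy : HH P -> {poly {poly K}} := symbol phi.
have syP a x y : sy (a *: x + y) = a%:P%:P * sy x + sy y by exact: symbolP.
have syB x y : sy (x - y) = sy x - sy y.
  by rewrite -scaleN1r addrC syP !(polyCN, polyC1) mulN1r addrC.
pose f4 (x : HH4 P) := sy (val x).
(* [fr] and [fz] use an arbitrary representative; [symbol_nil] and [vero_ker] show that the value
   does not depend on it. *)
pose fr (x : HH_red P) := sy (lift_rep x).
pose fz (x : zalg K) := vero (lift_rep x).
have rP (x y : HH P) : qproj (ProperGens (@hnilpotent_proper _ _ P)) x =
    qproj (ProperGens (@hnilpotent_proper _ _ P)) y <-> sy (x - y) = 0.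
  by rewrite (symbol_nil phi psi); exact: qproj_eqP.
have zP p p' : qproj (ProperGens (@zrels_proper K)) p =
    qproj (ProperGens (@zrels_proper K)) p' <-> vero (p - p') = 0.
  by rewrite vero_ker; exact: qproj_eqP.
have frE x : fr (qproj _ x) = sy x.
  apply/eqP; rewrite -subr_eq0 -syB; apply/eqP/rP.
  exact: lift_repK.
have fzE p : fz (qproj _ p) = vero p.
  apply/eqP; rewrite -subr_eq0 -veroB; apply/eqP/zP.
  exact: lift_repK.
have e4 : embedding f4.
  split=> [a x y||x y|x y xy].
  - exact: syP.
  - exact: symbol1.
  - exact: symbolM.
  apply/val_inj/eqP; rewrite -subr_eq0; apply/eqP.
  apply: (symbol_inj4 (phi := phi) psi); last by rewrite [LHS]syB;
    apply/eqP; rewrite subr_eq0; apply/eqP.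
  by rewrite rpredB //; exact: valP.
have er : embedding fr.
  split=> [a x y||x y|x y].
  - have [[x' ->] [y' ->]] := (qproj_surj x, qproj_surj y).
    by rewrite -linearP !frE syP.
  - exact: etrans (frE 1) (symbol1 _).
  - have [[x' ->] [y' ->]] := (qproj_surj x, qproj_surj y).
    by rewrite -rmorphM !frE; exact: symbolM.
  have [[x' ->] [y' ->]] := (qproj_surj x, qproj_surj y).
  rewrite !frE => xy; apply/rP.
  by rewrite [LHS]syB; apply/eqP; rewrite subr_eq0; apply/eqP.
have ez : embedding fz.
  split=> [a x y||x y|x y].
  - have [[x' ->] [y' ->]] := (qproj_surj x, qproj_surj y).
    by rewrite -linearP !fzE veroD veroZ.
  - exact: etrans (fzE 1) (rmorph1 _).
  - have [[x' ->] [y' ->]] := (qproj_surj x, qproj_surj y).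
    by rewrite -rmorphM !fzE veroM.
  have [[x' ->] [y' ->]] := (qproj_surj x, qproj_surj y).
  rewrite !fzE => xy; apply/zP.
  by rewrite veroB xy subrr.
have s4 (Q : {poly {poly K}}) : (forall n, size (nth 0%R Q n) <= (4 * n).+1)%N ->
    exists x, f4 x = Q.
  by move=> /(symbol_surj4 phi psi)[x x4 <-]; exists (HH4Sub x4).
have sr (Q : {poly {poly K}}) : (forall n, size (nth 0%R Q n) <= (4 * n).+1)%N ->
    exists x, fr x = Q.
  by move=> /(symbol_surj4 phi psi)[x _ <-]; exists (qproj _ x).
have sz (Q : {poly {poly K}}) : (forall n, size (nth 0%R Q n) <= (4 * n).+1)%N ->
    exists x, fz x = Q.
  by move=> /(@vero_surj _ _ 0)[p [<- _]]; exists (qproj _ p).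
(* When the symbol sits in degree t, the components of the class in other degrees have symbol zero
   and may be discarded. *)
have symbol_restr_deg t c : poly_deg t (sy (cls c)) ->
    sy (cls (restr (pred1 t) c)) = sy (cls c).
  move=> tc; apply/polyP => n; rewrite /sy symbol_restr /=; case: eqP => // /eqP nt.
  by rewrite -[symbol _ _]/(sy _) tc // eq_sym.
have restr_eq t x : poly_deg t (sy x) -> exists2 y, HH_deg t y & sy y = sy x.
  have [c ->] := cls_surj x => tx.
  exists (cls (restr (pred1 t) c)); first exact: HH_deg_restr.
  exact: symbol_restr_deg.
have d4 t x : HH4_deg t x <-> poly_deg t (f4 x).
  split=> [tx n tn|]; first exact: symbol_deg tx tn.
  rewrite /HH4_deg /f4; case: x => x /= x4 tx; have /asboolP[c xc c4] := x4.
  have [y [y4 ty yx]] : exists y, [/\ y \in @HH4_pred _ _ P, HH_deg t y & sy y = sy x].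
    exists (cls (restr (pred1 t) c)); split; first apply/asboolP.
    - exists (restr (pred1 t) c) => // n n4 z; rewrite cpt_restr.
      by case: ifP => // _; exact: c4.
    - exact: HH_deg_restr.
    - by rewrite xc; apply: symbol_restr_deg; rewrite -xc.
  suff -> : x = y by [].
  apply/eqP; rewrite -subr_eq0; apply/eqP.
  apply: (symbol_inj4 (phi := phi) psi); first by rewrite rpredB.
  by rewrite [LHS]syB yx subrr.
have dr t x : HH_red_deg t x <-> poly_deg t (fr x).
  have [x' ->] := qproj_surj x; rewrite frE; split=> [[r tr /esym xr] n tn|tx].
    by rewrite -frE -xr frE; exact: symbol_deg tr tn.
  have [y ty yx] := restr_eq t x' tx; exists y => //.
  apply/rP; rewrite [LHS]syB yx subrr.
  by [].
have dz t x : zalg_deg t x <-> poly_deg t (fz x).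
  split=> [[p tp ->] n tn|tx]; first by rewrite fzE; exact: vero_deg tp _ tn.
  have [p [pE pt]] := vero_surj t (fun n => size_vero (lift_rep x) n).
  exists p; first exact: pt.
  by apply: (emb_inj ez); rewrite fzE pE.
split.
- apply: (embedding_iso er e4) => // x; [apply: s4|apply: sr] => n; exact: size_symbol.
- apply: (embedding_iso e4 ez) => // x; [apply: sz => n; exact: size_symbol|].
  by apply: s4 => n; exact: size_vero.
(* The generators are preimages of the images of z_0, ..., z_4; for j > 4 a dummy value makes [g]
   total. *)
have ex0 j : exists x, (j < 5)%N -> fr x = ('X^j)%:P * 'X.
  have [ltj|_] := boolP (j < 5)%N; last by exists 0.
  have [x xE] := sr _ (fun n => size_vero (zvar K j) n).
  by exists x; rewrite xE vero_z.
pose g j := sval (cid (ex0 j)).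
have gE j : (j < 5)%N -> fr (g j) = ('X^j)%:P * 'X by rewrite /g; case: cid.
exists [seq g j | j <- iota 0 5] => D [D1 DP DM] Dg x.
have D0 : D 0 by rewrite -(addNr 1) -scaleN1r; apply: DP.
have fr0 : fr 0 = 0.
  have := emb_linear er (-1) 0 0; rewrite scaler0 addr0 => ->.
  by rewrite !(polyCN, polyC1) mulN1r addNr.
(* A subalgebra with these generators contains a preimage of each [vero p]; by [vero_surj] and
   injectivity of [fr] these are all elements. *)
have Dp p : exists2 y, D y & fr y = vero p.
  elim/mpolyind: p => [|c m p _ _ [y Dy yE]]; first by exists 0; rewrite ?rmorph0.
  suff [y' Dy' y'E] : exists2 y', D y' & fr y' = vero 'X_[m].
    exists (c *: y' + y); first exact: DP.
    rewrite (emb_linear er) y'E yE; by rewrite veroD veroZ.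
  rewrite mpolyX_z; elim/big_rec: _ => [|i p' _ [y' Dy' y'E]].
    by exists 1; rewrite ?(emb1 er) ?rmorph1.
  elim: (m i) => [|k [y2 Dy2 y2E]]; first by exists y'; rewrite ?expr0 ?mul1r.
  exists (g i * y2).
    apply: DM => //; apply: Dg; apply/mapP; exists (i : nat) => //.
    by rewrite mem_iota ltn_ord.
  by rewrite (embM er) y2E gE // (exprS (zvar K i)) -[in RHS]mulrA [in RHS]veroM vero_z.
have [p [pE _]] : exists p, vero p = fr x /\ _ :=
  vero_surj 0 (fun n => size_symbol phi (lift_rep x) n).
by have [y Dy yE] := Dp p; rewrite (emb_inj er (etrans (esym pE) (esym yE))).
Qed.
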